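(* Let $u:\mathbb{R}\to\mathbb{R}\cup\{-\infty\}$ be increasing and concave on the interior $(a,\infty)$, $a\in[-\infty,0)$, of its effective domain, with $\lim_{x\to-\infty}u(x)=-\infty$. If $W\in L^{\widehat u}_+$ satisfies $$\sup_{k\in K^W}E[u(x+k)]<u(+\infty)\quad\text{for some } x>a,$$ then $\mathcal{M}^W$ is not empty and $$U^W(x):=\sup_{k\in K^W}E[u(x+k)]=\sup_{f\in C^W}E[u(x+f)]=\min_{\lambda>0,\;Q\in\mathcal{M}^W}\left\{\lambda\,(x+\|Q_s\|)+E\left[\Phi\left(\lambda\frac{dQ_r}{dP}\right)\right]\right\},$$ where $Q=Q_r+Q_s$ is the decomposition of $Q$ into its regular and singular parts (the last minimum being attained).
   Context: Market: $T\in(0,\infty]$; $S$ is an $\mathbb{R}^d$-valued càdlàg semimartingale (not necessarily locally bounded) on a filtered probability space $(\Omega,\mathcal{F},(\mathcal{F}_t)_{t\in[0,T]},P)$ satisfying the usual conditions, with $\mathcal{F}_0$ trivial; if $T=\infty$, every process $Y$ considered is assumed to have a limit $Y_\infty=\lim_{t\uparrow\infty}Y_t$. $L(S)$ is the set of $\mathbb{R}^d$-valued predictable $S$-integrable processes and $H\cdot S$ is the stochastic integral. For $W\in L^0_+$, $\mathcal{H}^W=\{H\in L(S): \exists c>0,\ (H\cdot S)_t\ge -cW\ \forall t\le T\}$ and $K^W=\{(H\cdot S)_T: H\in\mathcal{H}^W\}$. Utility and conjugate: ''increasing'' is in the weak sense (u may be constant for large arguments); if $a$ is finite, $u(x)=-\infty$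 for $x<a$; $u(+\infty)=\lim_{x\to\infty}u(x)$. $\Phi(y)=\sup_{x\in\mathbb{R}}\{u(x)-xy\}$ for $y\ge0$, with $\Phi(0)=u(+\infty)$. Expectations $E[u(\cdot)]$ are set to $-\infty$ whenever the negative part has infinite expectation. Orlicz spaces: $\widehat u(x)=-u(-|x|)+u(0)$, $L^{\widehat u}=\{f\in L^0:\exists\alpha>0,\ E[\widehat u(\alpha f)]<\infty\}$ with the Luxemburg norm $N_{\widehat u}(f)=\inf\{c>0: E[\widehat u(f/c)]\le1\}$ (a Banach lattice); $\widehat\Phi(y)=\sup_{x}\{xy-\widehat u(x)\}$ and $L^{\widehat\Phi}$ is the corresponding Orlicz space. The norm dual decomposes as $(L^{\widehat u})^*=\mathcal{A}\oplus\mathcal{A}^d$, where $\mathcal{A}$ is the band of order-continuous functionals and $\mathcal{A}^d$ is the band of singular functionals, i.e. those lattice-disjoint from $\mathcal{A}$. Each $z$ is uniquely $z=z_r+z_s$ with $z_r\in\mathcal{A}$ (regular part), $z_s\in\mathcal{A}^d$ (singular part). The functional $z_r$ is identified with a density $\frac{dz_r}{dP}\in L^{\widehat\Phi}$ via $z_r(f)=E[f\frac{dz_r}{dP}]$. $\|\cdot\|$ is the dual norm on $(L^{\widehat u})^*$. Primal and dual sets: $C^W=(K^W-L^0_+)\cap L^{\widehat u}$; $(C^W)^0=\{z\in(L^{\widehat u})^*: z(f)\le0\ \forall f\in C^W\}$; $\mathcal{M}^W=\{Q\in(C^W)^0: Q(I_\Omega)=1\}$, where $I_\Omega$ is the constant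 function $1$. *)

(* Defs.v *)
From HB Require Import structures.
From mathcomp Require Import all_boot all_order all_algebra.
From mathcomp Require Import all_classical all_reals all_analysis.
Set Implicit Arguments.
Unset Strict Implicit.
Unset Printing Implicit Defensive.
Import Order.TTheory GRing.Theory Num.Theory.
Import numFieldNormedType.Exports.
Local Open Scope classical_set_scope.
Local Open Scope ring_scope.

(** Random variables are functions [Omega -> R]; elements of L^0 and of the
    Orlicz spaces are represented by their versions, and every notion below is
    invariant under almost sure equality. *)

Section Preliminaries.
Context {disp : measure_display} {Omega : measurableType disp} {R : realType}.
Variable P : probability Omega R.

Definition ae_le (f g : Omega -> R) : Prop := {ae P, forall w, f w <= g w}.

Definition measurable_wrt (G : set (set Omega)) (f : Omega -> R) : Prop :=
  forall B : set R, measurable B -> G (f @^-1` B).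

Definition Lzero : set (Omega -> R) := [set f | measurable_fun setT f].

Definition Lzero_pos : set (Omega -> R) :=
  [set f | Lzero f /\ ae_le (cst 0) f].

Definition expected_utility (g : Omega -> \bar R) : \bar R :=
  if (\int[P]_w (g^\- w) == +oo)%E then -oo%E else (\int[P]_w g w)%E.

Definition is_minimum (m : \bar R) (A : set (\bar R)) : Prop :=
  A m /\ lbound A m.

End Preliminaries.

(** * Market *)

(** Time runs through [[0, T]], a subset of [\bar R] since [T = +oo] is allowed;
    the values of a process outside [[0, T]] are irrelevant. *)

Section Market.
Context {disp : measure_display} {Omega : measurableType disp} {R : realType}.
Variables (P : probability Omega R) (T : \bar R) (F : \bar R -> set (set Omega)).

Definition process : Type := \bar R -> Omega -> R.

Definition usual_filtration : Prop :=
  [/\ forall t, (0 <= t <= T)%E ->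
        sigma_algebra setT (F t) /\ F t `<=` measurable,
      forall s t, (0 <= s)%E -> (s <= t)%E -> (t <= T)%E -> F s `<=` F t,
      forall t, (0 <= t < T)%E ->
        F t = \bigcap_(s in [set s | (t < s <= T)%E]) F s
    & P.-negligible `<=` F 0%E].

Definition trivial_initial : Prop :=
  forall A, F 0%E A -> P A = 0%E \/ P A = 1%E.

Definition adapted (X : process) : Prop :=
  forall t, (0 <= t <= T)%E -> measurable_wrt (F t) (X t).

Definition cadlag (X : process) : Prop := forall w,
  (forall t : R, 0 <= t -> (t%:E < T)%E ->
     X s%:E w @[s --> t^'+] --> X t%:E w) /\
  (forall t : R, 0 < t -> (t%:E <= T)%E -> cvg (X s%:E w @[s --> t^'-])).

(** When [T = +oo], the terminal value [X +oo] is the limit of the paths. *)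
Definition has_terminal_value (X : process) : Prop :=
  T = +oo%E -> {ae P, forall w, X s%:E w @[s --> +oo] --> X +oo%E w}.

Definition martingale (M : process) : Prop :=
  [/\ adapted M,
      forall t : R, 0 <= t -> (t%:E <= T)%E ->
        P.-integrable setT (EFin \o M t%:E)
    & forall s t : R, 0 <= s -> s <= t -> (t%:E <= T)%E ->
        forall A, F s%:E A ->
        (\int[P]_(w in A) (M t%:E w)%:E = \int[P]_(w in A) (M s%:E w)%:E)%E].

Definition stopping_time (tau : Omega -> \bar R) : Prop :=
  (forall w, (0 <= tau w)%E) /\
  (forall t, (0 <= t <= T)%E -> F t [set w | (tau w <= t)%E]).

Definition stopped (M : process) (tau : Omega -> \bar R) : process :=
  fun t w => M (Order.min t (tau w)) w.

(** Localization is on the real times of [[0, T]]: if [T = +oo] the stopping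
    times increase to infinity, and if [T] is finite they eventually reach [T]. *)
Definition local_martingale (M : process) : Prop :=
  [/\ adapted M, cadlag M
    & exists tau : nat -> Omega -> \bar R,
      [/\ forall n, stopping_time (tau n),
          forall n w, (tau n w <= tau n.+1 w)%E,
          {ae P, forall w, forall t : R, (t%:E <= T)%E ->
             exists n, (t%:E <= tau n w)%E}
        & forall n, martingale (stopped M (tau n))]].

Definition finite_variation (A : process) : Prop :=
  [/\ adapted A, cadlag A
    & forall w (t : R), 0 <= t -> (t%:E <= T)%E ->
        bounded_variation 0 t (fun s => A s%:E w)].

Definition semimartingale (X : process) : Prop :=
  [/\ adapted X, cadlag X
    & exists M A : process,
      [/\ local_martingale M, finite_variation A
        & {ae P, forall w, forall t : R, 0 <= t -> (t%:E <= T)%E ->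
             X t%:E w = M t%:E w + A t%:E w}]].

(** ** Elementary integrals *)

(** The elementary predictable process [xi * 1_(]s, t])]. *)
Record elementary := Elementary {
  el_left : R;
  el_right : R;
  el_coef : Omega -> R;
  el_left_ge0 : 0 <= el_left;
  el_le : el_left <= el_right;
  el_right_le : (el_right%:E <= T)%E;
  el_measurable : measurable_wrt (F el_left%:E) el_coef;
  el_bounded : exists C : R, forall w, `|el_coef w| <= C }.

(** A simple predictable process is a finite sum of elementary ones. *)
Definition simple_process : Type := seq elementary.

Definition simple_eval (h : simple_process) (t : R) (w : Omega) : R :=
  \sum_(e <- h) el_coef e w * (el_left e < t <= el_right e)%R%:R.

Definition simple_int (h : simple_process) (X : process) : process := fun t w =>
  \sum_(e <- h) el_coef e w *
    (X (Order.min (el_right e)%:E t) w - X (Order.min (el_left e)%:E t) w).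

(** Convergence in Emery's semimartingale topology (for adapted cadlag
    processes null at 0): for each real [t <= T], [(K . (X_n - X))_t] tends to
    0 in probability, uniformly over the simple predictable [K] with
    [|K| <= 1]. *)
Definition emery_cvg (Xn : nat -> process) (X : process) : Prop :=
  forall t : R, 0 <= t -> (t%:E <= T)%E ->
  forall eps eta : R, 0 < eps -> 0 < eta ->
  \forall n \near \oo, forall K : simple_process,
    (forall s w, `|simple_eval K s w| <= 1) ->
    (P [set w | eps < `|simple_int K (fun r v => Xn n r v - X r v) t%:E w|]%R
       <= eta%:E)%E.

Definition integral_path (X : process) : Prop :=
  [/\ adapted X, cadlag X & forall w, X 0%E w = 0].

(** ** Vector stochastic integral *)

Section Integral.
Variables (d : nat) (S : \bar R -> Omega -> 'rV[R]_d).

Definition coordinate (j : 'I_d) : process := fun t w => S t w ord0 j.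

Definition integrand : Type := R -> Omega -> 'rV[R]_d.

Definition time_space : set (R * Omega) :=
  [set p | 0 <= p.1 /\ (p.1%:E <= T)%E].

Definition predictable_rectangles : set (set (R * Omega)) :=
  [set B | (exists2 A, F 0%E A & B = [set 0] `*` A) \/
    exists s t A, [/\ 0 <= s, s <= t, (t%:E <= T)%E, F s%:E A
                    & B = [set r | s < r <= t] `*` A]].

Definition predictable (H : integrand) : Prop :=
  forall (j : 'I_d) (B : set R), measurable B ->
    <<s time_space, predictable_rectangles >>
      (time_space `&` [set p | B (H p.1 p.2 ord0 j)]).

Definition pointwise_cvg (Hn : nat -> integrand) (H : integrand) : Prop :=
  forall (t : R) w (j : 'I_d), 0 < t -> (t%:E <= T)%E ->
    Hn n t w ord0 j @[n --> \oo] --> H t w ord0 j.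

(** [bounded_integral H X]: [X] is (a cadlag version of) the integral of the
    bounded predictable process [H]. This is the extension of the elementary
    integral by dominated convergence; the simple processes generate the
    predictable sigma-algebra of [(0, T] x Omega], so that by the monotone
    class theorem all bounded predictable integrands are reached. The value of
    [H] at time 0 plays no role. *)
Inductive bounded_integral : integrand -> process -> Prop :=
| bounded_integral_simple (h : 'I_d -> simple_process) :
    bounded_integral (fun t w => \row_j simple_eval (h j) t w)
      (fun t w => \sum_j simple_int (h j) (coordinate j) t w)
| bounded_integral_lim (Hn : nat -> integrand) (Xn : nat -> process)
    (H : integrand) (X : process) (C : R) :
    (forall n, bounded_integral (Hn n) (Xn n)) ->
    (forall n (t : R) w (j : 'I_d), 0 < t -> (t%:E <= T)%E ->
       `|Hn n t w ord0 j| <= C) ->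
    pointwise_cvg Hn H ->
    integral_path X -> emery_cvg Xn X ->
    bounded_integral H X.

(** [stochastic_integral H X]: [H] belongs to [L(S)] and [X] is a cadlag version
    of [H . S]. As for vector measures, an [S]-integrable process is a pointwise
    limit of bounded predictable processes whose integrals converge, here in
    the semimartingale topology; the limit does not depend on the sequence, and
    the truncations of [H] are such a sequence. *)
Definition stochastic_integral (H : integrand) (X : process) : Prop :=
  predictable H /\
  exists (Hn : nat -> integrand) (Xn : nat -> process),
    [/\ forall n, bounded_integral (Hn n) (Xn n),
        pointwise_cvg Hn H, integral_path X & emery_cvg Xn X].

Definition market : Prop :=
  [/\ (0 < T)%E, usual_filtration, trivial_initial
    & forall j, semimartingale (coordinate j) /\
                has_terminal_value (coordinate j)].

(** ** Admissible strategies and terminal values *)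

(** [admissible W H X]: [H] belongs to [H^W] and [X] is a version of [H . S]. *)
Definition admissible (W : Omega -> R) (H : integrand) (X : process) : Prop :=
  [/\ stochastic_integral H X, has_terminal_value X
    & exists2 c : R, 0 < c &
        {ae P, forall w, forall t, (0 <= t <= T)%E -> - (c * W w) <= X t w}].

Definition K_set (W : Omega -> R) : set (Omega -> R) :=
  [set k | exists H X, admissible W H X /\ k = X T].

End Integral.
End Market.

(** * Utility function *)

Section Utility.
Context {R : realType}.

Definition utility (a : \bar R) (u : R -> \bar R) : Prop :=
  [/\ forall x, u x != +oo%E,
      {homo u : x y / x <= y >-> (x <= y)%E},
      [set x | u x != -oo%E]° = [set x | (a < x%:E)%E],
      (forall x y t : R, (a < x%:E)%E -> (a < y%:E)%E -> 0 <= t <= 1 ->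
         (t%:E * u x + (1 - t)%:E * u y <= u (t * x + (1 - t) * y)%R)%E)
    & u x @[x --> -oo] --> -oo%E].

Variable u : R -> \bar R.

Definition u_infty : \bar R := lim (u x @[x --> +oo]).

Definition Phi (y : R) : \bar R :=
  ereal_sup [set (u x - (x * y)%:E)%E | x in [set: R]].

Definition uhat (x : R) : \bar R := (- u (- `|x|)%R + u 0%R)%E.

Definition Phihat (y : R) : \bar R :=
  ereal_sup [set ((x * y)%:E - uhat x)%E | x in [set: R]].

End Utility.

(** * Orlicz spaces and their duals *)

Section Orlicz.
Context {disp : measure_display} {Omega : measurableType disp} {R : realType}.
Variable P : probability Omega R.

Definition orlicz (Y : R -> \bar R) : set (Omega -> R) :=
  [set f | Lzero f /\
     exists2 al : R, 0 < al & (\int[P]_w Y (al * f w)%R < +oo)%E].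

Definition luxemburg (Y : R -> \bar R) (f : Omega -> R) : \bar R :=
  ereal_inf [set c%:E | c in [set c : R |
    0 < c /\ (\int[P]_w Y (f w / c)%R <= 1)%E]].

Section Dual.
Variable Y : R -> \bar R.

(** Functionals are total on [Omega -> R], but only their restrictions to the
    Orlicz space matter. Boundedness makes them compatible with almost sure
    equality. *)
Definition functional : Type := (Omega -> R) -> R.

Definition dual : set functional :=
  [set z | (forall (b : R) f g, orlicz Y f -> orlicz Y g ->
              z (fun w => b * f w + g w) = b * z f + z g) /\
           exists C : R, forall f, orlicz Y f ->
              (`|z f|%:E <= C%:E * luxemburg Y f)%E].

Definition dual_norm (z : functional) : \bar R :=
  ereal_sup [set `|z f|%:E | f in
    [set f | orlicz Y f /\ (luxemburg Y f <= 1)%E]].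

Definition dual_le (z1 z2 : functional) : Prop :=
  forall f, orlicz Y f -> ae_le P (cst 0) f -> z1 f <= z2 f.

Definition is_modulus (z m : functional) : Prop :=
  [/\ dual m, dual_le z m, dual_le (fun f => - z f) m
    & forall m', dual m' -> dual_le z m' -> dual_le (fun f => - z f) m' ->
        dual_le m m'].

(** [|z1| /\ |z2| = 0] in the dual lattice *)
Definition lattice_disjoint (z1 z2 : functional) : Prop :=
  exists m1 m2, [/\ is_modulus z1 m1, is_modulus z2 m2
    & forall v, dual v -> dual_le v m1 -> dual_le v m2 ->
        dual_le v (fun _ => 0)].

(** A net [f], indexed by the directed preorder [prec], converges to 0 in order
    when it is dominated by a net [g] decreasing to 0. *)
Definition order_cvg0 (I : Type) (prec : I -> I -> Prop) (f : I -> Omega -> R) :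
    Prop :=
  exists g : I -> Omega -> R,
    [/\ forall i, orlicz Y (g i),
        forall i j, prec i j -> ae_le P (g j) (g i),
        forall i, ae_le P (cst 0) (g i),
        (forall h, orlicz Y h -> (forall i, ae_le P h (g i)) ->
           ae_le P h (cst 0))
      & forall i, ae_le P (fun w => `|f i w|) (g i)].

Definition order_continuous (z : functional) : Prop :=
  forall (I : Type) (prec : I -> I -> Prop) (f : I -> Omega -> R),
    inhabited I ->
    (forall i, prec i i) ->
    (forall i j k, prec i j -> prec j k -> prec i k) ->
    (forall i j, exists k, prec i k /\ prec j k) ->
    (forall i, orlicz Y (f i)) -> order_cvg0 prec f ->
    forall eps : R, 0 < eps ->
      exists i0, forall i, prec i0 i -> `|z (f i)| < eps.

Definition regular (z : functional) : Prop := dual z /\ order_continuous z.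

Definition singular (z : functional) : Prop :=
  dual z /\ forall v, regular v -> lattice_disjoint z v.

(** The restriction of [regular_part z] to the Orlicz space is unique. *)
Definition regular_part (z : functional) : functional :=
  xget (fun _ => 0)
    [set zr : functional | regular zr /\ singular (fun f => z f - zr f)].

Definition singular_part (z : functional) : functional :=
  fun f => z f - regular_part z f.

(** The density [dz/dP], in the Orlicz space of the conjugate [Y'] of [Y], is
    unique up to almost sure equality. *)
Definition density (Y' : R -> \bar R) (z : functional) : Omega -> R :=
  xget (fun _ => 0) [set phi : Omega -> R | orlicz Y' phi /\
    forall f, orlicz Y f ->
      P.-integrable setT (fun w => (f w * phi w)%:E) /\
      (z f)%:E = (\int[P]_w (f w * phi w)%:E)%E].

End Dual.

Section DualSets.
Variables (u : R -> \bar R) (K : set (Omega -> R)).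

Definition C_set : set (Omega -> R) :=
  [set f | orlicz (uhat u) f /\
     exists k l, [/\ K k, Lzero_pos P l & f = (fun w => k w - l w)]].

Definition polar_C : set functional :=
  [set z | dual (uhat u) z /\ forall f, C_set f -> z f <= 0].

Definition M_set : set functional :=
  [set Q | polar_C Q /\ Q (cst 1) = 1].

Definition utilities (D : set (Omega -> R)) (x : R) : set (\bar R) :=
  [set expected_utility P (fun w => u (x + k w)) | k in D].

Definition dual_value (x lambda : R) (Q : functional) : \bar R :=
  (lambda%:E * (x%:E + dual_norm (uhat u) (singular_part (uhat u) Q))
   + \int[P]_w Phi u
       (lambda * density (uhat u) (Phihat u) (regular_part (uhat u) Q) w)%R)%E.

Definition dual_values (x : R) : set (\bar R) :=
  [set v | exists (lambda : R) (Q : functional),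
     [/\ 0 < lambda, M_set Q & v = dual_value x lambda Q]].

End DualSets.
End Orlicz.

(* Main.v *)
(** All strategies are admissible up to a multiple of [W], so truncating
    [k \in K^W] from above lands in [C^W] without changing expected utilities in
    the limit. On the Orlicz space the value function [g |-> sup_(f in C^W)
    E[u(x + f + g)]] is concave, and it is finite below near 0 because [x > a];
    Hahn-Banach gives it a supergradient [z] at 0. Monotonicity and conicity put
    [z] in the polar of [C^W], and [z(1) > 0] since otherwise [u] would be bounded
    by the optimal value; so [z = lambda Q] with [Q \in M^W].

    It remains to compute the conjugate of [f |-> E[u(f)]] at [z]. A singular
    functional is carried by sets [A] of arbitrarily small probability: testing
    with [g] off [A] and [- f2] on [A], where [g] nearly attains the pointwise
    supremum defining [Phi(lambda dQ_r/dP)] and [f2] nearly attains [||Q_s||],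
    separates the regular from the singular contribution. The converse inequality
    is Fenchel's, the term [- Q_s(x + f)] being at most [||Q_s||] for the same
    reason. *)
From HB Require Import structures.
Require Import Defs.
From mathcomp Require Import all_boot all_order all_algebra.
From mathcomp Require Import all_classical all_reals all_analysis.
From mathcomp Require Import measurable_realfun finmap ring lra.
Set Implicit Arguments.
Unset Strict Implicit.
Unset Printing Implicit Defensive.
Import Order.TTheory GRing.Theory Num.Theory.
Import numFieldNormedType.Exports.
Import HBNNSimple.
Local Open Scope classical_set_scope.
Local Open Scope ring_scope.

(** * Expectation of integrable random variables *)

(** [uhat u] may grow arbitrarily fast, and even takes the value +oo when [a] is finite. The norm of
    the Orlicz space need not be order continuous, so a dual element need not have a density. The
    lattice facts about the dual all come from the Riesz-Kantorovich formula. The decomposition is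
    built for positive functionals, which is enough since the polar of [C_set] consists of such
    functionals. What makes a singular functional live on small sets is that the expectation is
    itself a regular functional, hence disjoint from it. Expected utilities can be infinite on
    either side. They are handled through integrable real minorants of [u (x + f)]: these combine
    under concavity without extended arithmetic, and every real number strictly below an expected
    utility has one. The conjugate is likewise approached from below, by bounded selectors with
    finitely many values. The duality is proved for an abstract convex cone [K] of measurable
    functions that contains 0 and whose elements are bounded below by multiples of [- W]; stochastic
    integration enters through the verification of these properties. *)

Section Expectation.
Context {disp : measure_display} {Omega : measurableType disp} {R : realType}.
Variable P : probability Omega R.
Implicit Types f g h : Omega -> R.

Definition Lone f : Prop := P.-integrable setT (EFin \o f).

(** An infinite integral is sent to 0, so the values of [Ex] carry information only together with
    [Lone]. *)
Definition Ex f : R := Rintegral P setT f.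

Lemma Lone_measurable f : Lone f -> measurable_fun setT f.
Proof. by move=> /integrableP[/measurable_EFinP]. Qed.

Lemma Ex_EFin f : Lone f -> (\int[P]_w (f w)%:E = (Ex f)%:E)%E.
Proof. by move=> fi; rewrite /Ex /Rintegral fineK//; exact: integrable_fin_num. Qed.

Lemma LoneD f g : Lone f -> Lone g -> Lone (fun w => f w + g w).
Proof. by move=> fi gi; exact: (integrableD measurableT fi gi). Qed.

Lemma LoneZ k f : Lone f -> Lone (fun w => k * f w).
Proof. by move=> fi; exact: (integrableZl measurableT k fi). Qed.

Lemma LoneB f g : Lone f -> Lone g -> Lone (fun w => f w - g w).
Proof. by move=> fi gi; exact: (integrableB measurableT fi gi). Qed.

Lemma Lone_cst k : Lone (fun=> k).
Proof. exact: (finite_measure_integrable_cst P k measurableT). Qed.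

Lemma Lone_le f g : measurable_fun setT f -> (forall w, `|f w| <= g w) ->
  Lone g -> Lone f.
Proof.
move=> mf fg; apply: le_integrable => //; first exact/measurable_EFinP.
by move=> w _ /=; rewrite lee_fin (le_trans (fg w))// ler_norm.
Qed.

Lemma Lone_le_ae f g : measurable_fun setT f -> {ae P, forall w, `|f w| <= g w} ->
  Lone g -> Lone f.
Proof.
move=> mf fg gi; apply/integrableP; split; first exact/measurable_EFinP.
have /integrableP[mg] := gi; apply: le_lt_trans.
apply: ae_ge0_le_integral => //.
- by apply: measurableT_comp => //; exact/measurable_EFinP.
- by apply: measurableT_comp.
by apply: filterS fg => w h _ /=; rewrite lee_fin (le_trans h)// ler_norm.
Qed.

Lemma Lone_abs f : Lone f -> Lone (fun w => `|f w|).
Proof. exact: integrable_norm. Qed.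

Lemma Lone_bounded f k : measurable_fun setT f -> (forall w, `|f w| <= k) -> Lone f.
Proof. by move=> mf fk; exact: (Lone_le mf fk (Lone_cst k)). Qed.

Lemma ExD f g : Lone f -> Lone g -> Ex (fun w => f w + g w) = Ex f + Ex g.
Proof. exact: RintegralD. Qed.

Lemma ExB f g : Lone f -> Lone g -> Ex (fun w => f w - g w) = Ex f - Ex g.
Proof. exact: RintegralB. Qed.

Lemma ExZ k f : Lone f -> Ex (fun w => k * f w) = k * Ex f.
Proof. exact: RintegralZl. Qed.

Lemma Ex_cst k : Ex (fun=> k) = k.
Proof. by rewrite /Ex Rintegral_cst// [X in fine X](probability_setT P) mulr1. Qed.

Lemma Ex_ge0 f : (forall w, 0 <= f w) -> 0 <= Ex f.
Proof. by move=> f0; apply: Rintegral_ge0 => w _. Qed.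

Lemma le_Ex_ae f g : Lone f -> Lone g -> ae_le P f g -> Ex f <= Ex g.
Proof.
move=> fi gi fg; rewrite -subr_ge0 -ExB//.
have gfi := LoneB gi fi.
rewrite -lee_fin -Ex_EFin// (ae_eq_integral (fun w => (`|g w - f w|)%:E))//.
- by apply: integral_ge0 => w _; rewrite lee_fin.
- exact: measurable_int gfi.
- exact: measurable_int (Lone_abs gfi).
- by apply: filterS fg => w fgw _; rewrite ger0_norm// subr_ge0.
Qed.

Lemma le_Ex f g : Lone f -> Lone g -> (forall w, f w <= g w) -> Ex f <= Ex g.
Proof. by move=> fi gi fg; apply: le_Ex_ae => //; apply: aeW. Qed.

Lemma eq_Ex f g : f =1 g -> Ex f = Ex g.
Proof. by move=> fg; congr Ex; apply/funext. Qed.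

Lemma Ex_abs f : Lone f -> `|Ex f| <= Ex (fun w => `|f w|).
Proof. by move=> fi; exact: le_normr_Rintegral. Qed.

Lemma Ex_abs_eq0 f : Lone f -> Ex (fun w => `|f w|) = 0 -> {ae P, forall w, f w = 0}.
Proof.
move=> fi f0.
have /(ae_eq_integral_abs P measurableT (measurable_int P fi)) :
    (\int[P]_w `|(EFin \o f) w| = 0)%E.
  by rewrite -[RHS]/(0%R%:E) -f0 -Ex_EFin//; exact: Lone_abs.
by apply: filterS => w /(_ I) [].
Qed.

Lemma Ex_dominated (fn : nat -> Omega -> R) f g :
  (forall n, measurable_fun setT (fn n)) -> measurable_fun setT f ->
  {ae P, forall w, fn n w @[n --> \oo] --> f w} ->
  (forall n, {ae P, forall w, `|fn n w| <= g w}) -> Lone g ->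
  Ex (fn n) @[n --> \oo] --> Ex f.
Proof.
move=> mfn mf cvf fg gi.
have fi : Lone f.
  apply: (Lone_le_ae mf _ gi).
  have /ae_foralln : forall n, {ae P, forall w, `|fn n w| <= g w} by [].
  apply: filterS2 cvf => w cv le; move/cvg_norm : cv => cv.
  rewrite -(cvg_lim _ cv)//; apply: limr_le; first exact: cvgP cv.
  exact: nearW.
have fni n : Lone (fn n) by exact: (Lone_le_ae (mfn n) (fg n) gi).
have [] := @dominated_convergence _ _ _ P setT measurableT
   (fun n => EFin \o fn n) (EFin \o f) (EFin \o g).
- by move=> n; exact/measurable_EFinP.
- exact/measurable_EFinP.
- by apply: filterS cvf => w cv _; apply/fine_cvgP; split => //; exact: nearW.
- exact: gi.
- have /ae_foralln := fg; apply: filterS => w le n _ /=.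
  by rewrite lee_fin.
move=> _ _; rewrite /comp Ex_EFin//.
under eq_fun do rewrite Ex_EFin//.
by move/fine_cvgP => [].
Qed.

(** Monotone convergence in real form: the uniform bound [B] on the expectations is what makes the
    limit integrable. *)
Lemma Ex_monotone (fn : nat -> Omega -> R) f B :
  (forall n, Lone (fn n)) -> measurable_fun setT f ->
  (forall n w, 0 <= fn n w) ->
  (forall w, nondecreasing_seq (fn ^~ w)) ->
  (forall w, fn n w @[n --> \oo] --> f w) ->
  (forall n, Ex (fn n) <= B) ->
  Lone f /\ Ex (fn n) @[n --> \oo] --> Ex f.
Proof.
move=> fni mf fn0 ndfn cvf fB.
have cvE : (\int[P]_w (fn n w)%:E)%E @[n --> \oo] --> (\int[P]_w (f w)%:E)%E.
  have -> : (\int[P]_w (f w)%:E = \int[P]_w limn (fun n => (fn n w)%:E))%E.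
    apply: eq_integral => w _; apply/esym/cvg_lim => //.
    by apply/fine_cvgP; split; [exact: nearW|exact: cvf].
  apply: cvg_monotone_convergence => //.
  - by move=> n; exact: measurable_int (fni n).
  - by move=> n w _; rewrite lee_fin.
  - by move=> w _ m n mn; rewrite lee_fin ndfn.
have fle n w : fn n w <= f w.
  have := nondecreasing_cvgn_le (ndfn w) (cvgP _ (cvf w)) n.
  by rewrite (cvg_lim _ (cvf w)).
have fi : Lone f.
  apply/integrableP; split; first exact/measurable_EFinP.
  under eq_integral do rewrite /= ger0_norm ?(le_trans (fn0 0 _) (fle 0 _))//.
  apply: le_lt_trans (ltry B).
  rewrite -(cvg_lim _ cvE)//; apply: lime_le; first exact: cvgP cvE.
  by apply: nearW => n; rewrite Ex_EFin// lee_fin.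
split => //; move: cvE; rewrite Ex_EFin//.
under eq_fun do rewrite Ex_EFin//.
by move/fine_cvgP => [].
Qed.

End Expectation.

(** * Orlicz spaces of extended-valued Young functions *)

(** The value +oo is allowed because [uhat u] is infinite beyond [- a] when [a] is finite; the
    Orlicz space then consists of the essentially bounded functions. Coercivity embeds the space in
    L^1, finiteness at one positive point puts the constants in it, and [young_mono] contains
    evenness. *)
Record young {R : realType} (Y : R -> \bar R) : Prop := Young {
  young0 : Y 0 = 0%E;
  young_ge0 : forall x, (0 <= Y x)%E;
  young_mono : forall x y, `|x| <= `|y| -> (Y x <= Y y)%E;
  young_convex : forall x y t, 0 <= t <= 1 ->
    (Y (t * x + (1 - t) * y)%R <= t%:E * Y x + (1 - t)%:E * Y y)%E;
  young_coercive : exists a b : R, 0 <= a /\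
    forall x, (`|x|%:E <= a%:E * Y x + b%:E)%E;
  young_finite : exists2 x, 0 < x & (Y x < +oo)%E }.

(** Sublevel sets are intervals because [Y] grows with the absolute value; this covers a jump of [Y]
    to +oo. *)
Lemma young_measurable {R : realType} (Y : R -> \bar R) :
  young Y -> measurable_fun setT Y.
Proof.
move=> hY; apply: (measurability _ (ErealGenOInfty.measurableE R)).
move=> /= _ [_ [a ->]] <-; rewrite setTI preimage_itvoy.
rewrite -[X in measurable X]setCK; apply: measurableC.
apply: is_interval_measurable => x y /= /negP xa /negP ya z /andP[xz zy].
apply/negP; rewrite -leNgt in xa; rewrite -leNgt in ya; rewrite -leNgt.
have [z0|z0] := leP 0 z.
  by apply: le_trans ya; apply: young_mono => //; rewrite !ger0_norm// (le_trans z0).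
by apply: le_trans xa; apply: young_mono => //; rewrite !ltr0_norm ?lerN2// (le_lt_trans xz).
Qed.

Section OrliczSpace.
Context {disp : measure_display} {Omega : measurableType disp} {R : realType}.
Variables (P : probability Omega R) (Y : R -> \bar R).
Hypothesis hY : young Y.
Implicit Types f g h : Omega -> R.

Local Notation V := (orlicz P Y).
Local Notation N := (luxemburg P Y).

Definition modular f : \bar R := (\int[P]_w Y (f w))%E.

Lemma modular_measurable f : measurable_fun setT f ->
  measurable_fun setT (fun w => Y (f w)).
Proof. by move=> mf; apply: measurableT_comp => //; exact: young_measurable. Qed.

Lemma modular_ge0 f : (0 <= modular f)%E.
Proof. by apply: integral_ge0 => w _; exact: young_ge0. Qed.

Lemma le_modular f g : measurable_fun setT f -> measurable_fun setT g ->
  {ae P, forall w, `|f w| <= `|g w|} -> (modular f <= modular g)%E.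
Proof.
move=> mf mg fg; apply: ae_ge0_le_integral => //.
- by move=> *; exact: young_ge0.
- exact: modular_measurable.
- by move=> *; exact: young_ge0.
- exact: modular_measurable.
- by apply: filterS fg => w h _; exact: young_mono.
Qed.

Lemma modular_convex f g t : measurable_fun setT f -> measurable_fun setT g ->
  0 <= t <= 1 ->
  (modular (fun w => t * f w + (1 - t) * g w)%R
   <= t%:E * modular f + (1 - t)%:E * modular g)%E.
Proof.
move=> mf mg t01; have /andP[t0 t1] := t01.
have mYf := modular_measurable mf; have mYg := modular_measurable mg.
rewrite -!ge0_integralZl//=; try by [move=> *; exact: young_ge0|
  rewrite lee_fin subr_ge0].
rewrite -ge0_integralD//=; last 4 first.
- by move=> w _; rewrite mule_ge0// ?lee_fin// young_ge0.
- exact: measurable_funeM.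
- by move=> w _; rewrite mule_ge0// ?lee_fin ?subr_ge0// young_ge0.
- exact: measurable_funeM.
apply: ge0_le_integral => //=.
- by move=> w _; exact: young_ge0.
- apply: modular_measurable; apply: measurable_funD; exact: measurable_funM.
- by apply: emeasurable_funD; exact: measurable_funeM.
- by move=> w _; exact: young_convex.
Qed.

Lemma modular0 : modular (fun=> 0) = 0%E.
Proof. by rewrite /modular young0// integral0. Qed.

Lemma modular_scale f t : measurable_fun setT f -> 0 <= t <= 1 ->
  (modular (fun w => t * f w)%R <= t%:E * modular f)%E.
Proof.
move=> mf t01.
have m0 : measurable_fun setT (fun _ : Omega => 0 : R) by exact: measurable_cst.
have := modular_convex mf m0 t01.
rewrite modular0 mule0 adde0; apply: le_trans.
by under [in leRHS]eq_fun do rewrite /= mulr0 addr0.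
Qed.

Lemma orlicz_measurable f : V f -> measurable_fun setT f.
Proof. by case. Qed.

Lemma orlicz_solid f g : measurable_fun setT f -> V g ->
  {ae P, forall w, `|f w| <= `|g w|} -> V f.
Proof.
move=> mf [mg [a a0 ga]] fg; split => //; exists a => //; apply: le_lt_trans ga.
apply: (@le_modular (fun w => a * f w) (fun w => a * g w)); try exact: measurable_funM.
by apply: filterS fg => w h; rewrite !normrM ler_wpM2l.
Qed.

Lemma orlicz_lin b f g : V f -> V g -> V (fun w => b * f w + g w).
Proof.
move=> [mf [a1 a10 fa]] [mg [a2 a20 ga]].
split; first by apply: measurable_funD => //; exact: measurable_funM.
(* Chosen so that c |b| is at most [a1 / 2] and [c] at most [a2 / 2]: then [c * (b * f + g)] is
   dominated by the midpoint [F] of two functions of finite modular. The 1 added to |b| covers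
   [b = 0]. *)
pose c := Num.min (a1 / (2 * (`|b| + 1))) (a2 / 2).
have b1 : 0 < `|b| + 1 by rewrite ltr_wpDl.
have c0 : 0 < c by rewrite lt_min !divr_gt0// mulr_gt0.
exists c => //.
pose F w := 2^-1 * `|a1 * f w| + (1 - 2^-1) * `|a2 * g w|.
have ma1 : measurable_fun setT (fun w => a1 * f w) by exact: measurable_funM.
have ma2 : measurable_fun setT (fun w => a2 * g w) by exact: measurable_funM.
have mna1 : measurable_fun setT (fun w => `|a1 * f w|) by exact: measurableT_comp.
have mna2 : measurable_fun setT (fun w => `|a2 * g w|) by exact: measurableT_comp.
apply: (@le_lt_trans _ _ (modular F)).
  apply: (@le_modular (fun w => c * (b * f w + g w)) F).
  - by apply: measurable_funM => //; apply: measurable_funD => //; exact: measurable_funM.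
  - by apply: measurable_funD; exact: measurable_funM.
  apply: aeW => w; rewrite /F [leRHS]ger0_norm; last by rewrite addr_ge0// mulr_ge0//; lra.
  rewrite mulrDr (le_trans (ler_normD _ _))// lerD//.
    rewrite mulrA !normrM mulrA ler_wpM2r// (gtr0_norm c0) (gtr0_norm a10).
    have : c <= a1 / (2 * (`|b| + 1)) by rewrite /c ge_min lexx.
    by rewrite ler_pdivlMr ?mulr_gt0// => ?; move: (ltW c0) => ?; nra.
  rewrite !normrM mulrA ler_wpM2r// (gtr0_norm c0) (gtr0_norm a20).
  have : c <= a2 / 2 by rewrite /c ge_min lexx orbT.
  by lra.
have h01 : 0 <= (2^-1 : R) <= 1 by apply/andP; split; lra.
apply: (le_lt_trans (modular_convex mna1 mna2 h01)).
have E h : modular (fun w => `|h w|) = modular h.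
  by apply: eq_integral => w _; apply: le_anti; rewrite !young_mono ?normr_id.
by rewrite !E lte_add_pinfty// lte_mul_pinfty// ?lee_fin ?subr_ge0//; lra.
Qed.

End OrliczSpace.

(** * The norm dual, described on the modular unit ball *)

Section OrliczDual.
Context {disp : measure_display} {Omega : measurableType disp} {R : realType}.
Variables (P : probability Omega R) (Y : R -> \bar R).
Hypothesis hY : young Y.
Implicit Types (f g h : Omega -> R) (z : @functional _ Omega R).

Local Notation V := (orlicz P Y).
Local Notation N := (luxemburg P Y).
Local Notation M := (modular P Y).

Lemma integral_cst_probability (k : \bar R) : (\int[P]_w k = k)%E.
Proof. by rewrite integral_cst// [X in (_ * X)%E](probability_setT P) mule1. Qed.

Lemma orlicz0 : V (fun=> 0).
Proof.
split; first exact: measurable_cst.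
exists 1 => //; under eq_integral do rewrite mulr0 (young0 hY).
by rewrite integral0.
Qed.

Lemma orliczZ b f : V f -> V (fun w => b * f w).
Proof.
by move=> /(orlicz_lin hY b)/(_ orlicz0); under eq_fun do rewrite addr0.
Qed.

Lemma orliczD f g : V f -> V g -> V (fun w => f w + g w).
Proof.
by move=> /(orlicz_lin hY 1)/[apply]; under eq_fun do rewrite mul1r.
Qed.

Lemma orliczB f g : V f -> V g -> V (fun w => f w - g w).
Proof.
by move=> Vf /(orlicz_lin hY (-1))/(_ Vf); under eq_fun do rewrite mulN1r addrC.
Qed.

Lemma orliczN f : V f -> V (fun w => - f w).
Proof. by move=> /(orliczZ (-1)); under eq_fun do rewrite mulN1r. Qed.

Lemma orlicz_cst k : V (fun=> k).
Proof.
split; first exact: measurable_cst.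
have [x x0 Yx] := young_finite hY.
exists (x / (`|k| + 1)); first by rewrite divr_gt0// ltr_wpDl.
rewrite integral_cst_probability; apply: le_lt_trans Yx.
apply: (young_mono hY); rewrite !normrM (gtr0_norm x0) normfV.
by rewrite -mulrA ler_piMr ?(ltW x0)// mulrC ler_pdivrMr ?mul1r ?(le_trans _ (ler_norm _))//
  ?normr_gt0 ?lerDl//; apply: lt0r_neq0; rewrite ltr_wpDl.
Qed.

Lemma orlicz_solid_le f g : measurable_fun setT f -> V g ->
  (forall w, `|f w| <= `|g w|) -> V f.
Proof. by move=> mf Vg fg; apply: (orlicz_solid hY mf Vg); exact: aeW. Qed.

Lemma orlicz_bounded f k : measurable_fun setT f -> (forall w, `|f w| <= k) -> V f.
Proof.
move=> mf fk; apply: (orlicz_solid_le mf (orlicz_cst k)) => w.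
by rewrite (le_trans (fk w))// ler_norm.
Qed.

Lemma orlicz_abs f : V f -> V (fun w => `|f w|).
Proof.
move=> Vf; apply: (orlicz_solid_le _ Vf) => [|w]; last by rewrite normr_id.
by apply: measurableT_comp => //; exact: orlicz_measurable Vf.
Qed.

Lemma orlicz_indic f A : measurable A -> V f -> V (fun w => f w * \1_A w).
Proof.
move=> mA Vf; apply: (orlicz_solid_le _ Vf) => [|w].
  by apply: measurable_funM; [exact: orlicz_measurable Vf|exact: measurable_indic].
by rewrite normrM ler_piMr// indicE; case: (_ \in _); rewrite ?normr1 ?normr0.
Qed.

Lemma orlicz_max f g : V f -> V g -> V (fun w => Num.max (f w) (g w)).
Proof.
move=> Vf Vg; apply: (orlicz_solid_le _ (orliczD (orlicz_abs Vf) (orlicz_abs Vg))) => [|w].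
  by apply: measurable_maxr; [exact: orlicz_measurable Vf|exact: orlicz_measurable Vg].
rewrite [leRHS]ger0_norm ?addr_ge0//.
by rewrite maxEge; case: ifP => _; rewrite ?lerDl ?lerDr.
Qed.

Lemma orlicz_min f g : V f -> V g -> V (fun w => Num.min (f w) (g w)).
Proof.
move=> Vf Vg; apply: (orlicz_solid_le _ (orliczD (orlicz_abs Vf) (orlicz_abs Vg))) => [|w].
  by apply: measurable_minr; [exact: orlicz_measurable Vf|exact: orlicz_measurable Vg].
rewrite [leRHS]ger0_norm ?addr_ge0//.
by rewrite minEge; case: ifP => _; rewrite ?lerDl ?lerDr.
Qed.

Lemma modular_Lone f : measurable_fun setT f -> (M f < +oo)%E -> Lone P f.
Proof.
move=> mf Mf; have [a [b [a0 ab]]] := young_coercive hY.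
have b0 : 0 <= b.
  by have := ab 0; rewrite (young0 hY) mule0 add0e normr0 lee_fin.
apply/integrableP; split; first exact/measurable_EFinP.
have mY := modular_measurable hY mf.
apply: (@le_lt_trans _ _ (\int[P]_w (a%:E * Y (f w) + b%:E))%E).
  apply: ge0_le_integral => //=.
  - by do 2 apply: measurableT_comp => //.
  - by apply: emeasurable_funD => //; exact: measurable_funeM.
rewrite ge0_integralD//=; last 2 first.
- by move=> w _; rewrite mule_ge0// ?lee_fin// (young_ge0 hY).
- exact: measurable_funeM.
rewrite ge0_integralZl//; last by move=> *; exact: young_ge0.
rewrite integral_cst_probability lte_add_pinfty ?ltry//.
by rewrite lte_mul_pinfty ?lee_fin.
Qed.

Lemma orlicz_Lone f : V f -> Lone P f.
Proof.
move=> Vf; have [mf [a a0 Ma]] := Vf.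
have maf : measurable_fun setT (fun w => a * f w) by exact: measurable_funM.
have := LoneZ a^-1 (modular_Lone maf Ma).
by under eq_fun do rewrite mulKf ?gt_eqF//.
Qed.

Lemma exists_modular_le1 f : V f -> exists2 s : R, 0 < s & (M (fun w => s * f w)%R <= 1)%E.
Proof.
move=> [mf [a a0 Ma]].
have maf : measurable_fun setT (fun w => a * f w) by exact: measurable_funM.
pose m := fine (M (fun w => a * f w)).
have mE : M (fun w => a * f w) = m%:E.
  by rewrite fineK// ge0_fin_numE//; exact: modular_ge0.
have m0 : 0 <= m by rewrite -lee_fin -mE; exact: modular_ge0.
(* Convexity and [Y 0 = 0] make the modular shrink at least as fast as the scaling factor, so this
   factor brings [m] down to at most 1. *)
have t01 : 0 <= (m + 1)^-1 <= 1.
  by rewrite invr_ge0 addr_ge0//= invf_le1 ?ltr_wpDl// lerDr.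
exists ((m + 1)^-1 * a); first by rewrite mulr_gt0// invr_gt0 ltr_wpDl.
have := modular_scale P hY maf t01; under eq_fun do rewrite mulrA.
move/le_trans; apply; rewrite mE -EFinM lee_fin mulrC ler_pdivrMr ?ltr_wpDl//.
by rewrite mul1r lerDl.
Qed.

Lemma luxemburg_ge0 f : (0 <= N f)%E.
Proof.
by apply: le_ereal_inf_tmp => _ [c [c0 _] <-]; rewrite lee_fin ltW.
Qed.

Lemma luxemburg_le f c : 0 < c -> (M (fun w => f w / c)%R <= 1)%E -> (N f <= c%:E)%E.
Proof. by move=> c0 Mf; apply: ereal_inf_lbound; exists c. Qed.

(** Strictness avoids the question whether the infimum is attained: some admissible constant lies
    below [c], and dividing by the larger [c] only decreases the modular. *)
Lemma modular_luxemburg f c : measurable_fun setT f -> 0 < c -> (N f < c%:E)%E ->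
  (M (fun w => f w / c)%R <= 1)%E.
Proof.
move=> mf c0 /ereal_inf_lt[_ [c' [c'0 Mf] <-]]; rewrite lte_fin => cc'.
apply: le_trans Mf; apply: le_modular => //; try exact: measurable_funM.
by apply: aeW => w; rewrite !normrM ler_wpM2l// !gtr0_norm ?invr_gt0// lef_pV2 ?posrE// ltW.
Qed.

Definition linear_on z := forall b f g, V f -> V g ->
  z (fun w => b * f w + g w) = b * z f + z g.

Lemma linear_on0 z : linear_on z -> z (fun=> 0) = 0.
Proof.
move=> zl; have := zl 1 _ _ orlicz0 orlicz0; rewrite mulr0 addr0 mul1r.
by move=> /eqP; rewrite -subr_eq subrr eq_sym => /eqP.
Qed.

Lemma linear_onZ z b f : linear_on z -> V f -> z (fun w => b * f w) = b * z f.
Proof.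
move=> zl Vf; have := zl b _ _ Vf orlicz0; rewrite (linear_on0 zl) addr0.
by under [X in z X]eq_fun do rewrite addr0.
Qed.

Lemma linear_onD z f g : linear_on z -> V f -> V g ->
  z (fun w => f w + g w) = z f + z g.
Proof.
move=> zl Vf Vg; have := zl 1 _ _ Vf Vg; rewrite mul1r.
by under [X in z X]eq_fun do rewrite mul1r.
Qed.

Lemma linear_onB z f g : linear_on z -> V f -> V g ->
  z (fun w => f w - g w) = z f - z g.
Proof.
move=> zl Vf Vg; have := zl (-1) _ _ Vg Vf; rewrite mulN1r addrC.
by under [X in z X]eq_fun do rewrite mulN1r addrC.
Qed.

(** By homogeneity a bound on the modular unit ball is the same as a norm bound, so membership in
    the dual can be checked without computing [luxemburg]. *)
Lemma dualP z : dual P Y z <-> linear_on z /\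
  exists C, forall f, V f -> (M f <= 1)%E -> `|z f| <= C.
Proof.
split=> [[zl [C zC]]|[zl [C zC]]]; split=> //.
  exists `|C| => f Vf Mf; rewrite -lee_fin.
  apply: (le_trans (zC _ Vf)); apply: (@le_trans _ _ (`|C|%:E * N f)%E).
    by rewrite lee_wpmul2r// ?luxemburg_ge0// lee_fin ler_norm.
  rewrite -[leRHS]mule1 lee_wpmul2l// luxemburg_le//.
  by under eq_fun do rewrite divr1.
have C0 : 0 <= C.
  by apply: le_trans (zC _ orlicz0 _) => //; rewrite modular0.
have C1 : 0 < C + 1 by rewrite ltr_wpDl.
exists (C + 1) => f Vf; rewrite -lee_pdivrMl//.
apply: le_ereal_inf_tmp => _ [c [c0 Mc] <-]; rewrite -EFinM lee_fin ler_pdivrMl//.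
have := zC (fun w => c^-1 * f w) (orliczZ _ Vf).
rewrite linear_onZ// normrM gtr0_norm ?invr_gt0//.
under eq_fun do rewrite mulrC.
move=> /(_ Mc); rewrite ler_pdivrMl// => /le_trans; apply.
by rewrite mulrC ler_pM2r// lerDl.
Qed.

Lemma dual_linear z : dual P Y z -> linear_on z.
Proof. by case/dualP. Qed.

(** Every multiple of an almost surely null function has modular 0 and stays in the unit ball, where
    [z] is bounded; a bound on all n |z h| forces [z h = 0]. *)
Lemma dual_eq_ae z f g : dual P Y z -> V f -> V g -> {ae P, forall w, f w = g w} ->
  z f = z g.
Proof.
move=> /dualP[zl [C zC]] Vf Vg fg; apply/eqP; rewrite -subr_eq0 -linear_onB//.
set h := (fun w => _); have Vh : V h by exact: orliczB.
have hn n : n%:R * `|z h| <= C.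
  have := zC (fun w => n%:R * h w) (orliczZ _ Vh).
  rewrite linear_onZ// normrM ger0_norm//; apply.
  apply: (@le_trans _ _ (M (fun=> 0))); last by rewrite modular0.
  apply: le_modular => //; first by apply: orlicz_measurable; exact: orliczZ Vh.
  by apply: filterS fg => w fgw; rewrite /h fgw subrr mulr0.
apply/negP => /negP zh; have zh0 : 0 < `|z h| by rewrite normr_gt0.
have := hn (Num.truncn (C / `|z h|)).+1; rewrite leNgt => /negP; apply.
by rewrite -ltr_pdivrMr// truncnS_gt.
Qed.

Lemma dual_le_mono z f g : dual P Y z -> dual_le P Y (fun=> 0) z -> V f -> V g ->
  ae_le P f g -> z f <= z g.
Proof.
move=> zd z0 Vf Vg fg; rewrite -subr_ge0 -linear_onB//; last exact: dual_linear.
apply: z0; first exact: orliczB.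
by apply: filterS fg => w; rewrite /= subr_ge0.
Qed.

End OrliczDual.

(** * The dual of an Orlicz space *)

Section PositivePart.
Context {disp : measure_display} {Omega : measurableType disp} {R : realType}.
Variables (P : probability Omega R) (Y : R -> \bar R).
Hypothesis hY : young Y.
Implicit Types (f g h : Omega -> R) (z : @functional _ Omega R).

Local Notation V := (orlicz P Y).
Local Notation M := (modular P Y).

(** The bounds hold everywhere rather than almost surely; [dual_eq_ae] later transfers the
    conclusions to almost surely nonnegative functions. *)
Definition order_interval f : set (Omega -> R) :=
  [set g | V g /\ forall w, 0 <= g w <= f w].

(** An order interval lies in a multiple of the modular unit ball. This makes the Riesz-Kantorovich
    supremum finite. *)
Lemma dual_order_bounded z f : dual P Y z -> V f -> exists B, forall g,
  order_interval f g -> z g <= B.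
Proof.
move=> /(dualP P hY)[zl [C zC]] Vf; have [s s0 Ms] := exists_modular_le1 hY Vf.
exists (C / s) => g [Vg gf]; rewrite ler_pdivlMr// mulrC.
rewrite -(linear_onZ hY s zl Vg) (le_trans (ler_norm _))// zC//; first exact: orliczZ.
apply: le_trans Ms; apply: le_modular => //.
- by apply: orlicz_measurable (orliczZ hY s Vg).
- by apply: orlicz_measurable (orliczZ hY s Vf).
apply: aeW => w; have /andP[g0 gfw] := gf w.
by rewrite !normrM ler_wpM2l// !ger0_norm// (le_trans g0).
Qed.

Section Construction.
Variable z : @functional _ Omega R.
Hypothesis zd : dual P Y z.

Let zl : linear_on P Y z. Proof. exact: dual_linear zd. Qed.

(** The Riesz-Kantorovich formula for the positive part of [z], meant for nonnegative [f]. *)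
Let p f : R := sup (z @` order_interval f).

Let has_sup_p f : V f -> (forall w, 0 <= f w) -> has_sup (z @` order_interval f).
Proof.
move=> Vf f0; split.
  exists (z (fun=> 0)), (fun=> 0) => //; split; first exact: orlicz0.
  by move=> w; rewrite lexx f0.
have [B zB] := dual_order_bounded zd Vf.
by exists B => _ [g gf <-]; exact: zB.
Qed.

Let p_ub f g : V f -> order_interval f g -> z g <= p f.
Proof.
move=> Vf gf; apply: sup_upper_bound; last by exists g.
apply: has_sup_p => // w; have [_ /(_ w)/andP[g0 /(le_trans g0)]] := gf; exact.
Qed.

Let p_le f B : V f -> (forall w, 0 <= f w) ->
  (forall g, order_interval f g -> z g <= B) -> p f <= B.
Proof.
move=> Vf f0 fB; apply: ge_sup; first by have [] := has_sup_p Vf f0.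
by move=> _ [g gf <-]; exact: fB.
Qed.

Let p_ge0 f : V f -> (forall w, 0 <= f w) -> 0 <= p f.
Proof.
move=> Vf f0; rewrite -(linear_on0 hY zl); apply: p_ub => //.
by split; [exact: orlicz0|move=> w; rewrite lexx f0].
Qed.

(** The nontrivial inequality is the Riesz decomposition property: [h] below [f + g] splits into the
    minimum of [h] and [f], which is below [f], and a remainder below [g]. *)
Let pD f g : V f -> V g -> (forall w, 0 <= f w) -> (forall w, 0 <= g w) ->
  p (fun w => f w + g w) = p f + p g.
Proof.
move=> Vf Vg f0 g0; have Vfg := orliczD hY Vf Vg.
have fg0 w : 0 <= f w + g w by rewrite addr_ge0.
apply/le_anti/andP; split.
  apply: p_le => // h [Vh hfg].
  pose h1 w := Num.min (h w) (f w); pose h2 w := h w - h1 w.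
  have Vh1 : V h1 by exact: orlicz_min.
  have Vh2 : V h2 by exact: orliczB.
  have -> : z h = z h1 + z h2.
    by rewrite -(linear_onD zl)//; congr z; apply/funext => w; rewrite /h2 addrC subrK.
  apply: lerD; apply: p_ub => //; split=> // w; have /andP[hw0 hw] := hfg w.
    by rewrite /h1 le_min hw0 f0/= ge_min lexx orbT.
  rewrite /h2 /h1; have [hf|hf] := leP (h w) (f w); first by rewrite subrr lexx g0.
  by rewrite subr_ge0 (ltW hf) lerBlDl.
rewrite -lerBrDr; apply: p_le => // h1 [Vh1 h1f].
rewrite lerBrDr addrC -lerBrDr; apply: p_le => // h2 [Vh2 h2g].
rewrite lerBrDr -(linear_onD zl)//; apply: p_ub => //; split; first exact: orliczD.
move=> w; have /andP[? ?] := h1f w; have /andP[? ?] := h2g w.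
by rewrite addr_ge0//= addrC lerD.
Qed.

Let pZ_le c f : 0 < c -> V f -> (forall w, 0 <= f w) -> c * p f <= p (fun w => c * f w).
Proof.
move=> c0 Vf f0; rewrite -ler_pdivlMl//; apply: p_le => // g [Vg gf].
rewrite ler_pdivlMl// -(linear_onZ hY c zl Vg); apply: p_ub; first exact: orliczZ.
split; first exact: orliczZ.
by move=> w; have /andP[? ?] := gf w; rewrite mulr_ge0 ?(ltW c0)//= ler_pM2l.
Qed.

Let pZ c f : 0 <= c -> V f -> (forall w, 0 <= f w) -> p (fun w => c * f w) = c * p f.
Proof.
rewrite le_eqVlt => /predU1P[<-|c0] Vf f0.
  rewrite mul0r; under eq_fun do rewrite mul0r.
  apply/le_anti; rewrite (p_ge0 (orlicz0 P hY))// andbT.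
  apply: p_le; [exact: orlicz0|by []|move=> g [Vg g0]].
  have -> : g = (fun=> 0) by apply/funext => w; apply/le_anti; rewrite andbC; exact: g0.
  by rewrite (linear_on0 hY zl).
have cf0 w : 0 <= c * f w by rewrite mulr_ge0// ltW.
have Vcf := orliczZ hY c Vf.
apply/le_anti; rewrite pZ_le// andbT -ler_pdivrMl//.
have c'0 : 0 < c^-1 by rewrite invr_gt0.
have := pZ_le c'0 Vcf cf0.
by have -> : (fun w => c^-1 * (c * f w)) = f by apply/funext => w; rewrite mulKf ?gt_eqF.
Qed.

Let pos f w := Num.max (f w) 0.
Let neg f w := Num.max (- f w) 0.
Let q f := p (pos f) - p (neg f).

Let Vpos f : V f -> V (pos f).
Proof. by move=> Vf; apply: orlicz_max => //; exact: orlicz0. Qed.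
Let Vneg f : V f -> V (neg f).
Proof. by move=> Vf; apply: orlicz_max => //; [exact: orliczN|exact: orlicz0]. Qed.
Let pos_ge0 f w : 0 <= pos f w. Proof. by rewrite le_max lexx orbT. Qed.
Let neg_ge0 f w : 0 <= neg f w. Proof. by rewrite le_max lexx orbT. Qed.
Let posneg f w : f w = pos f w - neg f w.
Proof.
rewrite /pos /neg; have [f0|f0] := leP (f w) 0; first by rewrite max_l ?oppr_ge0// sub0r opprK.
by rewrite max_r ?oppr_le0 ?subr0// ltW.
Qed.

(** Kantorovich's extension: additivity of [p] makes the value independent of how [f] is written as
    a difference of nonnegative functions, and linearity of [q] follows by choosing convenient
    differences. *)
Let qB f f1 f2 : V f -> V f1 -> V f2 -> (forall w, 0 <= f1 w) -> (forall w, 0 <= f2 w) ->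
  (forall w, f w = f1 w - f2 w) -> q f = p f1 - p f2.
Proof.
move=> Vf V1 V2 f10 f20 fE; rewrite /q; apply/eqP.
rewrite subr_eq addrAC eq_sym subr_eq; apply/eqP.
rewrite -!pD//; try by [exact: Vpos|exact: Vneg].
by congr p; apply/funext => w; have := fE w; rewrite (posneg f w); lra.
Qed.

(** The last clause keeps the supremum formula in the form of a test: bounding [z] on an order
    interval bounds [q] at its endpoint. It yields both the minimality of [q] and near-optimal [g]
    by contraposition. *)
Lemma positive_part_exists : exists q, [/\ dual P Y q, dual_le P Y (fun=> 0) q,
  dual_le P Y z q & forall f, V f -> (forall w, 0 <= f w) -> forall B,
    (forall g, V g -> (forall w, 0 <= g w <= f w) -> z g <= B) -> q f <= B].
Proof.
have qpos f : V f -> (forall w, 0 <= f w) -> q f = p f.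
  move=> Vf f0; rewrite (qB Vf Vf (orlicz0 P hY))//; last by move=> w; rewrite subr0.
  rewrite (_ : p (fun=> 0) = 0) ?subr0//.
  by have := pZ (lexx 0) Vf f0; rewrite mul0r; under eq_fun do rewrite mul0r.
have [_ [C zC]] := (dualP P hY z).1 zd.
have qd : dual P Y q.
  apply/(dualP P hY); split.
    move=> b f g Vf Vg; have Vbfg := orlicz_lin hY b Vf Vg.
    have [b0|b0] := leP 0 b.
      rewrite (@qB _ (fun w => b * pos f w + pos g w) (fun w => b * neg f w + neg g w))//.
      + rewrite !pD ?pZ//; try by [exact: Vpos|exact: Vneg|
          apply: orliczZ => //; exact: Vpos|apply: orliczZ => //; exact: Vneg|
          move=> w; rewrite mulr_ge0].
        by rewrite /q; ring.
      + by apply: orlicz_lin => //; exact: Vpos.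
      + by apply: orlicz_lin => //; exact: Vneg.
      + by move=> w; rewrite addr_ge0// mulr_ge0.
      + by move=> w; rewrite addr_ge0// mulr_ge0.
      + by move=> w; rewrite {1}(posneg f w) {1}(posneg g w); ring.
    have b0' : 0 <= - b by rewrite oppr_ge0 ltW.
    rewrite (@qB _ (fun w => (- b) * neg f w + pos g w) (fun w => (- b) * pos f w + neg g w))//.
    + rewrite !pD ?pZ//; try by [exact: Vpos|exact: Vneg|
        apply: orliczZ => //; exact: Vpos|apply: orliczZ => //; exact: Vneg|
        move=> w; rewrite mulr_ge0].
      by rewrite /q; ring.
    + by apply: orlicz_lin => //; [exact: Vneg|exact: Vpos].
    + by apply: orlicz_lin => //; [exact: Vpos|exact: Vneg].
    + by move=> w; rewrite addr_ge0// mulr_ge0.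
    + by move=> w; rewrite addr_ge0// mulr_ge0.
    + by move=> w; rewrite {1}(posneg f w) {1}(posneg g w); ring.
  exists (C + C) => f Vf Mf.
  have pC h : V h -> (forall w, 0 <= h w) -> (forall w, h w <= `|f w|) -> p h <= C.
    move=> Vh h0 hf; apply: p_le => // g [Vg gh].
    rewrite (le_trans (ler_norm _))// zC//; apply: le_trans Mf.
    apply: le_modular => //; [exact: orlicz_measurable Vg|exact: orlicz_measurable Vf|].
    by apply: aeW => w; have /andP[g0 gw] := gh w; rewrite ger0_norm// (le_trans gw).
  rewrite (le_trans (ler_normB _ _))// !ger0_norm ?p_ge0//; try by [exact: Vpos|exact: Vneg].
  apply: lerD; apply: pC => //; try by [exact: Vpos|exact: Vneg].
    by move=> w; rewrite /pos ge_max normr_ge0 ler_norm.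
  by move=> w; rewrite /neg ge_max normr_ge0 -normrN ler_norm.
have qae f : V f -> ae_le P (fun=> 0) f -> q f = q (pos f).
  move=> Vf f0; apply: (dual_eq_ae hY qd) => //; first exact: Vpos.
  by apply: filterS f0 => w f0; rewrite /pos max_l.
exists q; split => //.
- move=> f Vf f0; rewrite qae// qpos// ?p_ge0//; exact: Vpos.
- move=> f Vf f0; rewrite qae// qpos//; last exact: Vpos.
  rewrite (_ : z f = z (pos f)); last first.
    apply: (dual_eq_ae hY zd) => //; first exact: Vpos.
    by apply: filterS f0 => w f0; rewrite /pos max_l.
  by apply: p_ub; [exact: Vpos|split; [exact: Vpos|move=> w; rewrite lexx pos_ge0]].
- by move=> f Vf f0 B fB; rewrite qpos//; apply: p_le => // g [Vg gf]; exact: fB.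
Qed.

End Construction.
End PositivePart.

(** * Densities of sequentially order-continuous functionals *)

Section Densities.
Context {disp : measure_display} {Omega : measurableType disp} {R : realType}.
Variables (P : probability Omega R) (Y : R -> \bar R).
Hypothesis hY : young Y.
Implicit Types (f g h : Omega -> R) (z v : @functional _ Omega R).

Local Notation V := (orlicz P Y).
Local Notation M := (modular P Y).

Definition has_density v (chi : Omega -> R) := measurable_fun setT chi /\
  forall f, V f -> Lone P (fun w => f w * chi w) /\ v f = Ex P (fun w => f w * chi w).

(** A sequential, pointwise weakening of [order_continuous]: strong enough for countable additivity
    and for passing from simple functions to the whole space, and inherited by squeezing. *)
Definition seq_order_continuous v := forall f : nat -> Omega -> R,
  (forall n, V (f n)) -> (forall w, nonincreasing_seq (f ^~ w)) ->
  (forall w, f n w @[n --> \oo] --> 0) -> v (f n) @[n --> \oo] --> 0.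

(** A sequence decreasing to 0 serves as its own dominating net. *)
Lemma regular_seq_order_continuous v : regular P Y v -> seq_order_continuous v.
Proof.
move=> [vd voc] f Vf fdec f0.
have fge0 n w : 0 <= f n w.
  by rewrite -(cvg_lim _ (f0 w))//; apply: nonincreasing_cvgn_ge => //; exact: cvgP (f0 w).
have := voc nat (fun i j => (i <= j)%N) f (inhabits 0%N).
have lt3 i j k : (i <= j -> j <= k -> i <= k)%N by move=> /leq_trans; apply.
move=> /(_ (fun i => leqnn i) lt3) H.
apply/cvgr0Pnorm_lt => e e0; have [|||i0 iv] := H _ _ _ _ e0.
- by move=> i j; exists (maxn i j); rewrite leq_maxl leq_maxr.
- exact: Vf.
- exists f; split => //.
  + by move=> i j ij; apply: aeW => w; exact: fdec.
  + by move=> i; apply: aeW.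
  + move=> h Vh hf; have /ae_foralln : forall n, {ae P, forall w, h w <= f n w} by exact: hf.
    apply: filterS => w hfw; rewrite -(cvg_lim _ (f0 w))//.
    by apply: limr_ge; [exact: cvgP (f0 w)|exact: nearW].
  + by move=> i; apply: aeW => w; rewrite ger0_norm.
- by exists i0 => // i /= /iv.
Qed.

Section DensityOfSeqContinuous.
Variable v : @functional _ Omega R.
Hypotheses (vd : dual P Y v) (vc : seq_order_continuous v).

Let vl : linear_on P Y v. Proof. exact: dual_linear vd. Qed.

Let nu (A : set Omega) : \bar R := (v \1_A)%:E.

Let V1 A : measurable A -> V \1_A.
Proof.
move=> mA; apply: (orlicz_bounded P hY (k := 1)); first exact: measurable_indic.
by move=> w; rewrite indicE; case: (_ \in _); rewrite ?normr1 ?normr0.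
Qed.

Let nu0 : nu set0 = 0%E.
Proof. by rewrite /nu indic0 (linear_on0 hY vl). Qed.

Let nu_fin A : measurable A -> nu A \is a fin_num. Proof. by []. Qed.

(** The remainders [\1_U - g n] decrease everywhere to 0, so countable additivity is an instance of
    sequential order continuity. *)
Let nu_sigma : semi_sigma_additive nu.
Proof.
move=> F mF tF mUF; set U := \bigcup_n F n.
pose g n w : R := \sum_(0 <= i < n) \1_(F i) w.
have Vg n : V (g n).
  elim: n => [|n IH]; rewrite /g.
    by under eq_fun do rewrite big_nil; exact: orlicz0.
  by under eq_fun do rewrite big_nat_recr//=; apply: orliczD => //; exact: V1.
have vg n : (\sum_(0 <= i < n) nu (F i) = (v (g n))%:E)%E.
  elim: n => [|n IH]; rewrite /g.
    rewrite big_nil; under [in RHS]eq_fun do rewrite big_nil.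
    by rewrite (linear_on0 hY vl).
  rewrite big_nat_recr//= IH; under [in RHS]eq_fun do rewrite big_nat_recr//=.
  by rewrite (linear_onD vl (Vg n) (V1 (mF n))) EFinD.
(* By disjointness the partial sums at [w] jump from 0 to 1 right after the index of the only set
   containing [w], or stay at 0 forever. *)
have gE w : (exists2 k, forall n, g n w = (k < n)%N%:R & \1_U w = 1 :> R) \/
    ((forall n, g n w = 0) /\ \1_U w = 0 :> R).
  have [[k _ Fk]|nU] := pselect (U w).
    left; exists k; last by rewrite indicE mem_set//; exists k.
    move=> n; have Fi i : \1_(F i) w = (i == k)%:R :> R.
      rewrite indicE; case: eqP => [->|ik]; first by rewrite mem_set.
      rewrite memNset// => Fiw; apply: ik.
      by apply: tF => //; exists w.
    rewrite /g; under eq_bigr do rewrite Fi.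
    elim: n => [|n IH]; first by rewrite big_nil.
    by rewrite big_nat_recr//= IH ltnS; case: (ltngtP k n) => _; rewrite ?addr0 ?add0r.
  right; split; last by rewrite indicE memNset.
  move=> n; rewrite /g big1// => i _; rewrite indicE memNset// => Fi.
  by apply: nU; exists i.
have VU := V1 mUF.
have : v (fun w => \1_U w - g n w) @[n --> \oo] --> 0.
  apply: vc.
  - by move=> n; exact: orliczB.
  - move=> w m n mn; rewrite lerB// /g.
    have [/= [k gk _]|[g0 _]] := gE w; last by have := g0; rewrite /g => g0'; rewrite !g0'.
    have := gk; rewrite /g => gk'; rewrite !gk' ler_nat.
    by case: (ltnP k m) => // km; rewrite (leq_trans km mn).
  - move=> w; have [[k gk ->]|[g0 ->]] := gE w; last first.
      by under eq_fun do rewrite g0 subrr; exact: cvg_cst.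
    apply/cvgrPdist_lt => e e0; exists k.+1 => // n /= kn.
    by rewrite gk kn subrr subr0 normr0.
move=> cv; under eq_fun do rewrite vg; apply: cvg_EFin; first exact: nearW.
rewrite /comp/=.
have -> : (fun n => v (g n)) = (fun n => v \1_U - v (fun w => \1_U w - g n w)).
  by apply/funext => n; rewrite (linear_onB vl)// opprB addrC subrK.
by rewrite -[X in _ --> X]subr0; apply: cvgB => //; exact: cvg_cst.
Qed.

Let good chi f := [/\ V f, Lone P (fun w => f w * chi w) & v f = Ex P (fun w => f w * chi w)].

Let density_indic : exists2 chi : Omega -> R, measurable_fun setT chi &
  forall A, measurable A -> good chi \1_A.
Proof.
pose nu' : {charge set Omega -> \bar R} :=
  HB.pack nu (isCharge.Build _ _ _ nu nu0 nu_fin nu_sigma).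
have nuP : nu' `<< P.
  move=> A PA B mB BA; rewrite /nu' /= /nu -[RHS]/(0%R%:E); congr EFin.
  rewrite -(linear_on0 hY vl); apply: (dual_eq_ae hY vd); [exact: V1|exact: orlicz0|].
  exists B; split; [by []|exact: PA|].
  by move=> w /=; apply: contra_notP => wB; rewrite indicE memNset.
have ri := Radon_Nikodym_integrable nuP.
have rE A : measurable A -> _ := fun mA => Radon_Nikodym_integral nuP mA.
have rfin w := Radon_Nikodym_fin_num w nuP.
set rho := Radon_Nikodym _ _ in ri rE rfin.
pose chi w := fine (rho w).
have chiE : EFin \o chi = rho by apply/funext => w; rewrite /= fineK.
have chii : Lone P chi by rewrite /Lone chiE.
have mchi := Lone_measurable chii.
exists chi => // A mA.
have i1 : Lone P (fun w => \1_A w * chi w).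
  apply: (Lone_le _ _ (Lone_abs chii)) => [|w].
    by apply: measurable_funM => //; exact: measurable_indic.
  by rewrite normrM ler_piMl// indicE; case: (_ \in _); rewrite ?normr1 ?normr0.
split => //; first exact: V1.
apply: EFin_inj; rewrite -Ex_EFin// -[LHS]/(nu' A) rE// integral_mkcond.
apply: eq_integral => w _; rewrite -chiE patchE indicE.
by case: (w \in A); rewrite ?mul1r ?mul0r.
Qed.

Let good_lin chi b f g : good chi f -> good chi g -> good chi (fun w => b * f w + g w).
Proof.
move=> [Vf fi fE] [Vg gi gE].
have E : (fun w => (b * f w + g w) * chi w) = (fun w => b * (f w * chi w) + g w * chi w).
  by apply/funext => w; ring.
have bfi := LoneZ b fi; split; first exact: orlicz_lin.
  by rewrite E; exact: LoneD.
by rewrite vl// E (ExD bfi gi) ExZ// fE gE.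
Qed.

Let good_nnsfun chi (s : {nnsfun Omega >-> R}) :
  (forall A, measurable A -> good chi \1_A) -> good chi (fun w => s w).
Proof.
move=> g1; have g0 : good chi (fun=> 0) by have := g1 set0 measurable0; rewrite indic0.
rewrite (_ : (fun w => s w) =
    (fun w => \sum_(y <- fset_set (range s)) y * \1_(s @^-1` [set y]) w)); last first.
  by apply/funext => w; rewrite fimfunE fsbig_finite.
elim: (fset_set (range s) : seq R) => [|y t IH].
  by under eq_fun do rewrite big_nil.
under eq_fun do rewrite big_cons.
by apply: good_lin => //; exact: g1.
Qed.

(** Where [chi] has the constant sign [sigma], simple approximations of [f] have increasing
    integrals, bounded by order boundedness of [sigma * v]. Monotone convergence thus produces the
    integrability of [f * chi], unknown beforehand, and continuity of [v] identifies the limit. *)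
Let good_sign chi sigma f : measurable_fun setT chi -> sigma * sigma = 1 ->
  (forall s : {nnsfun Omega >-> R}, good chi (fun w => s w)) -> V f -> (forall w, 0 <= f w) ->
  (forall w, f w != 0 -> 0 <= sigma * chi w) -> good chi f.
Proof.
move=> mchi ss gs Vf f0 fchi; have mf := orlicz_measurable Vf.
have [s sinc sf] : exists2 s : {nnsfun Omega >-> R}^nat,
    (forall w, nondecreasing_seq (fun n => s n w)) &
    forall w, s n w @[n --> \oo] --> f w.
  have mf' : measurable_fun setT (EFin \o f) by exact/measurable_EFinP.
  exists (nnsfun_approx measurableT mf') => w.
    by move=> m n mn; exact/lefP/nd_nnsfun_approx.
  have f0' t : setT t -> (0 <= (EFin \o f) t)%E by rewrite /= lee_fin.
  by have /fine_cvgP[] := cvg_nnsfun_approx measurableT mf' f0' (I : setT w).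
have sle n w : s n w <= f w.
  have := nondecreasing_cvgn_le (sinc w) (cvgP _ (sf w)) n.
  by rewrite (cvg_lim _ (sf w)).
have Vs n : V (fun w => s n w) by have [] := gs (s n).
have [C fC] := dual_order_bounded hY vd Vf.
have nvd : dual P Y (fun g => sigma * v g).
  apply/(dualP P hY); have [_ [B vB]] := (dualP P hY v).1 vd; split.
    by move=> b g h Vg Vh; rewrite vl//; ring.
  exists (`|sigma| * B) => g Vg Mg; rewrite normrM ler_wpM2l//; exact: vB.
have [B fB] := dual_order_bounded hY nvd Vf.
have i1 n : Lone P (fun w => sigma * (s n w * chi w)) by apply: LoneZ; have [] := gs (s n).
have [||w|w|n|fi] := @Ex_monotone _ _ _ P _ (fun w => sigma * (f w * chi w)) B i1.
- by apply: measurable_funM => //; exact: measurable_funM.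
- move=> n w; have [fw0|fw0] := eqVneq (f w) 0.
    suff -> : s n w = 0 by rewrite mul0r mulr0.
    by apply/le_anti; rewrite -{1}fw0 sle fun_ge0.
  by rewrite mulrCA mulr_ge0 ?fun_ge0// fchi.
- move=> m n mn; have [fw0|fw0] := eqVneq (f w) 0.
    have s0 k : s k w = 0 by apply/le_anti; rewrite -{1}fw0 sle fun_ge0.
    by rewrite !s0.
  by rewrite [leLHS]mulrCA [leRHS]mulrCA ler_wpM2r ?fchi// sinc.
- by apply: cvgMr; apply: cvgMl; exact: sf.
- rewrite ExZ; last by have [] := gs (s n).
  have [_ _ <-] := gs (s n); apply: fB; split => // w.
  by rewrite fun_ge0 sle.
move=> cvE.
have cv : sigma * v (fun w => s n w) @[n --> \oo] --> sigma * v f.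
  apply: cvgMr; have -> : (fun n => v (fun w => s n w)) = (fun n => v f - v (fun w => f w - s n w)).
    by apply/funext => n; rewrite (linear_onB vl)// opprB addrC subrK.
  rewrite -[X in _ --> X]subr0; apply: cvgB; first exact: cvg_cst.
  apply: vc => [n|w m n mn|w]; first exact: orliczB.
    by rewrite lerB// sinc.
  by rewrite -(subrr (f w)); apply: cvgB; [exact: cvg_cst|exact: sf].
have fi' : Lone P (fun w => f w * chi w).
  by have := LoneZ sigma fi; under eq_fun do rewrite mulrA ss mul1r.
split => //.
have EE n : Ex P (fun w => sigma * (s n w * chi w)) = sigma * v (fun w => s n w).
  by have [_ gi ge] := gs (s n); rewrite ExZ// ge.
have : sigma * v f = sigma * Ex P (fun w => f w * chi w).
  rewrite -ExZ// -(cvg_lim _ cvE)// -(cvg_lim _ cv)//.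
  by congr (limn _); apply/funext => n; rewrite EE.
by move=> /(congr1 (fun x => sigma * x)); rewrite !mulrA ss !mul1r.
Qed.

(** [f] is cut into four pieces, along its own sign and along the sign of [chi], to each of which
    [good_sign] applies. *)
Lemma seq_order_continuous_density : exists chi, has_density v chi.
Proof.
have [chi mchi g1] := density_indic; exists chi; split => // f Vf.
have gs (s : {nnsfun Omega >-> R}) : good chi (fun w => s w) by exact: good_nnsfun.
pose pos f w : R := Num.max (f w) 0.
have Vpos g : V g -> V (pos g) by move=> Vg; apply: orlicz_max => //; exact: orlicz0.
have pos0 g w : 0 <= pos g w by rewrite le_max lexx orbT.
pose B := [set w | 0 <= chi w].
have mB : measurable B.
  rewrite -[B]setTI (_ : setT `&` B = setT `&` chi @^-1` `[0, +oo[).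
    by apply: mchi => //; exact: measurable_itv.
  by apply/seteqP; split => w [_ /=]; rewrite ?in_itv/= ?andbT.
have gpos g : V g -> good chi (pos g).
  move=> Vg; have := good_lin 1 (@good_sign chi 1 (fun w => pos g w * \1_B w) mchi _ gs _ _ _)
    (@good_sign chi (-1) (fun w => pos g w * \1_(~` B) w) mchi _ gs _ _ _).
  rewrite (_ : (fun w => 1 * (pos g w * \1_B w) + pos g w * \1_(~` B) w) = pos g); last first.
    by apply/funext => w; rewrite mul1r -mulrDr !indicE in_setC; case: (w \in B); rewrite ?addr0 ?add0r mulr1.
  apply.
  - by rewrite mulr1.
  - by apply: orlicz_indic => //; exact: Vpos.
  - by move=> w; rewrite mulr_ge0// indicE; case: (_ \in _).
  - move=> w; rewrite indicE mul1r; case: (boolP (w \in B)) => [/set_mem//|_].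
    by rewrite mulr0 eqxx.
  - by rewrite mulrNN mulr1.
  - by apply: orlicz_indic => //; [exact: measurableC|exact: Vpos].
  - by move=> w; rewrite mulr_ge0// indicE; case: (_ \in _).
  - move=> w; rewrite indicE mulN1r oppr_ge0; case: (boolP (w \in ~` B)) => [/set_mem/= /negP|_].
      by rewrite -ltNge => /ltW.
    by rewrite mulr0 eqxx.
have := good_lin (-1) (gpos _ (orliczN hY Vf)) (gpos _ Vf).
rewrite (_ : (fun w => _) = f); first by case.
apply/funext => w; rewrite /pos; have [f0|f0] := leP (f w) 0.
  by rewrite max_l ?oppr_ge0//; ring.
by rewrite max_r ?oppr_le0 ?(ltW f0)//; ring.
Qed.

End DensityOfSeqContinuous.

End Densities.

(** * Order continuity of functionals with a density *)

Section OrderContinuity.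
Context {disp : measure_display} {Omega : measurableType disp} {R : realType}.
Variables (P : probability Omega R) (Y : R -> \bar R).
Hypothesis hY : young Y.
Implicit Types (f g h : Omega -> R) (z v : @functional _ Omega R).

Local Notation V := (orlicz P Y).
Local Notation M := (modular P Y).

Lemma Lone_mul_abs f chi : measurable_fun setT f -> measurable_fun setT chi ->
  Lone P (fun w => f w * chi w) -> Lone P (fun w => f w * `|chi w|).
Proof.
move=> mf mchi fi; apply: (Lone_le _ _ (Lone_abs fi)) => [|w].
  by apply: measurable_funM => //; exact: measurableT_comp.
by rewrite !normrM normr_id.
Qed.

Lemma Ex_gt0_eq0 f : Lone P f -> (forall w, 0 <= f w) -> Ex P f <= 0 ->
  {ae P, forall w, f w = 0}.
Proof.
move=> fi f0 Ef; apply: Ex_abs_eq0 => //; apply/le_anti/andP; split.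
  by rewrite (@eq_Ex _ _ _ P _ f)// => w; rewrite ger0_norm.
by apply: Ex_ge0.
Qed.

(** Minimizing one strictly positive integral along the net produces a sequence
    whose limit is an a.e. lower bound of the whole net. *)
Lemma net_inf_integral (I : Type) (prec : I -> I -> Prop) (g : I -> Omega -> R)
    (rho : Omega -> R) :
  inhabited I ->
  (forall i j k, prec i j -> prec j k -> prec i k) ->
  (forall i j, exists k, prec i k /\ prec j k) ->
  (forall i, V (g i)) -> (forall i j, prec i j -> ae_le P (g j) (g i)) ->
  (forall i, ae_le P (cst 0) (g i)) ->
  (forall h, V h -> (forall i, ae_le P h (g i)) -> ae_le P h (cst 0)) ->
  measurable_fun setT rho -> (forall w, 0 < rho w) ->
  (forall f, V f -> Lone P (fun w => f w * rho w)) ->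
  forall eps, 0 < eps -> exists i, Ex P (fun w => g i w * rho w) < eps.
Proof.
move=> [i0] ptrans pdir Vg gdec g0 ginf mrho rho0 Vrho eps eps0.
pose kappa i := Ex P (fun w => g i w * rho w).
have kappa_mono i j : prec i j -> kappa j <= kappa i.
  move=> ij; apply: le_Ex_ae; [exact: Vrho|exact: Vrho|].
  by apply: filterS (gdec _ _ ij) => w le; rewrite ler_wpM2r// ltW.
have kappa0 i : 0 <= kappa i.
  rewrite -(Ex_cst P 0); apply: le_Ex_ae; [exact: Lone_cst|exact: Vrho|].
  by apply: filterS (g0 i) => w /= le; rewrite mulr_ge0// ltW.
pose m := inf (range kappa).
have hasinf : has_inf (range kappa).
  by split; [exists (kappa i0), i0|exists 0 => _ [i _ <-]].
have m_le i : m <= kappa i by apply: inf_lbound; [case: hasinf|exists i].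
have near_m n : exists i, kappa i < m + n.+1%:R^-1.
  have [||_ [i _ <-] ki] := @inf_adherent _ (range kappa) n.+1%:R^-1; last by exists i.
  - by rewrite invr_gt0.
  - exact: hasinf.
have [j jprec jm] : exists2 j : nat -> I, (forall n, prec (j n) (j n.+1)) &
    (forall n, kappa (j n) < m + n.+1%:R^-1).
  have step (x : I * nat) : {y : I | prec x.1 y /\ kappa y < m + x.2.+2%:R^-1}.
    apply: cid; have [i ki] := near_m x.2.+1; have [k [xk ik]] := pdir x.1 i.
    by exists k; split => //; apply: le_lt_trans ki; exact: kappa_mono.
  have [i1 ki1] := near_m 0%N.
  pose j := fix j n := if n is n'.+1 then sval (step (j n', n')) else i1.
  exists j => [n|[|n]] //=; first by case: (svalP (step (j n, n))).
  by case: (svalP (step (j n, n))).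
pose G n w := Num.max (g (j n) w) 0.
(* The net decreases only almost surely; positive parts and running minima give versions that are
   nonnegative and decreasing everywhere. *)
pose H := fix H n w := if n is n'.+1 then Num.min (H n' w) (G n'.+1 w) else G 0%N w.
have VG n : V (G n) by apply: orlicz_max => //; exact: orlicz0.
have VH n : V (H n) by elim: n => [|n IH] //=; exact: orlicz_min.
have H0 n w : 0 <= H n w.
  by elim: n => [|n IH] /=; rewrite /G ?le_min ?IH /= le_max lexx orbT.
have Hdec w : nonincreasing_seq (H ^~ w).
  by apply/nonincreasing_seqP => n /=; rewrite ge_min lexx.
have HE n : {ae P, forall w, H n w = g (j n) w}.
  elim: n => [|n IH] /=.
    by apply: filterS (g0 (j 0%N)) => w /= ?; rewrite /G max_l.
  apply: filterS3 IH (gdec _ _ (jprec n)) (g0 (j n.+1)) => w -> le /= ?.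
  by rewrite /G max_l// min_r.
pose h w := limn (H ^~ w).
have Hh w : H n w @[n --> \oo] --> h w.
  by apply: nonincreasing_is_cvgn => //; exists 0 => _ [n _ <-].
have mh : measurable_fun setT h.
  apply: (@measurable_fun_cvg _ _ _ _ H); first by move=> n; exact: orlicz_measurable (VH n).
  by move=> w _; exact: Hh.
have h0 w : 0 <= h w by apply: limr_ge; [exact: cvgP (Hh w)|exact: nearW].
have hH n w : h w <= H n w.
  by apply: nonincreasing_cvgn_ge => //; exact: cvgP (Hh w).
have Vh : V h.
  by apply: (orlicz_solid_le hY mh (VH 0%N)) => w; rewrite !ger0_norm// hH.
have EH n : Ex P (fun w => H n w * rho w) = kappa (j n).
  apply/le_anti/andP; split; apply: le_Ex_ae; try exact: Vrho;
    by apply: filterS (HE n) => w ->.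
(* The net has elements below both [g i] and [H n], so the minimum of [g i] and [h] still has
   [rho]-integral at least [m], while that of [h] is at most [m]. As [rho] is strictly positive, the
   two functions agree almost surely. *)
have h_le i : ae_le P h (g i).
  pose gi w := Num.min (g i w) (h w).
  have Vgi : V gi by exact: orlicz_min.
  have m_gi : m <= Ex P (fun w => gi w * rho w).
    have Egn n : m <= Ex P (fun w => Num.min (g i w) (H n w) * rho w).
      have [k [ik jk]] := pdir i (j n); apply: (le_trans (m_le k)).
      apply: le_Ex_ae; [exact: Vrho|by apply: Vrho; exact: orlicz_min|].
      apply: filterS3 (HE n) (gdec _ _ ik) (gdec _ _ jk) => w -> le1 le2.
      by rewrite ler_wpM2r ?(ltW (rho0 w))// le_min le1 le2.
    have cv : Ex P (fun w => Num.min (g i w) (H n w) * rho w) @[n --> \oo] -->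
        Ex P (fun w => gi w * rho w).
      apply: (@Ex_dominated _ _ _ _ _ _ (fun w => (`|g i w| + H 0%N w) * rho w)).
      - move=> n; apply: measurable_funM => //; apply: orlicz_measurable.
        by apply: orlicz_min; [exact: hY|exact: Vg|exact: VH].
      - by apply: measurable_funM => //; exact: orlicz_measurable Vgi.
      - apply: aeW => w; apply: cvgMl.
        rewrite /gi; under eq_fun do rewrite minr_absE; rewrite minr_absE.
        apply: cvgMl; apply: cvgB; first by apply: cvgD; [exact: cvg_cst|exact: Hh].
        by apply: cvg_norm; apply: cvgB; [exact: cvg_cst|exact: Hh].
      - move=> n; apply: aeW => w; rewrite normrM (gtr0_norm (rho0 w)).
        rewrite ler_wpM2r ?(ltW (rho0 w))//.
        have Hn : H n w <= H 0%N w by exact: Hdec.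
        have [_|_] := leP (g i w) (H n w); first by rewrite lerDl.
        by rewrite ger0_norm// (le_trans Hn)// lerDr.
      - by apply: Vrho; apply: orliczD => //; exact: orlicz_abs.
    rewrite -(cvg_lim _ cv)//; apply: limr_ge; first exact: cvgP cv.
    exact: nearW.
  have Eh : Ex P (fun w => h w * rho w) <= m.
    have cv : Ex P (fun w => H n w * rho w) @[n --> \oo] --> Ex P (fun w => h w * rho w).
      apply: (@Ex_dominated _ _ _ _ _ _ (fun w => H 0%N w * rho w)).
      - by move=> n; apply: measurable_funM => //; exact: orlicz_measurable (VH n).
      - exact: measurable_funM.
      - by apply: aeW => w; apply: cvgMl; exact: Hh.
      - move=> n; apply: aeW => w; rewrite normrM (gtr0_norm (rho0 w)) ger0_norm//.
        by rewrite ler_wpM2r ?(ltW (rho0 w))//; exact: Hdec.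
      - exact: Vrho.
    apply/ler_addgt0Pr => e e0.
    have /cvgrPdist_lt/(_ e e0)[n _ /(_ n (leqnn n))/=] := @cvg_harmonic R.
    rewrite sub0r normrN ger0_norm// => ne.
    apply: (@le_trans _ _ (kappa (j n))); last first.
      by rewrite (le_trans (ltW (jm n)))// lerD2l ltW.
    by rewrite -EH; apply: le_Ex => [||w]; rewrite ?ler_pM2r//; exact: Vrho.
  have dE : {ae P, forall w, (h w - gi w) * rho w = 0}.
    apply: Ex_gt0_eq0; first by apply: Vrho; exact: orliczB.
      by move=> w; rewrite mulr_ge0 ?(ltW (rho0 w))// subr_ge0 ge_min lexx orbT.
    rewrite (@eq_Ex _ _ _ P _ (fun w => h w * rho w - gi w * rho w)); last first.
      by move=> w; rewrite mulrBl.
    rewrite ExB; [|exact: Vrho|exact: Vrho].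
    by rewrite subr_le0 (le_trans Eh).
  apply: filterS dE => w /eqP; rewrite mulf_eq0 (gt_eqF (rho0 w)) orbF subr_eq0 => /eqP ->.
  by rewrite ge_min lexx.
have hz := ginf h Vh h_le.
have cv : Ex P (fun w => H n w * rho w) @[n --> \oo] --> Ex P (fun=> 0).
  apply: (@Ex_dominated _ _ _ _ _ _ (fun w => H 0%N w * rho w)).
  - by move=> n; apply: measurable_funM => //; exact: orlicz_measurable (VH n).
  - exact: measurable_cst.
  - apply: filterS hz => w /= hw.
    have hw0 : h w = 0 by apply/le_anti; rewrite hw h0.
    by rewrite -(mul0r (rho w)); apply: cvgMl; rewrite -hw0; exact: Hh.
  - move=> n; apply: aeW => w; rewrite normrM (gtr0_norm (rho0 w)) ger0_norm//.
    by rewrite ler_wpM2r ?(ltW (rho0 w))//; exact: Hdec.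
  - exact: Vrho.
have /cvgrPdist_lt/(_ _ eps0)[n _ /(_ n (leqnn n))/=] := cv.
rewrite EH Ex_cst sub0r normrN ger0_norm// => ?; by exists (j n).
Qed.

Lemma density_regular v chi : dual P Y v -> has_density P Y v chi -> regular P Y v.
Proof.
move=> vd [mchi vchi]; split => // I prec f Iinh _ ptrans pdir Vf.
move=> [g [Vg gdec g0 ginf fg]] eps eps0.
(* The 1 makes the weight strictly positive where [chi] vanishes; it keeps the products integrable
   because the Orlicz space embeds in L^1. *)
pose rho w := `|chi w| + 1.
have mrho : measurable_fun setT rho.
  by apply: measurable_funD => //; exact: measurableT_comp.
have rho0 w : 0 < rho w by rewrite ltr_wpDl.
have Vrho h : V h -> Lone P (fun w => h w * rho w).
  move=> Vh; have [hi _] := vchi _ Vh.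
  have := LoneD (Lone_mul_abs (orlicz_measurable Vh) mchi hi) (orlicz_Lone hY Vh).
  by congr (Lone _ _); apply/funext => w; rewrite /rho mulrDr mulr1.
have [i0 Ei0] := net_inf_integral Iinh ptrans pdir Vg gdec g0 ginf mrho rho0 Vrho eps0.
exists i0 => i i0i; have [fi ->] := vchi _ (Vf i).
apply: le_lt_trans Ei0; apply: (le_trans (Ex_abs fi)).
apply: le_Ex_ae; [exact: Lone_abs|exact: Vrho|].
apply: filterS2 (fg i) (gdec _ _ i0i) => w fgw gw; rewrite normrM.
apply: ler_pM => //; first exact: le_trans gw.
by rewrite lerDl.
Qed.

End OrderContinuity.

(** On [A], |eta| is at most [n.+1] plus the excess of |eta| over [n]. The excess has small
    expectation for large [n] by dominated convergence, and the constant part is controlled by the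
    probability of [A]. *)
Lemma Ex_abs_continuous {disp : measure_display} {Omega : measurableType disp}
    {R : realType} (P : probability Omega R) (eta : Omega -> R) (eps : R) :
  Lone P eta -> 0 < eps -> exists2 delta, 0 < delta & forall A, measurable A ->
    Ex P \1_A < delta -> Ex P (fun w => `|eta w| * \1_A w) < eps.
Proof.
move=> etai eps0; have meta := Lone_measurable etai.
pose tail n w := Num.max (`|eta w| - n%:R) 0.
have mtail n : measurable_fun setT (tail n).
  apply: measurable_maxr => //; apply: measurable_funB => //.
  exact: measurableT_comp.
have cv : Ex P (tail n) @[n --> \oo] --> Ex P (fun=> 0).
  apply: (Ex_dominated (g := fun w => `|eta w|)) => //.
  - apply: aeW => w; apply/cvgrPdist_lt => e e0.
    exists (Num.truncn `|eta w|).+1 => // n /= wn.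
    rewrite /tail max_r ?subr0 ?normr0// subr_le0.
    by rewrite (le_trans (ltW (truncnS_gt _)))// ler_nat.
  - move=> n; apply: aeW => w; rewrite /tail ger0_norm; last by rewrite le_max lexx orbT.
    by rewrite ge_max normr_ge0 andbT gerBl.
  - exact: Lone_abs.
have e2 : 0 < eps / 2 by rewrite divr_gt0.
have /cvgrPdist_lt/(_ _ e2)[n _ /(_ n (leqnn n))/=] := cv.
rewrite Ex_cst sub0r normrN => /(le_lt_trans (ler_norm _)) tn.
have taili : Lone P (tail n).
  apply: (Lone_le (mtail n) _ (Lone_abs etai)) => w.
  rewrite ger0_norm; last by rewrite le_max lexx orbT.
  by rewrite ge_max normr_ge0 andbT gerBl.
exists (eps / 2 / n.+1%:R); first by rewrite divr_gt0.
move=> A mA PA; have m1A : measurable_fun setT (\1_A : Omega -> R) by exact: measurable_indic.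
have Ai : Lone P \1_A.
  by apply: (Lone_bounded P (k := 1)) => // w; rewrite indicE; case: (_ \in _); rewrite ?normr1 ?normr0.
apply: (@le_lt_trans _ _ (Ex P (fun w => n.+1%:R * \1_A w + tail n w))).
  apply: le_Ex; last move=> w.
  - apply: (Lone_le _ _ (Lone_abs etai)) => [|w].
      by apply: measurable_funM => //; exact: measurableT_comp.
    by rewrite normrM normr_id ler_piMr// indicE; case: (_ \in _); rewrite ?normr1 ?normr0.
  - by apply: LoneD => //; exact: LoneZ.
  have t0 : 0 <= tail n w by rewrite le_max lexx orbT.
  rewrite indicE; case: (_ \in _); rewrite ?mulr0 ?add0r// !mulr1.
  have : `|eta w| - n%:R <= tail n w by rewrite le_max lexx.
  by rewrite -natr1; lra.
rewrite ExD//; last exact: LoneZ.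
rewrite ExZ// (splitr eps) ltrD//.
by rewrite mulrC -ltr_pdivlMr.
Qed.

(** * Singular functionals and the small sets that carry them *)

Section SingularFunctionals.
Context {disp : measure_display} {Omega : measurableType disp} {R : realType}.
Variables (P : probability Omega R) (Y : R -> \bar R).
Hypothesis hY : young Y.
Implicit Types (f g h : Omega -> R) (z v : @functional _ Omega R).

Local Notation V := (orlicz P Y).
Local Notation M := (modular P Y).
Local Notation positive := (dual_le P Y (fun=> 0)).

Lemma dual_lin b z v : dual P Y z -> dual P Y v -> dual P Y (fun f => b * z f + v f).
Proof.
move=> /(dualP P hY)[zl [C zC]] /(dualP P hY)[vl [B vB]]; apply/(dualP P hY); split.
  by move=> c f g Vf Vg; rewrite zl// vl//; ring.
exists (`|b| * C + B) => f Vf Mf; rewrite (le_trans (ler_normD _ _))// lerD ?vB//.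
by rewrite normrM ler_wpM2l// zC.
Qed.

Lemma dualB z v : dual P Y z -> dual P Y v -> dual P Y (fun f => z f - v f).
Proof.
move=> zd vd; have := dual_lin (-1) vd zd.
by congr (dual _ _ _); apply/funext => f; rewrite mulN1r addrC.
Qed.

Lemma Ex_density : has_density P Y (Ex P) (fun=> 1).
Proof.
split=> // f Vf; have E : (fun w => f w * 1) = f by apply/funext => w; rewrite mulr1.
by rewrite E; split => //; exact: (orlicz_Lone hY Vf).
Qed.

Lemma Ex_dual : dual P Y (Ex P).
Proof.
apply/(dualP P hY); split.
  move=> b f g /(orlicz_Lone hY) fi /(orlicz_Lone hY) gi.
  by rewrite (ExD (LoneZ b fi) gi) ExZ.
have [a [b [a0 ab]]] := young_coercive hY; exists (a + b) => f Vf Mf.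
have fi := orlicz_Lone hY Vf; apply: (le_trans (Ex_abs fi)).
have b0 : 0 <= b by have := ab 0; rewrite (young0 hY) mule0 add0e normr0 lee_fin.
have mY := modular_measurable hY (orlicz_measurable Vf).
rewrite -lee_fin -Ex_EFin; last exact: Lone_abs.
apply: (@le_trans _ _ (\int[P]_w (a%:E * Y (f w) + b%:E))%E).
  apply: ge0_le_integral => //=.
  - apply: measurableT_comp => //; apply: measurableT_comp => //.
    exact: orlicz_measurable Vf.
  - by apply: emeasurable_funD => //; exact: measurable_funeM.
rewrite ge0_integralD//=; last 2 first.
- by move=> w _; rewrite mule_ge0// ?lee_fin// (young_ge0 hY).
- exact: measurable_funeM.
rewrite ge0_integralZl//; last by move=> *; exact: young_ge0.
rewrite integral_cst_probability EFinD leeD2r// -[leRHS]mule1.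
by rewrite lee_wpmul2l ?lee_fin.
Qed.

(** Supplies the regular functional against which the disjointness of singular ones is tested. *)
Lemma Ex_regular : regular P Y (Ex P).
Proof. exact: (density_regular hY Ex_dual Ex_density). Qed.

Lemma positive_modulus z : dual P Y z -> positive z -> is_modulus P Y z z.
Proof.
move=> zd z0; split=> // f Vf f0.
by have := z0 f Vf f0; lra.
Qed.

Lemma modulus_positive z m : is_modulus P Y z m -> positive m.
Proof.
by case=> _ zm nzm _ f Vf f0; have := zm f Vf f0; have := nzm f Vf f0; lra.
Qed.

Lemma Ex_mul_lin chi b f g : V f -> V g ->
  (forall f, V f -> Lone P (fun w => f w * chi w)) ->
  Ex P (fun w => (b * f w + g w) * chi w) =
    b * Ex P (fun w => f w * chi w) + Ex P (fun w => g w * chi w).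
Proof.
move=> Vf Vg ci; rewrite -(ExZ b (ci f Vf)) -ExD; [|exact: LoneZ (ci f Vf)|exact: ci].
by apply: (eq_Ex P) => w; ring.
Qed.

(** Along the sign of [chi], the integral against |chi| is [v] on the part where [chi] is
    nonnegative minus [v] on the rest. An upper bound of [v] and [- v] dominates each piece. *)
Lemma density_modulus v chi : dual P Y v -> has_density P Y v chi ->
  is_modulus P Y v (fun f => Ex P (fun w => f w * `|chi w|)).
Proof.
move=> vd [mchi vchi].
have ci f : V f -> Lone P (fun w => f w * chi w) by case/vchi.
have aci f : V f -> Lone P (fun w => f w * `|chi w|).
  by move=> Vf; apply: Lone_mul_abs => //; [exact: orlicz_measurable Vf|exact: ci].
pose B := [set w | 0 <= chi w].
have mB : measurable B.
  rewrite -[B]setTI (_ : setT `&` B = setT `&` chi @^-1` `[0, +oo[).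
    by apply: mchi => //; exact: measurable_itv.
  by apply/seteqP; split => w [_ /=]; rewrite ?in_itv/= ?andbT.
have mBc := measurableC mB.
have VB f : V f -> V (fun w => f w * \1_B w) by exact: orlicz_indic.
have VBc f : V f -> V (fun w => f w * \1_(~` B) w) by exact: orlicz_indic.
have absE f : V f -> Ex P (fun w => f w * `|chi w|) =
    v (fun w => f w * \1_B w) - v (fun w => f w * \1_(~` B) w).
  move=> Vf; have [i1 ->] := vchi _ (VB _ Vf); have [i2 ->] := vchi _ (VBc _ Vf).
  rewrite -ExB//; apply: (eq_Ex P) => w; rewrite !indicE in_setC.
  case: (boolP (w \in B)) => [/set_mem Bw|wB]; rewrite ?mulr1 ?mulr0 ?mul0r ?subr0 ?sub0r.
    by rewrite ger0_norm.
  rewrite ltr0_norm ?mulrN// ltNge; apply/negP => ?.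
  by move/negP: wB; apply; exact/mem_set.
have splitB m f : linear_on P Y m -> V f -> m f =
    m (fun w => f w * \1_B w) + m (fun w => f w * \1_(~` B) w).
  move=> ml Vf; rewrite -(linear_onD ml (VB _ Vf) (VBc _ Vf)); congr m; apply/funext => w.
  by rewrite -mulrDr !indicE in_setC; case: (w \in B); rewrite ?addr0 ?add0r mulr1.
split.
- apply/(dualP P hY); split; first by move=> b f g Vf Vg; exact: Ex_mul_lin.
  have [vl [C vC]] := (dualP P hY v).1 vd.
  exists (C + C) => f Vf Mf; rewrite absE// (le_trans (ler_normB _ _))//.
  have le1 A : measurable A -> (M (fun w => f w * \1_A w)%R <= 1)%E.
    move=> mA; apply: le_trans Mf; apply: le_modular => //.
    - exact: orlicz_measurable (orlicz_indic hY mA Vf).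
    - exact: orlicz_measurable Vf.
    apply: aeW => w; rewrite normrM ler_piMr// indicE.
    by case: (_ \in _); rewrite ?normr1 ?normr0.
  by apply: lerD; apply: vC; [exact: VB|exact: le1|exact: VBc|exact: le1].
- move=> f Vf f0; have [i ->] := vchi _ Vf; apply: le_Ex_ae => //; first exact: aci.
  by apply: filterS f0 => w f0; rewrite ler_wpM2l// ler_norm.
- move=> f Vf f0; have [i ->] := vchi _ Vf; rewrite -mulN1r -ExZ//.
  apply: le_Ex_ae; [exact: LoneZ|exact: aci|].
  by apply: filterS f0 => w f0; rewrite mulrCA mulN1r ler_wpM2l// -normrN ler_norm.
- move=> m md vm nvm f Vf f0; rewrite absE// (splitB m f (dual_linear hY md) Vf).
  have f1 A : ae_le P (cst 0) (fun w => f w * \1_A w).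
    by apply: filterS f0 => w /= f0; rewrite mulr_ge0// indicE; case: (_ \in _).
  have := vm _ (VB _ Vf) (f1 _); have := nvm _ (VBc _ Vf) (f1 _); lra.
Qed.

Lemma positive_part_le z m q : dual P Y m -> positive m -> dual_le P Y z m ->
  dual P Y q ->
  (forall f, V f -> (forall w, 0 <= f w) -> forall B,
    (forall g, V g -> (forall w, 0 <= g w <= f w) -> z g <= B) -> q f <= B) ->
  dual_le P Y q m.
Proof.
move=> md m0 zm qd qB f Vf f0.
pose f' w := Num.max (f w) 0.
have Vf' : V f' by apply: orlicz_max => //; exact: orlicz0.
have ff' : {ae P, forall w, f w = f' w}.
  by apply: filterS f0 => w /= ?; rewrite /f' max_l.
rewrite (dual_eq_ae hY qd Vf Vf' ff') (dual_eq_ae hY md Vf Vf' ff').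
apply: qB => // [w|g Vg gf]; first by rewrite le_max lexx orbT.
apply: (@le_trans _ _ (m g)).
  by apply: zm => //; apply: aeW => w; have /andP[] := gf w.
by apply: (dual_le_mono hY md m0 Vg Vf'); apply: aeW => w; have /andP[] := gf w.
Qed.

(** The positive part of [- zs] lies below the modulus of [zs], and also below that of [zr] because
    [- zs <= zr]. Disjointness makes it vanish. *)
Lemma singular_part_positive zr zs : regular P Y zr -> singular P Y zs ->
  positive (fun f => zr f + zs f) -> positive zs.
Proof.
move=> rzr [zsd sing] Q0; have [zrd _] := rzr.
have nzsd : dual P Y (fun f => - zs f).
  have := dualB zsd (dual_lin 1 zsd zsd).
  by congr (dual _ _ _); apply/funext => f; lra.
have [q [qd q0 nzq qB]] := positive_part_exists hY nzsd.
have [m1 [m2 [mod1 mod2 disj]]] := sing zr rzr.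
have q_le0 : dual_le P Y q (fun=> 0).
  apply: disj => //.
    by apply: (positive_part_le (z := fun f => - zs f)) => //; [case: mod1|exact: modulus_positive mod1|case: mod1].
  apply: (positive_part_le (z := fun f => - zs f)) => //; [by case: mod2|exact: modulus_positive mod2|].
  move=> f Vf f0; have [_ zrm _ _] := mod2.
  by have := zrm f Vf f0; have := Q0 f Vf f0; lra.
by move=> f Vf f0; have := nzq f Vf f0; have := q_le0 f Vf f0; lra.
Qed.

(** [zs - (zs - E)^+] lies below both [zs] and the expectation [E], hence vanishes
    by disjointness; [g] nearly attains the supremum defining [(zs - E)^+ f]. *)
Lemma singular_approx zs f delta : singular P Y zs -> positive zs -> V f ->
  (forall w, 0 <= f w) -> 0 < delta ->
  exists g, [/\ V g, forall w, 0 <= g w <= f w & zs (fun w => f w - g w) + Ex P g < delta].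
Proof.
move=> [zsd sing] zs0 Vf f0 d0.
have zE := dualB zsd Ex_dual.
have [q [qd q0 zq qB]] := positive_part_exists hY zE.
have [m1 [m2 [[_ zm1 _ _] [_ Em2 _ _] disj]]] := sing _ Ex_regular.
have f0ae : ae_le P (cst 0) f by exact: aeW.
have zq0 : zs f - q f <= 0.
  apply: (disj (fun f => zs f - q f)) => //; first exact: dualB.
    move=> g Vg g0; apply: le_trans (zm1 g Vg g0).
    by rewrite gerBl; exact: q0.
  move=> g Vg g0; apply: le_trans (Em2 g Vg g0).
  by have := zq g Vg g0; lra.
apply: contrapT => nex.
have : q f <= zs f - delta.
  apply: qB => // g Vg gf; rewrite leNgt; apply/negP => gt; apply: nex.
  exists g; split => //; rewrite (linear_onB (dual_linear hY zsd))//.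
  by move: gt; lra.
by move: zq0; lra.
Qed.

(** With [f = h + 1] and [g] from [singular_approx], take [A] where [f < 2 * g]. Off [A],
    [f <= 2 * (f - g)], so [zs] is small there. On [A], [1 <= 2 * g], so the probability of [A] is
    at most [2 * Ex P g] and absolute continuity applies; the 1 added to [h] serves this bound, and
    the two factors 2 explain the halves in [e]. *)
Lemma singular_small_set zs h eta eps : singular P Y zs -> positive zs -> V h ->
  (forall w, 0 <= h w) -> Lone P eta -> 0 < eps ->
  exists A, [/\ measurable A, zs (fun w => h w * \1_(~` A) w) < eps
    & Ex P (fun w => `|eta w| * \1_A w) < eps].
Proof.
move=> sing zs0 Vh h0 etai eps0; have [zsd _] := sing.
have [delta d0 dE] := Ex_abs_continuous etai eps0.
pose f w := h w + 1.
have Vf : V f by apply: orliczD => //; exact: orlicz_cst.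
have f0 w : 0 <= f w by rewrite addr_ge0.
pose e := Num.min (eps / 2) (delta / 2).
have e0 : 0 < e by rewrite lt_min !divr_gt0.
have [g [Vg gf zg]] := singular_approx sing zs0 Vf f0 e0.
have Eg0 : 0 <= Ex P g by apply: Ex_ge0 => w; have /andP[] := gf w.
have Vfg : V (fun w => f w - g w) by exact: orliczB.
have zg0 : 0 <= zs (fun w => f w - g w).
  by apply: zs0 => //; apply: aeW => w /=; have /andP[] := gf w; rewrite subr_ge0.
have eE : e <= eps / 2 by rewrite ge_min lexx.
have ed : e <= delta / 2 by rewrite ge_min lexx orbT.
pose A := [set w | f w < 2 * g w].
have mA : measurable A.
  rewrite -[A]setTI; apply: measurable_fun_ltr => //; first exact: orlicz_measurable Vf.
  by apply: measurable_funM => //; exact: orlicz_measurable Vg.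
exists A; split => //.
  apply: (@le_lt_trans _ _ (zs (fun w => 2 * (f w - g w)))).
    apply: (dual_le_mono hY zsd zs0); first by apply: orlicz_indic => //; exact: measurableC.
      exact: orliczZ.
    apply: aeW => w; have /andP[g0 gfw] := gf w; rewrite indicE in_setC.
    case: (boolP (w \in A)) => [_|wA]; first by rewrite mulr0 mulr_ge0// subr_ge0.
    have : 2 * g w <= f w by rewrite leNgt; apply: contra wA => ?; exact/mem_set.
    by rewrite mulr1 /f; lra.
  rewrite (linear_onZ hY _ (dual_linear hY zsd))//; move: zg eE Eg0; lra.
apply: dE => //; apply: (@le_lt_trans _ _ (Ex P (fun w => 2 * g w))).
  have gi := orlicz_Lone hY Vg.
  apply: le_Ex => [||w]; [|exact: LoneZ|].
    apply: (Lone_bounded P (k := 1)); first exact: measurable_indic.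
    by move=> w; rewrite indicE; case: (_ \in _); rewrite ?normr1 ?normr0.
  rewrite indicE; case: (boolP (w \in A)) => [/set_mem/= Aw|_].
    suff : 1 <= 2 * g w by [].
    by have : f w < 2 * g w := Aw; move: (h0 w); rewrite /f; lra.
  by rewrite mulr_ge0//; have /andP[] := gf w.
have -> : Ex P (fun w => 2 * g w) = 2 * Ex P g by exact: (ExZ 2 (orlicz_Lone hY Vg)).
by move: zg ed zg0; lra.
Qed.

End SingularFunctionals.

(** * Band decomposition of a positive functional *)

Section Decomposition.
Context {disp : measure_display} {Omega : measurableType disp} {R : realType}.
Variables (P : probability Omega R) (Y : R -> \bar R).
Hypothesis hY : young Y.
Implicit Types (f g h : Omega -> R) (z v : @functional _ Omega R).

Local Notation V := (orlicz P Y).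
Local Notation M := (modular P Y).
Local Notation positive := (dual_le P Y (fun=> 0)).

Lemma positive_everywhere z : dual P Y z ->
  (forall f, V f -> (forall w, 0 <= f w) -> 0 <= z f) -> positive z.
Proof.
move=> zd z0 f Vf f0.
have Vf' : V (fun w => Num.max (f w) 0) by apply: orlicz_max => //; exact: orlicz0.
have ff' : {ae P, forall w, f w = Num.max (f w) 0}.
  by apply: filterS f0 => w /= ?; rewrite max_l.
rewrite (dual_eq_ae hY zd Vf Vf' ff'); apply: z0 => // w.
by rewrite le_max lexx orbT.
Qed.

Section Existence.
Variable Q : @functional _ Omega R.
Hypotheses (Qd : dual P Y Q) (Q0 : positive Q).

Let Ql : linear_on P Y Q. Proof. exact: dual_linear Qd. Qed.

Let D (phi : Omega -> R) := [/\ measurable_fun setT phi, forall w, 0 <= phi w &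
  forall f, V f -> (forall w, 0 <= f w) ->
    Lone P (fun w => f w * phi w) /\ Ex P (fun w => f w * phi w) <= Q f].

Let D0 : D (fun=> 0).
Proof.
split=> // f Vf f0; rewrite (_ : (fun w => f w * 0) = (fun=> 0)); last first.
  by apply/funext => w; rewrite mulr0.
by split; [exact: Lone_cst|rewrite Ex_cst; apply: Q0 => //; exact: aeW].
Qed.

(** Splitting along the set where [phi < psi] applies each density where it is the larger one;
    linearity of [Q] reassembles the two bounds. *)
Let D_max phi psi : D phi -> D psi -> D (fun w => Num.max (phi w) (psi w)).
Proof.
move=> [mphi phi0 Dphi] [mpsi psi0 Dpsi]; split.
- exact: measurable_maxr.
- by move=> w; rewrite le_max phi0.
move=> f Vf f0; pose A := [set w | phi w < psi w].
have mA : measurable A by rewrite -[A]setTI; exact: measurable_fun_ltr.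
have mAc := measurableC mA.
have pos B : forall w, 0 <= f w * \1_B w.
  by move=> w; rewrite mulr_ge0// indicE; case: (_ \in _).
have [i1 E1] := Dphi _ (orlicz_indic hY mAc Vf) (pos _).
have [i2 E2] := Dpsi _ (orlicz_indic hY mA Vf) (pos _).
rewrite (_ : (fun w => _ * _) =
    fun w => f w * \1_(~` A) w * phi w + f w * \1_A w * psi w); last first.
  apply/funext => w; rewrite !indicE in_setC.
  case: (boolP (w \in A)) => [/set_mem Aw|wA].
    by rewrite max_r ?mulr0 ?mul0r ?add0r ?mulr1// ltW.
  rewrite max_l ?mulr0 ?mul0r ?addr0 ?mulr1// leNgt; apply: contra wA => ?.
  exact/mem_set.
split; first exact: LoneD.
rewrite ExD//; apply: (le_trans (lerD E1 E2)).
rewrite -(linear_onD Ql (orlicz_indic hY mAc Vf) (orlicz_indic hY mA Vf)).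
rewrite (_ : (fun w => _ + _) = f)//; apply/funext => w.
by rewrite -mulrDr !indicE in_setC; case: (w \in A); rewrite ?addr0 ?add0r mulr1.
Qed.

Let D_Ex phi : D phi -> Lone P phi /\ Ex P phi <= Q (fun=> 1).
Proof.
move=> [mphi _ /(_ _ (orlicz_cst P hY 1) (fun=> ler01))].
by under eq_fun do rewrite mul1r.
Qed.

Let S := [set Ex P phi | phi in D].

Let hasS : has_sup S.
Proof.
split; first by exists (Ex P (fun=> 0)), (fun=> 0).
by exists (Q (fun=> 1)) => _ [phi /D_Ex[_ ?] <-].
Qed.

Let D_incr (psi : nat -> Omega -> R) : (forall n, D (psi n)) ->
  (forall w, nondecreasing_seq (psi ^~ w)) ->
  exists2 phi, D phi & {ae P, forall w, forall n, psi n w <= phi w}.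
Proof.
move=> Dpsi psi_nd.
pose e w := ereal_sup (range (fun n => (psi n w)%:E)).
have cve w : (psi n w)%:E @[n --> \oo] --> e w.
  by apply: ereal_nondecreasing_cvgn => m n mn; rewrite lee_fin psi_nd.
have mpsi n : measurable_fun setT (psi n) by case: (Dpsi n).
have psi0 n w : 0 <= psi n w by case: (Dpsi n).
have psii n : Lone P (psi n) by case: (D_Ex (Dpsi n)).
have me : measurable_fun setT e.
  apply: (@emeasurable_fun_cvg _ _ _ _ (fun n w => (psi n w)%:E)) => //.
  by move=> n; exact/measurable_EFinP.
have e0 w : (0 <= e w)%E.
  apply: (@le_trans _ _ (psi 0%N w)%:E); first by rewrite lee_fin.
  by apply: ereal_sup_ubound; exists 0%N.
have ei : P.-integrable setT e.
  apply/integrableP; split => //.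
  under eq_integral do rewrite gee0_abs//.
  have -> : (\int[P]_w e w = \int[P]_w limn (fun n => (psi n w)%:E))%E.
    by apply: eq_integral => w _; rewrite (cvg_lim _ (cve w)).
  rewrite monotone_convergence//; last 3 first.
  - by move=> n; exact/measurable_EFinP.
  - by move=> n w _; rewrite lee_fin.
  - by move=> w _ m n mn; rewrite lee_fin psi_nd.
  apply: le_lt_trans (ltry (Q (fun=> 1))); apply: lime_le.
    apply: ereal_nondecreasing_is_cvgn => m n mn; rewrite !Ex_EFin// lee_fin.
    by apply: le_Ex => // w; exact: psi_nd.
  by apply: nearW => n; rewrite Ex_EFin// lee_fin; case: (D_Ex (Dpsi n)).
have efin := integrable_ae measurableT ei.
(* The supremum is finite almost surely, its expectation being at most [Q] of 1. Off [F] the default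
   value of [fine] sets [phi] to 0, which preserves measurability and domination. *)
pose F := [set w | e w \is a fin_num].
have mF : measurable F by rewrite -[F]setTI; exact: emeasurable_fin_num.
pose phi w := fine (e w).
have mphi : measurable_fun setT phi by exact: measurableT_comp.
have phi0 w : 0 <= phi w by exact: fine_ge0.
have cvphi w : psi n w * \1_F w @[n --> \oo] --> phi w.
  have [Fw|nFw] := pselect (F w).
    rewrite indicE mem_set//; under eq_fun do rewrite mulr1.
    by have := cve w; rewrite -[e w]fineK// => /fine_cvgP[].
  rewrite indicE memNset//; under eq_fun do rewrite mulr0.
  suff -> : phi w = 0 by exact: cvg_cst.
  by rewrite /phi; move: nFw (e0 w); rewrite /F /=; case: (e w).
exists phi; last first.
  apply: filterS efin => w /(_ I) Fw n.
  by rewrite -lee_fin fineK//; apply: ereal_sup_ubound; exists n.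
split => // f Vf f0; have [_ _ Df] := Dpsi 0%N.
have i1 n : Lone P (fun w => f w * (psi n w * \1_F w)).
  have [_ _ /(_ _ (orlicz_indic hY mF Vf))[]] := Dpsi n.
    by move=> w; rewrite mulr_ge0// indicE; case: (_ \in _).
  by move=> + _; congr (Lone _ _); apply/funext => w; ring.
have Eb n : Ex P (fun w => f w * (psi n w * \1_F w)) <= Q f.
  have [_ _ /(_ _ Vf f0)[i2]] := Dpsi n; apply: le_trans.
  apply: le_Ex => // w; rewrite mulrA; apply: ler_piMr; first exact: mulr_ge0.
  by rewrite indicE; case: (w \in F).
have [||w|w||fi cvE] := @Ex_monotone _ _ _ P _ (fun w => f w * phi w) (Q f) i1.
- by apply: measurable_funM => //; exact: orlicz_measurable Vf.
- by move=> n w; rewrite !mulr_ge0// indicE; case: (_ \in _).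
- move=> m n mn; apply: ler_wpM2l => //; apply: ler_wpM2r; last exact: psi_nd.
  by rewrite indicE; case: (w \in F).
- by apply: cvgMr; exact: cvphi.
- exact: Eb.
split => //; rewrite -(cvg_lim _ cvE)//; apply: limr_le; first exact: cvgP cvE.
exact: nearW.
Qed.

(** Exhaustion: running maxima of nearly optimal densities stay in [D], increase, and have a limit
    in [D] that attains the supremum. *)
Let D_has_max : exists2 phi, D phi & forall psi, D psi -> Ex P psi <= Ex P phi.
Proof.
have near_sup n : {phi | D phi /\ sup S - n.+1%:R^-1 < Ex P phi}.
  apply: cid; have n0 : 0 < n.+1%:R^-1 :> R by rewrite invr_gt0.
  by have [_ [phi Dphi <-] ?] := sup_adherent n0 hasS; exists phi.
pose phi n := sval (near_sup n).
have Dphi n : D (phi n) by rewrite /phi; case: (svalP (near_sup n)).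
pose psi := fix psi n w := if n is n'.+1 then Num.max (psi n' w) (phi n w) else phi 0%N w.
have Dpsi n : D (psi n) by elim: n => [|n IH]; [exact: Dphi|exact: D_max].
have psi_nd w : nondecreasing_seq (psi ^~ w).
  by apply/nondecreasing_seqP => n /=; rewrite le_max lexx.
have phi_psi n w : phi n w <= psi n w by case: n => //= n; rewrite le_max lexx orbT.
have [phi' Dphi' psi_phi] := D_incr Dpsi psi_nd.
exists phi' => // rho Drho.
have rhoS : Ex P rho <= sup S by apply: sup_upper_bound => //; exists rho.
apply: (le_trans rhoS); apply/ler_addgt0Pr => eps eps0.
have /cvgrPdist_lt/(_ _ eps0)[n _ /(_ n (leqnn n))/=] := @cvg_harmonic R.
rewrite sub0r normrN ger0_norm// => ne.
have {}ne : n.+1%:R^-1 < eps by exact: ne.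
have Sn : sup S - n.+1%:R^-1 < Ex P (phi n) by case: (svalP (near_sup n)).
have phin : Ex P (phi n) <= Ex P phi'.
  apply: le_Ex_ae; [by case: (D_Ex (Dphi n))|by case: (D_Ex Dphi')|].
  by apply: filterS psi_phi => w /(_ n); exact: le_trans.
by apply: le_trans (lerD phin (ltW ne)); rewrite -lerBlDr ltW.
Qed.

(** The regular part has the density of maximal expectation among those dominated
    by [Q]: a functional below the remainder and below some density would itself
    have a density, which could be added. *)
Lemma regular_singular_decomposition : exists zr, regular P Y zr /\
  singular P Y (fun f => Q f - zr f).
Proof.
have [phi [mphi phi0 Dphi] phimax] := D_has_max.
have phii f : V f -> Lone P (fun w => f w * phi w).
  move=> Vf; have [i _] := Dphi _ (orlicz_abs hY Vf) (fun w => normr_ge0 _).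
  apply: (Lone_le _ _ i) => [|w].
    by apply: measurable_funM => //; exact: orlicz_measurable Vf.
  by rewrite normrM (ger0_norm (phi0 w)).
pose zr f := Ex P (fun w => f w * phi w).
have zrd : dual P Y zr.
  apply/(dualP P hY); split; first by move=> b f g Vf Vg; apply: Ex_mul_lin Vf Vg phii.
  have [_ [C QC]] := (dualP P hY Q).1 Qd; exists C => f Vf Mf.
  apply: (le_trans (Ex_abs (phii _ Vf))).
  have [i Ei] := Dphi _ (orlicz_abs hY Vf) (fun w => normr_ge0 _).
  rewrite (@eq_Ex _ _ _ P _ (fun w => `|f w| * phi w)); last first.
    by move=> w /=; rewrite normrM (ger0_norm (phi0 w)).
  apply: (le_trans Ei); apply: (le_trans (ler_norm _)); apply: QC.
    exact: orlicz_abs.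
  apply: le_trans Mf; apply: le_modular => //.
  - exact: orlicz_measurable (orlicz_abs hY Vf).
  - exact: orlicz_measurable Vf.
  by apply: aeW => w; rewrite normr_id.
have zrdens : has_density P Y zr phi by split=> // f Vf; split => //; exact: phii.
have zsd : dual P Y (fun f => Q f - zr f) by exact: dualB.
have zs0 : positive (fun f => Q f - zr f).
  apply: positive_everywhere => // f Vf f0.
  by have [_] := Dphi f Vf f0; rewrite subr_ge0.
exists zr; split; first exact: (density_regular hY zrd zrdens).
split => // v [vd voc].
have [chi vchi] := seq_order_continuous_density hY vd
  (regular_seq_order_continuous (conj vd voc)).
have mod2 := density_modulus hY vd vchi.
set m2 := (fun f => Ex P _) in mod2.
have [m2d _ _ _] := mod2; have m20 := modulus_positive mod2.
exists (fun f => Q f - zr f), m2; split=> //; first exact: positive_modulus.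
move=> w wd wzs wm2.
have [q [qd q0 wq qB]] := positive_part_exists hY wd.
have q_zs := positive_part_le hY zsd zs0 wzs qd qB.
have q_m2 := positive_part_le hY m2d m20 wm2 qd qB.
have [mchi chii] := vchi.
have achii f : V f -> Lone P (fun w => f w * `|chi w|).
  by move=> Vf; apply: Lone_mul_abs => //; [exact: orlicz_measurable Vf|case: (chii f Vf)].
(* Being squeezed between 0 and the modulus [m2], which has density |chi|, [q] inherits sequential
   order continuity; this is why [w] is first replaced by its positive part. *)
have qc : seq_order_continuous P Y q.
  move=> f Vf fdec f0.
  have fge0 n t : 0 <= f n t.
    by rewrite -(cvg_lim _ (f0 t))//; apply: nonincreasing_cvgn_ge => //; exact: cvgP (f0 t).
  have cv : Ex P (fun t => f n t * `|chi t|) @[n --> \oo] --> Ex P (fun=> 0).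
    apply: (@Ex_dominated _ _ _ _ _ _ (fun t => f 0%N t * `|chi t|)).
    - by move=> n; exact: Lone_measurable (achii _ (Vf n)).
    - exact: measurable_cst.
    - by apply: aeW => t; rewrite -(mul0r `|chi t|); apply: cvgMl; exact: f0.
    - move=> n; apply: aeW => t; rewrite normrM normr_id ger0_norm//.
      by rewrite ler_wpM2r//; exact: fdec.
    - exact: achii.
  rewrite Ex_cst in cv; apply: (squeeze_cvgr _ (cvg_cst 0) cv).
  apply: nearW => n; have fae : ae_le P (cst 0) (f n) by exact: aeW.
  by rewrite q0//=; apply: q_m2.
have [rho [mrho rhoi]] := seq_order_continuous_density hY qd qc.
(* [D] requires nonnegativity everywhere. Truncating amounts to restricting [f] to the set where
   [rho] is positive, which does not increase [q f]. *)
pose rho' w := Num.max (rho w) 0.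
have mrho' : measurable_fun setT rho' by exact: measurable_maxr.
have rho'0 t : 0 <= rho' t by rewrite le_max lexx orbT.
have rho'E f : V f -> (forall t, 0 <= f t) ->
    Lone P (fun t => f t * rho' t) /\ Ex P (fun t => f t * rho' t) <= q f.
  move=> Vf f0; pose B := [set t | 0 < rho t].
  have mB : measurable B by rewrite -[B]setTI; apply: measurable_fun_ltr.
  have [i E] := rhoi _ (orlicz_indic hY mB Vf).
  rewrite (_ : (fun t => f t * rho' t) = (fun t => f t * \1_B t * rho t)); last first.
    apply/funext => t; rewrite /rho' indicE; case: (boolP (t \in B)) => [/set_mem Bt|tB].
      by rewrite mulr1 max_l// ltW.
    rewrite mulr0 mul0r max_r ?mulr0// leNgt; apply: contra tB => ?; exact/mem_set.
  split => //; rewrite -E; apply: (dual_le_mono hY qd q0) => //.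
    exact: orlicz_indic.
  apply: aeW => t; rewrite ler_piMr// indicE; by case: (_ \in _).
have Dsum : D (fun t => phi t + rho' t).
  split; [exact: measurable_funD|by move=> t; rewrite addr_ge0|].
  move=> f Vf f0; have [i1 E1] := Dphi f Vf f0; have [i2 E2] := rho'E f Vf f0.
  rewrite (_ : (fun t => _ * _) = fun t => f t * phi t + f t * rho' t); last first.
    by apply/funext => t; rewrite mulrDr.
  split; first exact: LoneD.
  rewrite ExD//; have : q f <= Q f - zr f by apply: q_zs => //; exact: aeW.
  by rewrite /zr; lra.
have [phi1 _] := D_Ex (And3 mphi phi0 Dphi).
have rho1 : Lone P rho'.
  have [] := rho'E _ (orlicz_cst P hY 1) (fun=> ler01).
  by under eq_fun do rewrite mul1r.
(* Adding [rho'] to the optimal [phi] gives another element of [D], so maximality leaves no mass to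
   [rho']. *)
have rho_le0 : {ae P, forall t, rho' t = 0}.
  apply: Ex_gt0_eq0 => //.
  by have := phimax _ Dsum; rewrite ExD// gerDl.
move=> f Vf f0; apply: (le_trans (wq f Vf f0)).
have [i ->] := rhoi f Vf; rewrite -[leRHS](Ex_cst P 0).
apply: le_Ex_ae => //; first exact: Lone_cst.
apply: filterS2 f0 rho_le0 => t /= f0 r0; rewrite mulr_ge0_le0//.
by rewrite -r0 le_max lexx.
Qed.

End Existence.
End Decomposition.

(** * Conjugates of integral functionals *)

(** The convention for concave [h]: [h = u] gives [Phi u], while [h = - Y] evaluated at [- y] gives
    the Young conjugate of [Y] at [y]. *)
Definition conjugate {R : realType} (h : R -> \bar R) (y : R) : \bar R :=
  ereal_sup [set (h x - (x * y)%:E)%E | x in [set: R]].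

(** A one-sided substitute for continuity that reduces the supremum in [conjugate] to a countable
    one, even if [h] jumps to -oo at the end of its domain. *)
Definition rational_dense {R : realType} (h : R -> \bar R) : Prop :=
  forall x eps : R, 0 < eps -> exists2 q : rat,
    `|ratr q - x| < eps & (h x <= h (ratr q))%E.

(** * Interchange of supremum and expectation *)

Section Interchange.
Context {disp : measure_display} {Omega : measurableType disp} {R : realType}.
Variables (P : probability Omega R) (h : R -> \bar R).
Hypotheses (h0 : h 0 \is a fin_num) (hy : forall x, h x != +oo%E).
Hypothesis (hq : rational_dense h).
Variable psi : Omega -> R.
Hypothesis mpsi : measurable_fun setT psi.

Let q n : R := if n is n'.+1 then
    if @choice.unpickle rat n' is Some r then
      if h (ratr r) \is a fin_num then ratr r else 0 else 0
  else 0.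

Let c n : R := fine (h (q n)).

Let hqE n : h (q n) = (c n)%:E.
Proof.
rewrite /c fineK//; case: n => [|n] //=.
by case: choice.unpickle => // r; case: ifP.
Qed.

Let h0E : h 0 = (c 0)%:E. Proof. exact: (hqE 0). Qed.

(** Running argmax of [h x - x * psi w] over the first [n] rationals of [dom h],
    paired with the value of [h] there. *)
Let f := fix f n w : R * R := if n is n'.+1 then
    let x := f n' w in
    if x.2 - x.1 * psi w < c n - q n * psi w then (q n, c n) else x
  else (q 0%N, c 0%N).

Let G n w := (f n w).2 - (f n w).1 * psi w.

Let fE n w : h (f n w).1 = ((f n w).2)%:E.
Proof.
elim: n => [|n IH]; first exact: (hqE 0).
by rewrite /f -/f; case: ifP => _; [exact: (hqE n.+1)|exact: IH].
Qed.

Let f_bounded n : exists k, forall w, `|(f n w).1| <= k /\ `|(f n w).2| <= k.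
Proof.
elim: n => [|n [k IH]].
  by exists (`|q 0%N| + `|c 0%N|) => w /=; rewrite lerDl lerDr.
exists (`|q n.+1| + `|c n.+1| + k) => w /=; have [k1 k2] := IH w.
have k0 : 0 <= k by apply: le_trans k1.
have := normr_ge0 (q n.+1); have := normr_ge0 (c n.+1).
by case: ifP => _ /=; lra.
Qed.

Let f_measurable n : measurable_fun setT (fun w => (f n w).1) /\
  measurable_fun setT (fun w => (f n w).2).
Proof.
elim: n => [|n [IH1 IH2]]; first by split; exact: measurable_cst.
have mb : measurable_fun setT
    (fun w => (f n w).2 - (f n w).1 * psi w < c n.+1 - q n.+1 * psi w).
  apply: measurable_fun_ltr; apply: measurable_funB => //; exact: measurable_funM.
split.
  rewrite (_ : (fun w => _) = fun w => if (f n w).2 - (f n w).1 * psi w <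
      c n.+1 - q n.+1 * psi w then q n.+1 else (f n w).1).
    by apply: measurable_fun_ifT.
  by apply/funext => w /=; case: ifP.
rewrite (_ : (fun w => _) = fun w => if (f n w).2 - (f n w).1 * psi w <
    c n.+1 - q n.+1 * psi w then c n.+1 else (f n w).2).
  by apply: measurable_fun_ifT.
by apply/funext => w /=; case: ifP.
Qed.

Let mG n : measurable_fun setT (G n).
Proof.
have [m1 m2] := f_measurable n.
by apply: measurable_funB => //; exact: measurable_funM.
Qed.

Let G_nd w : nondecreasing_seq (G ^~ w).
Proof.
apply/nondecreasing_seqP => n; rewrite /G /=; case: ifP => // lt.
exact: ltW.
Qed.

Let G_ge n w : c n - q n * psi w <= G n w.
Proof.
case: n => [|n] //; rewrite /G /=; case: ifPn => //.
by rewrite -leNgt.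
Qed.

Let cvG w : (G n w)%:E @[n --> \oo] --> conjugate h (psi w).
Proof.
suff -> : conjugate h (psi w) = ereal_sup (range (fun n => (G n w)%:E)).
  by apply: ereal_nondecreasing_cvgn => m n mn; rewrite lee_fin G_nd.
apply/le_anti/andP; split; last first.
  apply: ge_ereal_sup => _ [n _ <-]; apply: ereal_sup_ubound.
  by exists (f n w).1 => //; rewrite fE.
apply: ge_ereal_sup => _ [x _ <-].
have [->|hxfin] := eqVneq (h x) -oo%E; first by rewrite leNye.
have hx : h x \is a fin_num by rewrite fin_numE hxfin hy.
apply/lee_addgt0Pr => e e0.
(* A tolerance for which replacing [x] by a nearby rational changes [x * psi w] by at most [e]; the
   added 1 covers [psi w = 0]. *)
have d0 : 0 < e / (`|psi w| + 1) by rewrite divr_gt0// ltr_wpDl.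
have [r rx hr] := hq x d0.
have hrfin : h (ratr r) \is a fin_num.
  by rewrite fin_numE hy andbT; apply: contraTneq hr => ->; rewrite leeNy_eq.
pose n := (choice.pickle r).+1.
have qn : q n = ratr r by rewrite /n /= choice.pickleK hrfin.
apply: (@le_trans _ _ ((G n w)%:E + e%:E)%E); last first.
  by rewrite leeD2r//; apply: ereal_sup_ubound; exists n.
have hxr : fine (h x) <= fine (h (ratr r)) by exact: fine_le.
rewrite -(fineK hx) -EFinB -EFinD lee_fin.
have := G_ge n w; rewrite /c qn.
have : (ratr r - x) * psi w <= e.
  apply: (le_trans (ler_norm _)); rewrite normrM.
  apply: (@le_trans _ _ (e / (`|psi w| + 1) * (`|psi w| + 1))).
    by apply: ler_pM => //; [exact: ltW|rewrite lerDl].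
  by rewrite divfK// gt_eqF// ltr_wpDl.
by move: hxr; rewrite mulrBl; lra.
Qed.

Lemma conjugate_measurable : measurable_fun setT (fun w => conjugate h (psi w)).
Proof.
apply: (@emeasurable_fun_cvg _ _ _ _ (fun n w => (G n w)%:E)).
  by move=> n; exact/measurable_EFinP.
by move=> w _; exact: cvG.
Qed.

Lemma conjugate_ge y : (h 0 <= conjugate h y)%E.
Proof. by apply: ereal_sup_ubound; exists 0 => //; rewrite mul0r sube0. Qed.

(** The harder half of Rockafellar's interchange theorem. The running argmax takes finitely many
    values, so it is a bounded selector, and monotone convergence brings its expected gain above
    [beta]. *)
Lemma integral_conjugate_lt beta : Lone P psi ->
  (beta%:E < \int[P]_w conjugate h (psi w))%E ->
  exists g eta : Omega -> R, [/\ measurable_fun setT g, measurable_fun setT eta,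
    exists k, forall w, `|g w| <= k /\ `|eta w| <= k,
    forall w, h (g w) = (eta w)%:E &
    beta < Ex P (fun w => eta w - g w * psi w)].
Proof.
move=> psii ltb.
have [[n nlt]|nex] := pselect (exists n, beta < Ex P (G n)).
  exists (fun w => (f n w).1), (fun w => (f n w).2).
  by have [m1 m2] := f_measurable n; split=> //; exact: f_bounded.
have Gi n : Lone P (G n).
  have [m1 m2] := f_measurable n; have [k fk] := f_bounded n; apply: LoneB.
    by apply: (Lone_bounded P (k := k)) => // w; case: (fk w).
  apply: (Lone_le _ _ (LoneZ k (Lone_abs psii))) => [|w].
    exact: measurable_funM.
  by rewrite normrM ler_wpM2r//; case: (fk w).
(* Subtracting the initial value [h 0] makes the increasing sequence nonnegative, as monotone
   convergence demands. *)
pose c0 := c 0%N.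
have G0 w : G 0%N w = c0 by rewrite /G/= mul0r subr0.
have Gc0 n w : 0 <= G n w - c0 by rewrite subr_ge0 -(G0 w) G_nd.
have Gc0i n : Lone P (fun w => G n w - c0) by apply: LoneB => //; exact: Lone_cst.
have cvGc w : (G n w - c0)%:E @[n --> \oo] --> (conjugate h (psi w) - c0%:E)%E.
  have := @cvG w; have := conjugate_ge (psi w).
  rewrite h0E -/c0 => ge cv.
  have -> : (fun n => (G n w - c0)%:E) = (fun n => (G n w)%:E - c0%:E)%E by [].
  by apply: cvgeB; [rewrite fin_num_adde_defl|exact: cv|exact: cvg_cst].
have I1 : (\int[P]_w (conjugate h (psi w) - c0%:E) <= (beta - c0)%:E)%E.
  have -> : (\int[P]_w (conjugate h (psi w) - c0%:E) =
      \int[P]_w limn (fun n => (G n w - c0)%:E))%E.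
    by apply: eq_integral => w _; rewrite (cvg_lim _ (@cvGc w)).
  rewrite monotone_convergence//; last 3 first.
  - by move=> n; exact: measurable_int (Gc0i n).
  - by move=> n w _; rewrite lee_fin.
  - by move=> w _ m n mn; rewrite lee_fin lerB// G_nd.
  apply: lime_le.
    apply: ereal_nondecreasing_is_cvgn => m n mn; rewrite !Ex_EFin// lee_fin.
    by apply: le_Ex => // w; rewrite lerB// G_nd.
  apply: nearW => n; rewrite Ex_EFin// lee_fin ExB//; last exact: Lone_cst.
  rewrite Ex_cst lerB// leNgt; apply/negP => lt.
  by apply: nex; exists n.
have mH := conjugate_measurable.
have ge0 w : (0 <= conjugate h (psi w) - c0%:E)%E.
  rewrite sube_ge0//; have := conjugate_ge (psi w).
  by rewrite h0E.
have Hi : P.-integrable setT (fun w => conjugate h (psi w) - c0%:E)%E.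
  apply/integrableP; split; first by apply: emeasurable_funB.
  under eq_integral do rewrite gee0_abs//.
  exact: le_lt_trans I1 (ltry _).
move: ltb; rewrite ltNge => /negP; case.
have -> : (\int[P]_w conjugate h (psi w) =
   \int[P]_w ((conjugate h (psi w) - c0%:E) + c0%:E))%E.
  by apply: eq_integral => w _; rewrite subeK.
rewrite integralD//=; last exact: (Lone_cst P c0).
rewrite (integral_cst_probability P) -(subrK c0 beta) EFinD leeD2r//.
Qed.

End Interchange.

(** * Densities belong to the conjugate Orlicz space *)

Section DensityConjugate.
Context {disp : measure_display} {Omega : measurableType disp} {R : realType}.
Variables (P : probability Omega R) (Y : R -> \bar R).
Hypothesis hY : young Y.
Hypothesis Yrat : rational_dense (fun x => - Y x)%E.

(** If the conjugate modular of [al * chi] exceeded 1, some bounded [g] of modular [m] would satisfy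
    [al * v g - m > 1]. If [m <= 1], then [v g <= C]; otherwise [m^-1 * g] lies in the unit ball and
    [v g <= C * m]. Both are incompatible with [al = (C + 1)^-1]. *)
Lemma density_conjugate_orlicz v chi : dual P Y v -> has_density P Y v chi ->
  orlicz P (fun y => ereal_sup [set ((x * y)%:E - Y x)%E | x in [set: R]]) chi.
Proof.
move=> vd [mchi vchi]; split => //.
have [vl [C vC]] := (dualP P hY v).1 vd.
have C0 : 0 <= C.
  by apply: le_trans (vC _ (orlicz0 P hY) _) => //; rewrite modular0.
have C1 : 0 < C + 1 by rewrite ltr_wpDl.
exists (C + 1)^-1; first by rewrite invr_gt0.
pose al := (C + 1)^-1; pose psi w := - (al * chi w).
have al0 : 0 < al by rewrite invr_gt0.
under eq_integral => w _.
  rewrite (_ : ereal_sup _ = conjugate (fun x => - Y x)%E (psi w)); last first.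
    congr ereal_sup; apply/seteqP; split=> _ [x _ <-]; exists x => //;
    by rewrite /psi mulrN EFinN oppeK addeC.
  over.
apply: (@le_lt_trans _ _ 1%E); last exact: ltry.
have chii : Lone P chi.
  have [+ _] := vchi _ (orlicz_cst P hY 1).
  by under eq_fun do rewrite mul1r.
have mpsi : measurable_fun setT psi.
  by apply: measurable_funN; exact: measurable_funM.
have psii : Lone P psi.
  have := LoneZ (- al) chii; congr (Lone _ _); apply/funext => w.
  by rewrite /psi mulNr.
rewrite leNgt; apply/negP => lt.
have [||g [eta [mg meta [k gk] Yg]]] :=
    @integral_conjugate_lt _ _ _ P (fun x => - Y x)%E _ _ Yrat psi mpsi 1 psii lt.
- by rewrite (young0 hY) oppe0.
- by move=> x; rewrite eqe_oppLR /=; apply: contraTneq (young_ge0 hY x) => ->.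
have gV : orlicz P Y g by apply: (orlicz_bounded P hY (k := k)) => // w; case: (gk w).
have etai : Lone P eta by apply: (Lone_bounded P (k := k)) => // w; case: (gk w).
have [gchi vE] := vchi _ gV.
pose m := Ex P (fun w => - 1 * eta w).
have netai := LoneZ (- 1) etai.
have Mg : modular P Y g = m%:E.
  rewrite -Ex_EFin//; apply: eq_integral => w _.
  by rewrite mulN1r EFinN -Yg oppeK.
have m0 : 0 <= m by rewrite -lee_fin -Mg; exact: modular_ge0.
rewrite (@eq_Ex _ _ _ P _ (fun w => eta w + al * (g w * chi w))); last first.
  by move=> w; rewrite /psi; ring.
rewrite ExD//; last exact: LoneZ.
rewrite (ExZ al gchi) -vE.
have -> : Ex P eta = - m by rewrite /m ExZ// mulN1r opprK.
have [m1|m1] := leP m 1.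
  have : al * v g <= 1.
    rewrite ler_pdivrMl// mulr1 (le_trans (ler_norm _))// (le_trans (vC _ gV _)) ?lerDl//.
    by rewrite Mg lee_fin.
  by move: m0; lra.
have m'01 : 0 <= m^-1 <= 1.
  by rewrite invr_ge0 m0 invf_le1 ?(lt_trans ltr01 m1)// ltW.
have : v (fun w => m^-1 * g w) <= C.
  rewrite (le_trans (ler_norm _))// vC//; first exact: orliczZ.
  apply: (le_trans (modular_scale P hY mg m'01)).
  by rewrite Mg -EFinM mulVf// gt_eqF// (lt_trans ltr01).
rewrite (linear_onZ hY _ vl)// ler_pdivrMl ?(lt_trans ltr01)// => le1.
have : al * v g <= m.
  rewrite ler_pdivrMl// (le_trans le1)// mulrC ler_wpM2r// lerDl//.
by lra.
Qed.

End DensityConjugate.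

(** * Utility functions *)

Section UtilityFunction.
Context {R : realType}.
Variables (a : \bar R) (u : R -> \bar R).
Hypotheses (ha : (a < 0)%E) (hu : utility a u).

Lemma utility_lty x : u x != +oo%E. Proof. by case: hu => + _ _ _ _; exact. Qed.

Lemma utility_mono x y : x <= y -> (u x <= u y)%E.
Proof. by case: hu => _ + _ _ _; exact. Qed.

Lemma utility_fin_num x : (a < x%:E)%E -> u x \is a fin_num.
Proof.
case: hu => _ _ ui _ _ ax; rewrite fin_numE utility_lty andbT.
have : [set x | u x != -oo%E]° x by rewrite ui.
exact: interior_subset.
Qed.

(** Monotonicity makes the domain upward closed, so a finite value at some [x] below [a] would put
    the midpoint of [x] and [a] in its interior. *)
Lemma utility_Ny x : (x%:E < a)%E -> u x = -oo%E.
Proof.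
move=> xa; apply/eqP/contraT => ux.
have aE : a = (fine a)%:E by move: ha xa; case: (a) => [r||].
pose y := (x + fine a) / 2.
have [xy ya] : x < y /\ y < fine a by move: xa; rewrite aE lte_fin /y; split; lra.
suff : (a < y%:E)%E by rewrite aE lte_fin ltNge (ltW ya).
case: hu => _ um ui _ _; suff : [set x | u x != -oo%E]° y by rewrite ui.
apply/nbhs_ballP; exists (y - x); first by rewrite /= subr_gt0.
move=> z; rewrite /ball /= => yz; apply: contraNN ux => /eqP uz.
rewrite -leeNy_eq -uz; apply: um.
by move: yz; rewrite ltr_norml => /andP[]; lra.
Qed.

Lemma utility0_fin_num : u 0 \is a fin_num.
Proof. exact: utility_fin_num. Qed.

(** Concavity is assumed on the open domain, while [u] may be finite at [a] itself. Both points are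
    contracted towards their mean [m] by a factor [s]: monotonicity controls the left one and
    concavity between [y] and [m] the right one; [s] is then taken small. *)
Let concave_lt x y t : x < y -> 0 < t < 1 -> u x \is a fin_num -> u y \is a fin_num ->
  (t%:E * u x + (1 - t)%:E * u y <= u (t * x + (1 - t) * y)%R)%E.
Proof.
move=> xy /andP[t0 t1] ux uy.
pose m := t * x + (1 - t) * y.
have xm : x < m by rewrite /m; nra.
have my : m < y by rewrite /m; nra.
have ax : (a <= x%:E)%E.
  by rewrite leNgt; apply: contraTN ux => /utility_Ny ->.
have am : (a < m%:E)%E by apply: le_lt_trans ax _; rewrite lte_fin.
have ay : (a < y%:E)%E by apply: lt_trans am _; rewrite lte_fin.
have um := utility_fin_num am.
rewrite -/m -(fineK ux) -(fineK uy) -(fineK um) -!EFinM -EFinD lee_fin.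
set p := fine (u x); set q := fine (u y); set L := fine (u m).
have key s : 0 < s -> s < 1 -> t * p + (1 - t) * ((1 - s) * q + s * L) <= L.
  move=> s0 s1; pose xs := (1 - s) * x + s * m; pose ys := (1 - s) * y + s * m.
  have xxs : x < xs by rewrite /xs; nra.
  have axs : (a < xs%:E)%E by apply: le_lt_trans ax _; rewrite lte_fin.
  have mys : m < ys by rewrite /ys; nra.
  have ays : (a < ys%:E)%E by apply: lt_trans am _; rewrite lte_fin.
  case: hu => _ _ _ uc _.
  have := uc xs ys t axs ays; rewrite (ltW t0) (ltW t1) => /(_ isT).
  have -> : t * xs + (1 - t) * ys = m by rewrite /xs /ys /m; ring.
  rewrite -(fineK um) -(fineK (utility_fin_num axs)) -(fineK (utility_fin_num ays)).
  rewrite -!EFinM -EFinD lee_fin -/L; apply: le_trans; apply: lerD.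
    rewrite ler_pM2l// fine_le// ?utility_fin_num//.
    by apply: utility_mono; exact: ltW.
  rewrite ler_pM2l ?subr_gt0//.
  have := uc y m (1 - s) ay am; rewrite subr_ge0 (ltW s1) gerBl (ltW s0) => /(_ isT).
  have -> : 1 - (1 - s) = s by ring.
  rewrite -/ys.
  rewrite -(fineK uy) -(fineK um) -(fineK (utility_fin_num ays)).
  by rewrite -!EFinM -EFinD lee_fin.
rewrite leNgt; apply/negP => lt.
pose d := t * p + (1 - t) * q - L; have d0 : 0 < d by rewrite subr_gt0.
pose B := `|q - L| + 1; have B0 : 0 < B by rewrite ltr_wpDl.
(* With this choice the contraction costs at most [d / 2], less than the supposed gap [d]. *)
pose s := Num.min (2^-1) (d / (2 * B)).
have s0 : 0 < s by rewrite lt_min invr_gt0 ltr0n divr_gt0// mulr_gt0.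
have s1 : s < 1 by rewrite gt_min; apply/orP; left; lra.
have sB : s * B <= d / 2.
  have : s <= d / (2 * B) by rewrite ge_min lexx orbT.
  by rewrite ler_pdivlMr ?mulr_gt0//; lra.
have := key _ s0 s1.
have : (1 - t) * s * (q - L) <= s * B.
  have qL : q - L <= B by rewrite /B (le_trans (ler_norm _))// lerDl.
  have [neg|pos] := leP (q - L) 0.
    apply: (@le_trans _ _ 0); last by rewrite mulr_ge0// ltW.
    by rewrite mulr_ge0_le0// mulr_ge0 ?subr_ge0// ltW.
  apply: (@le_trans _ _ (s * (q - L))); last by rewrite ler_pM2l.
  by rewrite ler_pM2r// ler_piMl ?ltW//; lra.
by move: sB d0; rewrite /d; lra.
Qed.

Lemma utility_concave x y t : 0 <= t <= 1 ->
  (t%:E * u x + (1 - t)%:E * u y <= u (t * x + (1 - t) * y)%R)%E.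
Proof.
move=> /andP[t0 t1].
have [->|tn0] := eqVneq t 0; first by rewrite mul0e add0e subr0 mul1e mul0r add0r mul1r.
have [->|tn1] := eqVneq t 1; first by rewrite subrr mul0e adde0 mul1e mul0r addr0 mul1r.
have {}t0 : 0 < t by rewrite lt_def tn0.
have {}t1 : t < 1 by rewrite lt_def eq_sym tn1.
have t1' : 0 < 1 - t by rewrite subr_gt0.
have [uxN|uxN] := eqVneq (u x) -oo%E.
  by rewrite uxN gt0_muleNy ?lte_fin// addNye leNye.
have [uyN|uyN] := eqVneq (u y) -oo%E.
  by rewrite uyN (gt0_muleNy (x := (1 - t)%:E)) ?lte_fin// addeNy leNye.
have ux : u x \is a fin_num by rewrite fin_numE uxN utility_lty.
have uy : u y \is a fin_num by rewrite fin_numE uyN utility_lty.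
have [xy|yx|<-] := ltgtP x y.
- by apply: concave_lt => //; rewrite t0 t1.
- have t01 : 0 < 1 - t < 1 by rewrite t1' gtrBl t0.
  have := concave_lt yx t01 uy ux.
  have -> : 1 - (1 - t) = t by ring.
  by rewrite addeC (addrC ((1 - t) * y)).
- rewrite -mulrDl addrCA subrr addr0 mul1r -(fineK ux) -!EFinM -EFinD lee_fin.
  by rewrite -mulrDl addrCA subrr addr0 mul1r.
Qed.

Lemma uhatE x : (uhat u x = (fine (u 0))%:E - u (- `|x|)%R)%E.
Proof. by rewrite /uhat fineK ?utility0_fin_num// addeC. Qed.

Lemma uhat_ge0 x : (0 <= uhat u x)%E.
Proof.
rewrite uhatE fineK ?utility0_fin_num// sube_ge0 ?utility0_fin_num ?orbT//.
by by apply: utility_mono; rewrite oppr_le0.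
Qed.

Lemma uhat_convex x y t : 0 <= t <= 1 ->
  (uhat u (t * x + (1 - t) * y)%R <= t%:E * uhat u x + (1 - t)%:E * uhat u y)%E.
Proof.
move=> t01; have /andP[t0 t1] := t01.
have := utility_concave (- `|x|) (- `|y|) t01.
have mono : (u (t * - `|x| + (1 - t) * - `|y|)%R <= u (- `|t * x + (1 - t) * y|)%R)%E.
  apply: utility_mono; rewrite !mulrN -opprD lerN2 (le_trans (ler_normD _ _))//.
  by rewrite !normrM (ger0_norm t0) (@ger0_norm _ (1 - t)) ?subr_ge0.
move=> /le_trans/(_ mono); rewrite !uhatE.
have [->|tn0] := eqVneq t 0.
  rewrite !mul0e !add0e subr0 !mul1e => le.
  by rewrite leeB.
have [->|tn1] := eqVneq t 1.
  rewrite subrr !mul0e !adde0 !mul1e => le.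
  by rewrite leeB.
have {}t0 : 0 < t by rewrite lt_def tn0.
have {}t1 : 0 < 1 - t by rewrite subr_gt0 lt_def eq_sym tn1.
have := utility_lty (- `|x|); have := utility_lty (- `|y|).
have := utility_lty (- `|t * x + (1 - t) * y|).
case: (u (- `|t * x + (1 - t) * y|)%R) => [r||]; case: (u (- `|x|)%R) => [p||];
  case: (u (- `|y|)%R) => [q||] // _ _ _; rewrite /= ?oppeN ?addey//;
  rewrite ?(gt0_muley (x := t%:E)) ?(gt0_muley (x := (1 - t)%:E)) ?lte_fin//=;
  rewrite ?addye ?addey ?leey//=.
- by rewrite -!EFinM -!EFinD !lee_fin; lra.
Qed.

Lemma uhat_young : young (uhat u).
Proof.
have uhat00 : uhat u 0 = 0%E.
  by rewrite uhatE normr0 oppr0 fineK ?subee// utility0_fin_num.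
have uhat_mono x y : `|x| <= `|y| -> (uhat u x <= uhat u y)%E.
  by move=> xy; rewrite !uhatE leeB// utility_mono// lerN2.
split => //.
- exact: uhat_ge0.
- by move=> x y t; exact: uhat_convex.
(* As [u] tends to -oo, [uhat u] is at least 1 at some [M]. Convexity and its zero at 0 then give
   |x| <= M * uhat u x beyond [M], and the additive constant [M] covers the rest. *)
- have [M M0 YM] : exists2 M : R, 0 < M & (1 <= uhat u M)%E.
    case: hu => _ um _ _ /cvgeNyPle/(_ (fine (u 0) - 1))[M [_ HM]].
    pose x := Num.min M 0 - 1.
    have xM : x < M by rewrite /x; have : Num.min M 0 <= M by [rewrite ge_min lexx]; lra.
    have x0 : x < 0 by rewrite /x; have : Num.min M 0 <= 0 by [rewrite ge_min lexx orbT]; lra.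
    exists (- x); first by rewrite oppr_gt0.
    rewrite uhatE gtr0_norm ?oppr_gt0// opprK.
    have := HM x xM; have := utility_lty x.
    case: (u x) => [r||] // _; rewrite ?lee_fin; last by rewrite leey.
    by move=> ?; lra.
  exists M, M; split; first exact: ltW.
  move=> x; have [xM|Mx] := leP `|x| M.
    apply: (@le_trans _ _ M%:E); first by rewrite lee_fin.
    by rewrite leeDr// mule_ge0// ?lee_fin ?(ltW M0)// uhat_ge0.
  have x0 : 0 < `|x| by apply: lt_trans Mx.
  have t01 : 0 <= M / `|x| <= 1.
    by rewrite divr_ge0 ?(ltW M0)//= ler_pdivrMr// mul1r ltW.
  have := uhat_convex `|x| 0 t01; rewrite mulr0 addr0 divfK ?gt_eqF// uhat00 mule0 adde0.
  move=> /(le_trans YM).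
  have -> : uhat u `|x| = uhat u x by rewrite !uhatE normr_id.
  have := uhat_ge0 x; case: (uhat u x) => [r||]//.
    rewrite -!EFinM !lee_fin => r0; rewrite mulrAC ler_pdivlMr// mul1r.
    by lra.
  by move=> _ _; rewrite gt0_muley ?lte_fin// addye// leey.
- have [x x0 ax] : exists2 x : R, 0 < x & (a < (- x)%:E)%E.
    move: ha; case: (a) => [r||]//; last by exists 1 => //; rewrite ltNyr.
    by rewrite lte_fin => r0; exists (- r / 2); rewrite ?lte_fin; lra.
  exists x => //; rewrite uhatE gtr0_norm//.
  by rewrite -(fineK (utility_fin_num ax)) -EFinB ltry.
Qed.

Lemma utility_rational_dense : rational_dense u.
Proof.
move=> x e e0; have /rat_in_itvoo[q] : x < x + e by rewrite ltrDl.
rewrite in_itv/= => /andP[xq qe]; exists q; last by apply: utility_mono; exact: ltW.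
by rewrite ger0_norm ?subr_ge0 ?(ltW xq)//; lra.
Qed.

(** The rational is chosen on the side of 0, where [uhat u] is smaller. *)
Lemma uhat_rational_dense : rational_dense (fun x => - uhat u x)%E.
Proof.
move=> x e e0.
suff [q qx qle] : exists2 q : rat, `|ratr q - x| < e & `|ratr q : R| <= `|x|.
  by exists q => //; rewrite leeN2; apply: young_mono => //; exact: uhat_young.
have [x0|x0|->] := ltgtP x 0; last by exists 0; rewrite rmorph0 ?subr0 normr0.
- have /rat_in_itvoo[q] : x < Num.min (x + e) 0 by rewrite lt_min ltrDl e0.
  rewrite in_itv/= lt_min => /and3P[xq qe q0]; exists q.
    by rewrite ger0_norm ?subr_ge0 ?(ltW xq)//; lra.
  by rewrite !ltr0_norm// lerN2 ltW.
- have /rat_in_itvoo[q] : Num.max (x - e) 0 < x by rewrite gt_max ltrBlDr ltrDl e0.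
  rewrite in_itv/= gt_max => /andP[/andP[qe q0] xq]; exists q.
    by rewrite ler0_norm ?subr_le0 ?(ltW xq)//; lra.
  by rewrite !gtr0_norm// ltW.
Qed.

Lemma u_infty_sup : u_infty u = ereal_sup (range u).
Proof.
apply/cvg_lim => //; apply: nondecreasing_cvge => x y; exact: utility_mono.
Qed.

Lemma utility_measurable : measurable_fun setT u.
Proof.
apply: (measurability _ (ErealGenOInfty.measurableE R)).
move=> /= _ [_ [b ->]] <-; rewrite setTI preimage_itvoy.
apply: is_interval_measurable => x y /= ux uy z /andP[xz zy].
by apply: lt_le_trans ux _; exact: utility_mono.
Qed.

End UtilityFunction.

(** * Supergradients along a cone *)

Section HahnBanach.
Context {X : Type} {R : realType}.
Variable V : set (X -> R).
Hypotheses (V0 : V (fun=> 0))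
  (Vlin : forall b f g, V f -> V g -> V (fun w => b * f w + g w)).

Section Extension.
Variable p : (X -> R) -> R.
Hypotheses (pD : forall f g, V f -> V g -> p (fun w => f w + g w) <= p f + p g)
  (pZ : forall c f, 0 < c -> V f -> p (fun w => c * f w) = c * p f).

(** Partial functionals are encoded by their graphs, so that unions of chains are plain unions.
    Single-valuedness is a consequence: domination by [p] with [p 0 = 0] excludes two values at one
    point. *)
Let dominated_graph (G : set ((X -> R) * R)) :=
  (forall b f r g s, G (f, r) -> G (g, s) -> G (fun w => b * f w + g w, b * r + s)) /\
  (forall f r, G (f, r) -> V f /\ r <= p f).

Let VZ b f : V f -> V (fun w => b * f w).
Proof. by move=> /(Vlin b)/(_ V0); under eq_fun do rewrite addr0. Qed.

Let p0 : p (fun=> 0) = 0.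
Proof.
have := pZ (ltr0n R 2) V0; under eq_fun do rewrite mulr0.
by lra.
Qed.

Let maximal_graph : exists2 A, dominated_graph A &
  forall B, dominated_graph B -> A `<=` B -> B `<=` A.
Proof.
have [F FD Ftot|A [DA maxA]] := @Zorn_bigcup _ dominated_graph; last first.
  exists A => // B DB AB; apply: contrapT => nBA; exact: maxA (conj AB nBA) DB.
split=> [b f r g s [G1 F1 G1f] [G2 F2 G2g]|f r [G FG Gf]].
  have [G12|G21] := Ftot _ _ F1 F2.
    by exists G2 => //; have [+ _] := FD _ F2; apply => //; exact: G12.
  by exists G1 => //; have [+ _] := FD _ F1; apply => //; exact: G21.
by have [_] := FD _ FG; apply.
Qed.

Lemma hahn_banach : exists2 z : (X -> R) -> R,
  (forall b f g, V f -> V g -> z (fun w => b * f w + g w) = b * z f + z g) &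
  forall f, V f -> z f <= p f.
Proof.
have [A [Alin Adom] Amax] := maximal_graph.
(* The empty graph is dominated as well, so maximality has to be used to obtain the origin. *)
have A0 : A (fun=> 0, 0).
  have [[[f r] Afr]|nA] := pselect (exists x, A x).
    have := Alin (-1) _ _ _ _ Afr Afr.
    rewrite mulN1r addNr; congr A; congr pair; apply/funext => w; ring.
  apply: (Amax [set (fun=> 0, 0)]) => //.
    split=> [b f r g s [-> ->] [-> ->]|f r [-> ->]]; last by rewrite p0.
    by congr pair; [apply/funext => w|]; rewrite mulr0 addr0.
  by move=> x Ax; case: nA; exists x.
have AZ b f r : A (f, r) -> A (fun w => b * f w, b * r).
  move=> /(Alin b) /(_ A0); rewrite addr0.
  by under eq_fun do rewrite addr0.
have Atotal v : V v -> exists r, A (v, r).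
  move=> Vv; pose L := [set x | exists f r, A (f, r) /\ x = r - p (fun w => f w - v w)].
  have VB f g : V f -> V g -> V (fun w => f w - g w).
    move=> Vf Vg; have := Vlin (-1) Vg Vf.
    by congr V; apply/funext => w; ring.
  have VD f g : V f -> V g -> V (fun w => f w + g w).
    move=> Vf Vg; have := Vlin 1 Vf Vg.
    by congr V; apply/funext => w; ring.
  have L_le f r g s : A (f, r) -> A (g, s) ->
      r - p (fun w => f w - v w) <= p (fun w => g w + v w) - s.
    move=> Afr Ags; have [Vf _] := Adom _ _ Afr; have [Vg _] := Adom _ _ Ags.
    have [_ +] := Adom _ _ (Alin 1 _ _ _ _ Afr Ags).
    have := pD (VB _ _ Vf Vv) (VD _ _ Vg Vv).
    have -> : (fun w => f w - v w + (g w + v w)) = (fun w => 1 * f w + g w).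
      by apply/funext => w; ring.
    by lra.
  have hasL : has_sup L.
    split; first by exists (0 - p (fun w => 0 - v w)), (fun=> 0), 0.
    by exists (p (fun w => 0 + v w) - 0) => _ [f [r [Afr ->]]]; exact: L_le Afr A0.
  (* Any value between the two sides of [L_le] extends the functional to [v]; this is the
     smallest. *)
  pose c := sup L.
  have cL f r : A (f, r) -> r - p (fun w => f w - v w) <= c.
    by move=> Afr; apply: sup_upper_bound => //; exists f, r.
  have cU f r : A (f, r) -> c <= p (fun w => f w + v w) - r.
    move=> Afr; apply: ge_sup; first by case: hasL.
    by move=> _ [g [s [Ags ->]]]; exact: L_le.
  pose B := [set x | exists f r t, A (f, r) /\
    x = ((fun w => f w + t * v w), r + t * c)].
  exists c; apply: (Amax B); last first.
  - exists (fun=> 0), 0, 1; split => //.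
    by congr pair; [apply/funext => w|]; ring.
  - move=> [f r] Afr; exists f, r, 0; split => //.
    by congr pair; [apply/funext => w|]; ring.
  split=> [b f r g s [f1 [r1 [t1 [A1 [-> ->]]]]] [f2 [r2 [t2 [A2 [-> ->]]]]]|f r].
    exists (fun w => b * f1 w + f2 w), (b * r1 + r2), (b * t1 + t2); split.
      exact: Alin.
    by congr pair; [apply/funext => w|]; ring.
  move=> [f1 [r1 [t [A1 [-> ->]]]]]; have [V1 r1p] := Adom _ _ A1.
  split.
    by have := Vlin t Vv V1; congr V; apply/funext => w; ring.
  have [t0|t0|t0] := ltgtP t 0.
  - pose tau := - t; have tau0 : 0 < tau by rewrite oppr_gt0.
    have := cL _ _ (AZ tau^-1 _ _ A1).
    have -> : p (fun w => f1 w + t * v w) = tau * p (fun w => tau^-1 * f1 w - v w).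
      rewrite -pZ//; last by apply: VB => //; exact: VZ.
      congr p; apply/funext => w; rewrite mulrBr mulrA mulfV ?gt_eqF//.
      by rewrite /tau; ring.
    rewrite -(ler_pM2l tau0) mulrBr mulrA mulfV ?gt_eqF// mul1r.
    by rewrite /tau; lra.
  - have := cU _ _ (AZ t^-1 _ _ A1).
    have -> : p (fun w => f1 w + t * v w) = t * p (fun w => t^-1 * f1 w + v w).
      rewrite -pZ//; last by apply: VD => //; exact: VZ.
      congr p; apply/funext => w; rewrite mulrDr mulrA mulfV ?gt_eqF//.
      by ring.
    rewrite -(ler_pM2l t0) mulrBr mulrA mulfV ?gt_eqF// mul1r.
    by lra.
  - rewrite t0 mul0r addr0 (_ : (fun w => _) = f1)//.
    by apply/funext => w; ring.
have Auniq f r s : A (f, r) -> A (f, s) -> r = s.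
  have le r' s' : A (f, r') -> A (f, s') -> s' <= r'.
    move=> Ar As; have [_] := Adom _ _ (Alin (-1) _ _ _ _ Ar As).
    have -> : (fun w => -1 * f w + f w) = (fun=> 0) by apply/funext => w; ring.
    by rewrite p0; lra.
  by move=> Ar As; apply/le_anti; rewrite !le.
pose z f := xget 0 [set r | A (f, r)].
have zA f : V f -> A (f, z f).
  by move=> /Atotal[r Afr]; rewrite /z; case: xgetP => [s _//|/(_ r)].
exists z => [b f g Vf Vg|f Vf]; last by have [] := Adom _ _ (zA f Vf).
by apply: Auniq (Alin _ _ _ _ _ (zA f Vf) (zA g Vg)); apply: zA; exact: Vlin.
Qed.

End Extension.

(** [J f r] is to be read as [r <= j f] for a concave functional [j]; [U] bounds
    [j] on the convex cone [C], and [z] is a supergradient at 0 of the value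
    function [g |-> sup_(f in C) j (f + g)]. *)
Lemma cone_supergradient (C : set (X -> R)) (J : (X -> R) -> R -> Prop) (U : R) :
  C (fun=> 0) -> C `<=` V ->
  (forall b f g, 0 <= b -> C f -> C g -> C (fun w => b * f w + g w)) ->
  (forall f g r s t, V f -> V g -> 0 < t < 1 -> J f r -> J g s ->
    J (fun w => t * f w + (1 - t) * g w) (t * r + (1 - t) * s)) ->
  (forall f r, C f -> J f r -> r <= U) ->
  (forall g, V g -> exists t r, 0 < t /\ J (fun w => - (t * g w)) r) ->
  exists2 z : (X -> R) -> R,
    (forall b f g, V f -> V g -> z (fun w => b * f w + g w) = b * z f + z g) &
    forall f g r, C f -> V g -> J (fun w => f w + g w) r -> r <= U + z g.
Proof.
move=> C0 CV Clin Jconc JU Jabs.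
have VZ b f : V f -> V (fun w => b * f w).
  by move=> /(Vlin b)/(_ V0); under eq_fun do rewrite addr0.
have VD f g : V f -> V g -> V (fun w => f w + g w).
  move=> Vf Vg; have := Vlin 1 Vf Vg.
  by congr V; apply/funext => w; ring.
have VBZ t f g : V f -> V g -> V (fun w => f w - t * g w).
  move=> Vf Vg; have := Vlin (- t) Vg Vf.
  by congr V; apply/funext => w; ring.
have CZ b f : 0 <= b -> C f -> C (fun w => b * f w).
  by move=> b0 Cf; have := Clin b f _ b0 Cf C0; under eq_fun do rewrite addr0.
(* Difference quotients of the value function in direction [- g], measured from the bound [U]. Their
   infimum is the sublinear majorant for Hahn-Banach. *)
pose D g := [set x | exists t f r, [/\ 0 < t, C f, J (fun w => f w - t * g w) r
  & x = (U - r) / t]].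
have hasD g : V g -> has_inf (D g).
  move=> Vg; split.
    have [t [r [t0 Jr]]] := Jabs g Vg; exists ((U - r) / t), t, (fun=> 0), r.
    by split => //; under eq_fun do rewrite sub0r.
  have Vng : V (fun w => - g w) by have := VZ (-1) g Vg; under eq_fun do rewrite mulN1r.
  have [t0 [r0 [t00 Jr0]]] := Jabs _ Vng; exists (- ((U - r0) / t0)).
  move=> _ [t [f [r [t1 Cf Jr ->]]]].
  have tt : 0 < t + t0 by rewrite addr_gt0.
  (* The weights that cancel the direction [g]: the combination lies in [C], where [U] applies. This
     bounds [D g] below. *)
  pose th := t0 / (t + t0).
  have th01 : 0 < th < 1 by rewrite divr_gt0//= ltr_pdivrMr// mul1r ltrDr.
  have Vn : V (fun w => - (t0 * - g w)).
    by have := VZ t0 g Vg; under [X in _ -> V X]eq_fun do rewrite mulrN opprK.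
  have := Jconc _ _ _ _ _ (VBZ t _ _ (CV _ Cf) Vg) Vn th01 Jr Jr0.
  have -> : (fun w => th * (f w - t * g w) + (1 - th) * - (t0 * - g w)) =
      (fun w => th * f w).
    by apply/funext => w; rewrite /th; field; rewrite gt_eqF.
  move=> /(JU _ _ (CZ _ _ (ltW (proj1 (andP th01))) Cf)) le.
  have : 0 <= (U - (th * r + (1 - th) * r0)) * ((t + t0) / (t * t0)).
    by rewrite mulr_ge0 ?subr_ge0// divr_ge0// ltW// mulr_gt0.
  have -> : (U - (th * r + (1 - th) * r0)) * ((t + t0) / (t * t0)) =
      (U - r) / t + (U - r0) / t0.
    by rewrite /th; field; rewrite !gt_eqF.
  by lra.
pose p g := inf (D g).
have p_le g t f r : V g -> 0 < t -> C f -> J (fun w => f w - t * g w) r ->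
    p g <= (U - r) / t.
  move=> Vg t0 Cf Jr; apply: inf_lbound; first by case: (hasD g Vg).
  by exists t, f, r.
have pZ_le c g : 0 < c -> V g -> p (fun w => c * g w) <= c * p g.
  move=> c0 Vg; rewrite -ler_pdivrMl//; apply: lb_le_inf; first by case: (hasD g Vg).
  move=> _ [t [f [r [t0 Cf Jr ->]]]]; rewrite ler_pdivrMl//.
  rewrite (_ : c * _ = (U - r) / (t / c)); last by field; rewrite !gt_eqF.
  apply: (p_le _ _ f) => //; [exact: VZ|by rewrite divr_gt0|].
  move: Jr; congr J; apply/funext => w; field; by rewrite gt_eqF.
have pZ c g : 0 < c -> V g -> p (fun w => c * g w) = c * p g.
  move=> c0 Vg; apply/le_anti; rewrite pZ_le//= -ler_pdivlMl//.
  have := pZ_le c^-1 _ _ (VZ c g Vg).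
  rewrite invr_gt0 => /(_ c0).
  by have -> : (fun w => c^-1 * (c * g w)) = g by apply/funext => w; rewrite mulKf ?gt_eqF.
have pD f g : V f -> V g -> p (fun w => f w + g w) <= p f + p g.
  move=> Vf Vg; rewrite -lerBlDr; apply: lb_le_inf; first by case: (hasD f Vf).
  move=> _ [t1 [f1 [r1 [t10 C1 J1 ->]]]]; rewrite lerBlDr -lerBlDl.
  apply: lb_le_inf; first by case: (hasD g Vg).
  move=> _ [t2 [f2 [r2 [t20 C2 J2 ->]]]]; rewrite lerBlDl.
  have tt : 0 < t1 + t2 by rewrite addr_gt0.
  (* The weights that give [f] and [g] the common step [t1 * t2 / (t1 + t2)]. *)
  pose th := t2 / (t1 + t2).
  have th01 : 0 < th < 1 by rewrite divr_gt0//= ltr_pdivrMr// mul1r ltrDr.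
  have [th0 th1] := andP th01.
  have := Jconc _ _ _ _ _ (VBZ t1 _ _ (CV _ C1) Vf) (VBZ t2 _ _ (CV _ C2) Vg) th01 J1 J2.
  have -> : (fun w => th * (f1 w - t1 * f w) + (1 - th) * (f2 w - t2 * g w)) =
      (fun w => (th * f1 w + (1 - th) * f2 w) - t1 * t2 / (t1 + t2) * (f w + g w)).
    by apply/funext => w; rewrite /th; field; rewrite gt_eqF.
  move=> /p_le; have -> : (U - r1) / t1 + (U - r2) / t2 =
      (U - (th * r1 + (1 - th) * r2)) / (t1 * t2 / (t1 + t2)).
    by rewrite /th; field; rewrite !gt_eqF.
  apply; [exact: VD|by rewrite divr_gt0// mulr_gt0|].
  by apply: Clin; [exact: ltW|by []|apply: CZ => //; rewrite subr_ge0 ltW].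
have [z zl zp] := hahn_banach pD pZ; exists z => // f g r Cf Vg Jr.
have Vng : V (fun w => - g w) by have := VZ (-1) g Vg; under eq_fun do rewrite mulN1r.
have zN : z (fun w => - g w) = - z g.
  have z0 : z (fun=> 0) = 0.
    have := zl 1 _ _ V0 V0; rewrite mulr0 addr0 mul1r.
    by move=> /eqP; rewrite -subr_eq subrr eq_sym => /eqP.
  have := zl (-1) _ _ Vg V0; rewrite z0 addr0 mulN1r => <-; congr z.
  by apply/funext => w; rewrite mulN1r addr0.
(* Step 1 in direction [- g] turns [f - t * (- g)] into [f + g]. *)
have := le_trans (zp _ Vng) (p_le _ 1 f r Vng ltr01 Cf _).
rewrite divr1 zN => le; have : - z g <= U - r; last by lra.
apply: le; move: Jr; congr J; apply/funext => w; by rewrite mul1r opprK.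
Qed.

End HahnBanach.

(** * Expected utilities through integrable minorants *)

Section ExpectedUtility.
Context {disp : measure_display} {Omega : measurableType disp} {R : realType}.
Variable P : probability Omega R.
Implicit Types (g : Omega -> \bar R) (eta : Omega -> R).

(** States [r <= E[g]] without infinite expectations, through an integrable
    minorant of [g]. *)
Definition below_expectation g (r : R) := exists eta,
  [/\ Lone P eta, {ae P, forall w, ((eta w)%:E <= g w)%E} & r <= Ex P eta].

Lemma below_expectation_le g r : measurable_fun setT g -> below_expectation g r ->
  (r%:E <= expected_utility P g)%E.
Proof.
move=> mg [eta [etai etag rE]].
have meta : measurable_fun setT (EFin \o eta) := measurable_int P etai.
have neg_le : (\int[P]_w g^\- w <= \int[P]_w (EFin \o eta)^\- w)%E.
  apply: ae_ge0_le_integral => //; [exact: measurable_funeneg|exact: measurable_funeneg|].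
  apply: filterS etag => w le _; rewrite !funenegE ge_max !le_max lexx orbT andbT.
  by rewrite leeN2 le.
have pos_le : (\int[P]_w (EFin \o eta)^\+ w <= \int[P]_w g^\+ w)%E.
  apply: ae_ge0_le_integral => //; [exact: measurable_funepos|exact: measurable_funepos|].
  apply: filterS etag => w le _; rewrite !funeposE ge_max !le_max lexx orbT andbT.
  by rewrite le.
have etafin := integral_funeneg_lt_pinfty measurableT etai.
rewrite /expected_utility lt_eqF; last exact: le_lt_trans etafin.
apply: (@le_trans _ _ (Ex P eta)%:E); first by rewrite lee_fin.
by rewrite -Ex_EFin// [leLHS]integralE [leRHS]integralE leeB.
Qed.

(** The finite expectation assumption implied by [r] makes the negative part integrable. Strictness
    leaves room to truncate the positive part, whose expectation may be infinite. *)
Lemma lt_below_expectation g r : measurable_fun setT g -> (forall w, g w != +oo%E) ->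
  (r%:E < expected_utility P g)%E -> below_expectation g r.
Proof.
move=> mg gy; rewrite /expected_utility; case: ifPn => [_|negfin].
  by rewrite ltNge leNye.
have mpos : measurable_fun setT (g^\+)%E by exact: measurable_funepos.
have mneg : measurable_fun setT (g^\-)%E by exact: measurable_funeneg.
have negi : P.-integrable setT (g^\-)%E.
  apply/integrableP; split => //; under eq_integral do rewrite gee0_abs//.
  by rewrite ltey.
rewrite integralE.
pose m w := fine ((g^\- w)%E).
have mm : measurable_fun setT m by exact: measurableT_comp.
have mi : Lone P m.
  apply: (le_integrable _ _ _ negi) => //; first exact/measurable_EFinP.
  by move=> w _ /=; rewrite /m; case: ((g^\- w)%E) => [x||] //=; rewrite ?leey ?normr0// lee_fin.
have mE : {ae P, forall w, (g^\- w)%E = (m w)%:E}.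
  by apply: filterS (integrable_ae measurableT negi) => w /(_ I) fin; rewrite fineK.
have -> : (\int[P]_w (g^\- w)%E = (Ex P m)%:E)%E.
  rewrite -Ex_EFin//; apply: ae_eq_integral => //; first exact/measurable_EFinP.
  by apply: filterS mE => w -> _.
have posfin w : (g^\+ w)%E \is a fin_num.
  rewrite ge0_fin_numE; last by rewrite funepos_ge0.
  by rewrite funeposE gt_max ltry andbT ltey.
pose p n w := Num.min (fine ((g^\+ w)%E)) n%:R.
have p0 n w : 0 <= p n w by rewrite le_min ler0n andbT fine_ge0// funepos_ge0.
have mp n : measurable_fun setT (p n).
  by apply: measurable_minr => //; exact: measurableT_comp.
have pi n : Lone P (p n).
  apply: (Lone_bounded P (k := n%:R)) => // w; rewrite ger0_norm//.
  by rewrite ge_min lexx orbT.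
have cvp w : (p n w)%:E @[n --> \oo] --> (g^\+ w)%E.
  rewrite -(fineK (posfin w)); apply: cvg_EFin; first exact: nearW.
  apply/cvgrPdist_lt => e e0; exists (Num.truncn (fine ((g^\+ w)%E))).+1 => // n /= wn.
  rewrite /p /= min_l ?subrr ?normr0//.
  by rewrite (le_trans (ltW (truncnS_gt _)))// ler_nat.
have p_nd w i j : (i <= j)%N -> p i w <= p j w.
  move=> ij; rewrite /p le_min ge_min lexx/= ge_min ler_nat ij orbT.
  by [].
rewrite lteBrDr// -EFinD => lt.
have [n nlt] : exists n, r + Ex P m <= Ex P (p n).
  apply: contrapT => nex; move: lt; rewrite ltNge => /negP; apply.
  have -> : (\int[P]_w (g^\+ w)%E = \int[P]_w limn (fun n => (p n w)%:E))%E.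
    by apply: eq_integral => w _; rewrite (cvg_lim _ (cvp w)).
  rewrite monotone_convergence//; last 3 first.
  - by move=> n; exact/measurable_EFinP.
  - by move=> n w _; rewrite lee_fin.
  - by move=> w _ i j ij; rewrite lee_fin p_nd.
  apply: lime_le.
    apply: ereal_nondecreasing_is_cvgn => i j ij; rewrite !Ex_EFin// lee_fin.
    by apply: le_Ex => // w; exact: p_nd.
  apply: nearW => n; rewrite Ex_EFin// lee_fin leNgt; apply/negP => lt.
  by apply: nex; exists n; exact: ltW.
exists (fun w => p n w - m w); split; first exact: LoneB.
  apply: filterS mE => w mw; rewrite EFinB -mw [g in leRHS]funeposneg leeB//.
  by rewrite -[leRHS]fineK// lee_fin ge_min lexx.
by rewrite ExB// lerBrDr.
Qed.

End ExpectedUtility.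

(** * The cone of terminal values *)

Section MeasurableWrt.
Context {X : pointedType} {R : realType}.
Variable G : set (set X).
Hypothesis sG : sigma_algebra setT G.

(** Recasts measurability for a family of sets as [measurable_fun] on a generated type, so that
    closure under sums and products becomes available. *)
Lemma measurable_wrtP (f : X -> R) :
  (forall B : set R, measurable B -> G (f @^-1` B)) <->
  measurable_fun setT (f : g_sigma_algebraType G -> R).
Proof.
split=> [Gf _ B mB|mf B mB].
  by rewrite setTI /measurable /= (sigma_algebra_id sG); exact: Gf.
by have := mf measurableT B mB; rewrite setTI /measurable /= (sigma_algebra_id sG).
Qed.

End MeasurableWrt.

Lemma eq_fun2 {A B C : Type} (f g : A -> B -> C) : (forall x y, f x y = g x y) -> f = g.
Proof. by move=> fg; apply/funext => x; apply/funext => y. Qed.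

Lemma vector_process_coord {T U : Type} {R : realType} {d : nat}
    (H H' : T -> U -> 'rV[R]_d) :
  (forall t w j, H t w ord0 j = H' t w ord0 j) -> H = H'.
Proof. by move=> HH; apply: eq_fun2 => t w; apply/rowP => j. Qed.

(** * Linearity of the stochastic integral *)

Section StochasticIntegral.
Context {disp : measure_display} {Omega : measurableType disp} {R : realType}.
Variables (P : probability Omega R) (T : \bar R) (F : \bar R -> set (set Omega)).
Hypotheses (T0 : (0 < T)%E) (hF : usual_filtration P T F).

Local Notation process := (@process _ Omega R).
Implicit Types X : process.

Definition lin_process (a : R) X (X' : process) : process :=
  fun t w => a * X t w + X' t w.

Let sigma_F t : (0 <= t <= T)%E -> sigma_algebra setT (F t).
Proof. by move=> t0T; have [/(_ t t0T)[]] := hF. Qed.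

Let F_measurable t : (0 <= t <= T)%E -> F t `<=` measurable.
Proof. by move=> t0T; have [/(_ t t0T)[]] := hF. Qed.

Let F_mono s t : (0 <= s)%E -> (s <= t)%E -> (t <= T)%E -> F s `<=` F t.
Proof. by case: hF => _ + _ _; exact. Qed.

Lemma measurable_wrt_fun t (f : Omega -> R) : (0 <= t <= T)%E -> measurable_wrt (F t) f ->
  measurable_fun setT f.
Proof.
move=> t0T Ff _ B mB; rewrite setTI; apply: (F_measurable t0T); exact: Ff.
Qed.

Lemma adapted_lin a X X' : adapted T F X -> adapted T F X' ->
  adapted T F (lin_process a X X').
Proof.
move=> FX FX' t t0T; apply/(measurable_wrtP (sigma_F t0T)).
apply: measurable_funD.
  by apply: measurable_funM => //; apply/(measurable_wrtP (sigma_F t0T)); exact: FX.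
by apply/(measurable_wrtP (sigma_F t0T)); exact: FX'.
Qed.

Lemma cadlag_lin (c : Omega -> R) X X' : cadlag T X -> cadlag T X' ->
  cadlag T (fun t w => c w * X t w + X' t w).
Proof.
move=> hX hX' w; have [r l] := hX w; have [r' l'] := hX' w; split=> t t0 tT.
  by apply: cvgD; [apply: cvgMr; exact: r|exact: r'].
by apply: is_cvgD; [apply: is_cvgMr; exact: l|exact: l'].
Qed.

Lemma cadlag0 : cadlag T ((fun _ _ => 0) : process).
Proof. by move=> w; split=> t t0 tT; [exact: cvg_cst|exact: is_cvg_cst]. Qed.

Lemma integral_path0 : integral_path T F ((fun _ _ => 0) : process).
Proof.
split=> //; last exact: cadlag0.
by move=> t t0T; apply/(measurable_wrtP (sigma_F t0T)); exact: measurable_cst.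
Qed.

Lemma cadlag_stopped X r : cadlag T X -> 0 <= r -> (r%:E <= T)%E ->
  cadlag T (fun t => X (Order.min r%:E t)).
Proof.
move=> hX r0 rT w; have [rX lX] := hX w; split=> t t0 tT.
  have [tr|rt] := ltP t r.
    rewrite min_r ?lee_fin ?(ltW tr)//; apply: cvg_trans (rX t t0 tT).
    apply: near_eq_cvg; near=> s; rewrite min_r// lee_fin.
    by near: s; exact: nbhs_right_le.
  have cst : X r%:E w @[_ --> t^'+] --> X r%:E w by exact: cvg_cst.
  rewrite min_l ?lee_fin//; apply: cvg_trans cst.
  apply: near_eq_cvg; near=> s; have ts : t <= s by near: s; exact: nbhs_right_ge.
  by rewrite min_l// lee_fin (le_trans rt).
have [tr|rt] := leP t r.
  have := lX t t0 tT => /cvg_ex[l cl]; apply/cvg_ex; exists l.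
  apply: cvg_trans cl; apply: near_eq_cvg; near=> s.
  have st : s <= t by near: s; exact: nbhs_left_le.
  by rewrite min_r// lee_fin (le_trans st).
have cst : X r%:E w @[_ --> t^'-] --> X r%:E w by exact: cvg_cst.
apply/cvg_ex; exists (X r%:E w); apply: cvg_trans cst.
apply: near_eq_cvg; near=> s; rewrite min_l// lee_fin.
by near: s; exact: nbhs_left_ge.
Unshelve. all: by end_near. Qed.

Lemma integral_path_lin a X X' : integral_path T F X -> integral_path T F X' ->
  integral_path T F (lin_process a X X').
Proof.
move=> [FX cX X0] [FX' cX' X'0]; split; first exact: adapted_lin.
  exact: (cadlag_lin (fun=> a)).
by move=> w; rewrite /lin_process X0 X'0 mulr0 addr0.
Qed.

Let elementary_int (e : elementary T F) X : process := fun t w =>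
  el_coef e w * (X (Order.min (el_right e)%:E t) w - X (Order.min (el_left e)%:E t) w).

(** Up to [el_left] the increment vanishes; afterwards the coefficient is measurable because the
    filtration increases. *)
Let elementary_int_adapted e X : adapted T F X -> adapted T F (elementary_int e X).
Proof.
move=> FX t t0T; have /andP[t0 tT] := t0T.
apply/(measurable_wrtP (sigma_F t0T)).
have l0 := el_left_ge0 e; have lr := el_le e; have rT := el_right_le e.
have [tl|lt] := leP t (el_left e)%:E.
  rewrite (_ : elementary_int e X t = fun=> 0); first exact: measurable_cst.
  apply/funext => w; rewrite /elementary_int !min_r// ?subrr ?mulr0//.
  by rewrite (le_trans tl)// lee_fin.
have mX s : (0 <= s)%E -> (s <= t)%E ->
    measurable_fun setT (X s : g_sigma_algebraType (F t) -> R).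
  move=> s0 st; apply/(measurable_wrtP (sigma_F t0T)) => B mB.
  apply: (F_mono s0 st tT); apply: FX => //.
  by rewrite s0 (le_trans st).
apply: measurable_funM.
  apply/(measurable_wrtP (sigma_F t0T)) => B mB.
  apply: (F_mono _ (ltW lt) tT); first by rewrite lee_fin.
  exact: el_measurable.
apply: measurable_funB; apply: mX; rewrite ?ge_min ?lexx ?orbT// le_min t0 andbT lee_fin//.
by rewrite (le_trans l0).
Qed.

Let elementary_int_cadlag e X : cadlag T X -> cadlag T (elementary_int e X).
Proof.
move=> cX; have l0 := el_left_ge0 e; have lr := el_le e; have rT := el_right_le e.
have r0 := le_trans l0 lr.
have lT : ((el_left e)%:E <= T)%E by rewrite (le_trans _ rT)// lee_fin.
have c1 := cadlag_lin (fun=> -1) (cadlag_stopped cX l0 lT) (cadlag_stopped cX r0 rT).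
have := cadlag_lin (el_coef e) c1 cadlag0; congr (cadlag _ _).
by apply: eq_fun2 => t w; rewrite /elementary_int; ring.
Qed.

Lemma simple_int_path (h : simple_process T F) X : adapted T F X -> cadlag T X ->
  integral_path T F (simple_int h X).
Proof.
move=> FX cX; elim: h => [|e h IH].
  have -> : simple_int ([::] : simple_process T F) X = (fun _ _ => 0) :> process.
    by apply: eq_fun2 => t w; rewrite /simple_int big_nil.
  exact: integral_path0.
have -> : simple_int (e :: h) X = lin_process 1 (elementary_int e X) (simple_int h X).
  apply: eq_fun2 => t w.
  by rewrite /simple_int /lin_process big_cons mul1r.
apply: integral_path_lin => //; split.
- exact: elementary_int_adapted.
- exact: elementary_int_cadlag.
- move=> w; rewrite /elementary_int !min_r ?subrr ?mulr0// lee_fin ?el_left_ge0//.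
  by rewrite (le_trans (el_left_ge0 e))// el_le.
Qed.

Lemma simple_int_measurable (h : simple_process T F) X t : adapted T F X ->
  0 <= t -> (t%:E <= T)%E -> measurable_fun setT (simple_int h X t%:E).
Proof.
move=> FX t0 tT; elim: h => [|e h IH].
  rewrite (_ : simple_int _ _ _ = fun=> 0); first exact: measurable_cst.
  by apply/funext => w; rewrite /simple_int big_nil.
rewrite (_ : simple_int _ _ _ =
    fun w => elementary_int e X t%:E w + simple_int h X t%:E w); last first.
  by apply/funext => w; rewrite /simple_int big_cons.
apply: measurable_funD => //.
have t0T : (0 <= t%:E <= T)%E by rewrite lee_fin t0.
by apply: (measurable_wrt_fun t0T); apply: elementary_int_adapted.
Qed.

Lemma simple_int_lin (h : simple_process T F) a X X' t w :
  simple_int h (lin_process a X X') t w = a * simple_int h X t w + simple_int h X' t w.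
Proof.
rewrite /simple_int mulr_sumr -big_split/=; apply: eq_bigr => e _.
by rewrite /lin_process; ring.
Qed.

(** A union bound uniform in the test process [K], with both tolerances halved and the first summand
    rescaled by |a| + 1. Adaptedness makes the events measurable. *)
Lemma emery_cvg_lin a (Xn Yn : nat -> process) X X' :
  (forall n, adapted T F (Xn n)) -> (forall n, adapted T F (Yn n)) ->
  adapted T F X -> adapted T F X' -> emery_cvg P T F Xn X -> emery_cvg P T F Yn X' ->
  emery_cvg P T F (fun n => lin_process a (Xn n) (Yn n)) (lin_process a X X').
Proof.
move=> FXn FYn FX FX' cX cY t t0 tT eps eta eps0 eta0.
pose b := `|a| + 1; have b0 : 0 < b by rewrite ltr_wpDl.
have e1 : 0 < eps / 2 / b by rewrite !divr_gt0.
have e2 : 0 < eps / 2 by rewrite divr_gt0.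
have h2 : 0 < eta / 2 by rewrite divr_gt0.
have := cX t t0 tT _ _ e1 h2; have := cY t t0 tT _ _ e2 h2.
apply: filterS2 => n Yn' Xn' K K1.
have FB (Z Z' : process) : adapted T F Z -> adapted T F Z' ->
    adapted T F (fun r v => Z r v - Z' r v).
  move=> FZ FZ'; have := adapted_lin (-1) FZ' FZ; congr (adapted _ _ _).
  by apply: eq_fun2 => r v; rewrite /lin_process mulN1r addrC.
pose x := simple_int K (fun r v => Xn n r v - X r v) t%:E.
pose y := simple_int K (fun r v => Yn n r v - X' r v) t%:E.
have mx : measurable_fun setT x by apply: simple_int_measurable => //; exact: FB.
have my : measurable_fun setT y by apply: simple_int_measurable => //; exact: FB.
have mset (g : Omega -> R) e : measurable_fun setT g -> measurable [set w | e < `|g w|].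
  move=> mg; rewrite -[X in measurable X]setTI; apply: measurable_fun_ltr => //.
  exact: measurableT_comp.
have xyE : simple_int K (fun r v => lin_process a (Xn n) (Yn n) r v -
    lin_process a X X' r v) t%:E = fun w => a * x w + y w.
  apply/funext => w; rewrite -simple_int_lin; congr simple_int.
  by apply: eq_fun2 => r v; rewrite /lin_process; ring.
rewrite xyE.
apply: (@le_trans _ _ (P ([set w | eps / 2 / b < `|x w|] `|` [set w | eps / 2 < `|y w|]))).
  apply: le_measure.
  - by apply/mem_set/(mset (fun w => a * x w + y w)); apply: measurable_funD => //; exact: measurable_funM.
  - by apply/mem_set; apply: measurableU; exact: mset.
  move=> w /= lt; apply: contrapT => /not_orP[/negP + /negP].
  rewrite -!leNgt => xle yle; move: lt; apply/negP; rewrite -leNgt.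
  rewrite (le_trans (ler_normD _ _))// (splitr eps) lerD// normrM.
  rewrite ler_pdivlMr// in xle; rewrite (le_trans _ xle)// mulrC.
  by rewrite ler_wpM2l// lerDl.
apply: (le_trans (measureU2 _ (mset _ _ mx) (mset _ _ my))).
by rewrite (splitr eta) EFinD leeD//; [exact: Xn'|exact: Yn'].
Qed.

Lemma emery_cvg_cst X : emery_cvg P T F (fun=> X) X.
Proof.
move=> t t0 tT eps eta eps0 eta0; apply: nearW => n K _.
rewrite [X in P X](_ : _ = set0) ?measure0 ?lee_fin ?ltW//.
apply/seteqP; split=> w //=; rewrite /simple_int big1 ?normr0 ?ltNge ?ltW//.
by move=> e _; rewrite !subrr mulr0.
Qed.

Section Vector.
Variables (d : nat) (S : \bar R -> Omega -> 'rV[R]_d).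
Hypothesis hS : forall j, adapted T F (coordinate S j) /\ cadlag T (coordinate S j).

Local Notation integrand := (@integrand _ Omega R d).
Implicit Types H : integrand.

Definition lin_integrand (a : R) H (H' : integrand) : integrand :=
  fun t w => a *: H t w + H' t w.

Let lin_integrandE a H H' t w j :
  lin_integrand a H H' t w ord0 j = a * H t w ord0 j + H' t w ord0 j.
Proof. by rewrite !mxE. Qed.

Let el_scale_measurable a (e : elementary T F) :
  measurable_wrt (F (el_left e)%:E) (fun w => a * el_coef e w).
Proof.
have l0T : (0 <= (el_left e)%:E <= T)%E.
  by rewrite lee_fin el_left_ge0 (le_trans _ (el_right_le e))// lee_fin el_le.
apply/(measurable_wrtP (sigma_F l0T)); apply: measurable_funM => //.
by apply/(measurable_wrtP (sigma_F l0T)); exact: el_measurable.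
Qed.

Let el_scale_bounded a (e : elementary T F) :
  exists C : R, forall w, `|a * el_coef e w| <= C.
Proof.
have [C eC] := el_bounded e; exists (`|a| * C) => w.
by rewrite normrM ler_wpM2l.
Qed.

Definition el_scale a (e : elementary T F) : elementary T F :=
  Elementary (el_left_ge0 e) (el_le e) (el_right_le e) (el_scale_measurable a e)
    (el_scale_bounded a e).

Definition simple_lin a (h h' : simple_process T F) : simple_process T F :=
  map (el_scale a) h ++ h'.

Lemma simple_lin_eval a h h' t w :
  simple_eval (simple_lin a h h') t w = a * simple_eval h t w + simple_eval h' t w.
Proof.
rewrite /simple_eval big_cat big_map mulr_sumr; congr (_ + _).
by apply: eq_bigr => e _ /=; rewrite mulrA.
Qed.

Lemma simple_lin_int a h h' X t w :
  simple_int (simple_lin a h h') X t w = a * simple_int h X t w + simple_int h' X t w.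
Proof.
rewrite /simple_int big_cat big_map mulr_sumr; congr (_ + _).
by apply: eq_bigr => e _ /=; rewrite mulrA.
Qed.

Lemma bounded_integral_path H X : bounded_integral P T F S H X -> integral_path T F X.
Proof.
case=> // h.
suff : forall s : seq 'I_d, integral_path T F
    (fun t w => \sum_(j <- s) simple_int (h j) (coordinate S j) t w).
  by move=> /(_ (index_enum 'I_d)).
elim=> [|j s IH].
  rewrite (_ : (fun t w => _) = (fun _ _ => 0) :> process); first exact: integral_path0.
  by apply: eq_fun2 => t w; rewrite big_nil.
have -> : (fun t w => \sum_(j0 <- j :: s) simple_int (h j0) (coordinate S j0) t w) =
    lin_process 1 (simple_int (h j) (coordinate S j))
      (fun t w => \sum_(j <- s) simple_int (h j) (coordinate S j) t w).
  by apply: eq_fun2 => t w; rewrite /lin_process big_cons mul1r.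
apply: integral_path_lin => //.
by have [FS cS] := hS j; exact: simple_int_path.
Qed.

Lemma bounded_integral_bounded H X : bounded_integral P T F S H X ->
  exists C, forall (t : R) w j, 0 < t -> (t%:E <= T)%E -> `|H t w ord0 j| <= C.
Proof.
case=> [h|Hn Xn {}H {}X C _ HC cvH _ _]; last first.
  exists C => t w j t0 tT; have cv : `|Hn n t w ord0 j| @[n --> \oo] --> `|H t w ord0 j|.
    by apply: cvg_norm; exact: cvH.
  rewrite -(cvg_lim _ cv)//; apply: limr_le; first exact: cvgP cv.
  by apply: nearW => n; exact: HC.
have simple_bounded (s : simple_process T F) :
    exists C, forall t w, `|simple_eval s t w| <= C.
  elim: s => [|e s [C sC]]; first by exists 0 => t w; rewrite /simple_eval big_nil normr0.
  have [B eB] := el_bounded e; exists (B + C) => t w.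
  rewrite /simple_eval big_cons (le_trans (ler_normD _ _))// lerD//; last exact: sC.
  by rewrite normrM (le_trans _ (eB w))// ler_piMr//; case: (_ < _ <= _); rewrite ?normr1 ?normr0.
have /choice[C hC] : forall j, exists C, forall t w, `|simple_eval (h j) t w| <= C.
  by move=> j; exact: simple_bounded.
have C0 j : 0 <= C j by apply: le_trans (hC j 0 point).
exists (\sum_j C j) => t w j _ _; rewrite mxE (bigD1 j)//=.
by rewrite (le_trans (hC j t w))// lerDl sumr_ge0.
Qed.

(** Nested induction: while one integrand passes to the limit the other is kept fixed, and its
    uniform bound enters the dominating constant. *)
Lemma bounded_integral_lin a H X H' X' : bounded_integral P T F S H X ->
  bounded_integral P T F S H' X' ->
  bounded_integral P T F S (lin_integrand a H H') (lin_process a X X').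
Proof.
move=> HX; elim: HX H' X' => {H X} [h|Hn Xn H X C HXn IH HC cvH pX cvX] H' X' HX'.
  elim: HX' => {H' X'} [h'|Hn Xn H X C HXn IH HC cvH pX cvX].
    rewrite (_ : lin_integrand _ _ _ = fun t w => \row_j simple_eval (simple_lin a (h j) (h' j)) t w).
      rewrite (_ : lin_process _ _ _ = fun t w =>
          \sum_j simple_int (simple_lin a (h j) (h' j)) (coordinate S j) t w).
        exact: bounded_integral_simple.
      apply: eq_fun2 => t w; rewrite /lin_process mulr_sumr -big_split/=.
      by apply: eq_bigr => j _; rewrite simple_lin_int.
    by apply: vector_process_coord => t w j; rewrite lin_integrandE !mxE simple_lin_eval.
  have hX := bounded_integral_simple P S h; have ph := bounded_integral_path hX.
  have [B hB] := bounded_integral_bounded hX.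
  apply: (bounded_integral_lim (C := `|a| * B + C) IH).
  - move=> n t w j t0 tT; rewrite lin_integrandE (le_trans (ler_normD _ _))// lerD ?HC//.
    by rewrite normrM ler_wpM2l// hB.
  - move=> t w j t0 tT; rewrite lin_integrandE; under eq_fun do rewrite lin_integrandE.
    by apply: cvgD; [exact: cvg_cst|exact: cvH].
  - exact: integral_path_lin.
  - apply: emery_cvg_lin => //.
    + by move=> _; case: ph.
    + by move=> n; case: (bounded_integral_path (HXn n)).
    + by case: ph.
    + by case: pX.
    + exact: emery_cvg_cst.
have pX' := bounded_integral_path HX'; have [B hB] := bounded_integral_bounded HX'.
apply: (bounded_integral_lim (C := `|a| * C + B) (fun n => IH n _ _ HX')).
- move=> n t w j t0 tT; rewrite lin_integrandE (le_trans (ler_normD _ _))// lerD ?hB//.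
  by rewrite normrM ler_wpM2l// HC.
- move=> t w j t0 tT; rewrite lin_integrandE; under eq_fun do rewrite lin_integrandE.
  by apply: cvgD; [apply: cvgMr; exact: cvH|exact: cvg_cst].
- exact: integral_path_lin.
- apply: emery_cvg_lin => //.
  + by move=> n; case: (bounded_integral_path (HXn n)).
  + by move=> _; case: pX'.
  + by case: pX.
  + by case: pX'.
  + exact: emery_cvg_cst.
Qed.

(** The predictable sets form a sigma-algebra on [time_space T] only. *)
Let trace : set (set (R * Omega)) := [set E |
  <<s time_space T, predictable_rectangles T F >> (time_space T `&` E)].

Let sigma_trace : sigma_algebra setT trace.
Proof.
have [s0 sC sU] := smallest_sigma_algebra (@time_space _ Omega R T)
  (predictable_rectangles T F).
split.
- by rewrite /trace /= setI0.
- move=> A /sC; rewrite /trace /=; congr (<<s _, _ >> _).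
  apply/seteqP; split=> p [tp nA]; split => //.
    by split => // Ap; apply: nA.
  by case: nA => _ nA [_ /nA].
- by move=> A /sU; rewrite /trace /= setI_bigcupr.
Qed.

Lemma predictable_lin a H H' : predictable T F H -> predictable T F H' ->
  predictable T F (lin_integrand a H H').
Proof.
move=> pH pH' j.
have coordP (K : integrand) : predictable T F K -> measurable_fun setT
    ((fun p => K p.1 p.2 ord0 j) : g_sigma_algebraType trace -> R).
  by move=> pK; apply/(measurable_wrtP sigma_trace) => B; exact: pK.
suff : measurable_fun setT
    ((fun p => lin_integrand a H H' p.1 p.2 ord0 j) : g_sigma_algebraType trace -> R).
  by move=> /(measurable_wrtP sigma_trace).
rewrite (_ : (fun p => _) = fun p => a * H p.1 p.2 ord0 j + H' p.1 p.2 ord0 j).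
  by apply: measurable_funD; [apply: measurable_funM => //|]; exact: coordP.
by apply/funext => p; rewrite lin_integrandE.
Qed.

Lemma stochastic_integral_lin a H X H' X' : stochastic_integral P T F S H X ->
  stochastic_integral P T F S H' X' ->
  stochastic_integral P T F S (lin_integrand a H H') (lin_process a X X').
Proof.
move=> [pH [Hn [Xn [bX cH iX eX]]]] [pH' [Hn' [Xn' [bX' cH' iX' eX']]]].
split; first exact: predictable_lin.
exists (fun n => lin_integrand a (Hn n) (Hn' n)), (fun n => lin_process a (Xn n) (Xn' n)).
split.
- by move=> n; exact: bounded_integral_lin.
- move=> t w j t0 tT; rewrite lin_integrandE; under eq_fun do rewrite lin_integrandE.
  by apply: cvgD; [apply: cvgMr; exact: cH|exact: cH'].
- exact: integral_path_lin.
- apply: emery_cvg_lin => //.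
  + by move=> n; case: (bounded_integral_path (bX n)).
  + by move=> n; case: (bounded_integral_path (bX' n)).
  + by case: iX.
  + by case: iX'.
Qed.

Variable W : Omega -> R.
Hypothesis W0 : ae_le P (cst 0) W.

Lemma K_set_lin b k k' : 0 <= b -> K_set P T F S W k -> K_set P T F S W k' ->
  K_set P T F S W (fun w => b * k w + k' w).
Proof.
move=> b0 [H [X [[HX tX [c c0 cX]] ->]]] [H' [X' [[HX' tX' [c' c'0 cX']] ->]]].
exists (lin_integrand b H H'), (lin_process b X X'); split => //; split.
- exact: stochastic_integral_lin.
- move=> Ty; apply: filterS2 (tX Ty) (tX' Ty) => w cv cv'.
  by apply: cvgD => //; exact: cvgMr.
- exists (b * c + c'); first by rewrite ltr_wpDl// mulr_ge0// ltW.
  apply: filterS2 cX cX' => w cX cX' t t0T.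
  have := cX t t0T; have := cX' t t0T; rewrite /lin_process => le' le.
  have : b * (- (c * W w)) <= b * X t w by rewrite ler_wpM2l.
  by move: le'; lra.
Qed.

Lemma K_set0 : K_set P T F S W (fun=> 0).
Proof.
have b0 := bounded_integral_simple P S (fun=> [::] : simple_process T F).
have EH : (fun (t : R) w => \row_(j < d) simple_eval ([::] : simple_process T F) t w) =
    (fun _ _ => 0) :> integrand.
  by apply: vector_process_coord => t w j; rewrite !mxE /simple_eval big_nil.
have EX : (fun t w => \sum_j simple_int ([::] : simple_process T F) (coordinate S j) t w) =
    (fun _ _ => 0) :> process.
  by apply: eq_fun2 => t w; rewrite big1// => j _; rewrite /simple_int big_nil.
have {}b0 : bounded_integral P T F S (fun _ _ => 0) (fun _ _ => 0).
  by move: b0; rewrite EH EX.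
exists (fun _ _ => 0), (fun _ _ => 0); split => //; split.
- split.
    move=> j B mB; have [s0 sC _] := smallest_sigma_algebra (@time_space _ Omega R T)
      (predictable_rectangles T F).
    have [B0|nB0] := pselect (B 0).
      rewrite (_ : _ `&` _ = time_space T); first by rewrite -[X in _ X]setD0; exact: sC.
      by apply/seteqP; split=> p; [case|move=> tp; split => //=; rewrite mxE].
    rewrite (_ : _ `&` _ = set0); first exact: s0.
    by apply/seteqP; split=> p //= -[_]; rewrite mxE.
  exists (fun _ _ _ => 0), (fun _ _ _ => 0); split => //.
  + by move=> t w j _ _; exact: cvg_cst.
  + exact: bounded_integral_path b0.
  + exact: emery_cvg_cst.
- by move=> _; apply: aeW => w; exact: cvg_cst.
- exists 1 => //; apply: filterS W0 => w /= w0 t _.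
  by rewrite mul1r oppr_le0.
Qed.

Lemma K_set_measurable k : K_set P T F S W k -> measurable_fun setT k.
Proof.
move=> [H [X [[[_ [_ [_ [_ _ [FX _ _] _]]]] _ _] ->]]].
have T0T : (0 <= T <= T)%E by rewrite ltW//=.
exact: (measurable_wrt_fun T0T (FX T T0T)).
Qed.

Lemma K_set_ge k : K_set P T F S W k ->
  exists2 c, 0 < c & {ae P, forall w, - (c * W w) <= k w}.
Proof.
move=> [H [X [[_ _ [c c0 cX]] ->]]]; exists c => //.
by apply: filterS cX => w; apply; rewrite ltW//=.
Qed.

End Vector.
End StochasticIntegral.

(** * Duality *)

(** Tests a possibly infinite expected utility at the real numbers strictly below it, where
    integrable minorants exist. *)
Lemma le_from_reals {R : realType} (A B : \bar R) :
  (forall r : R, (r%:E < A)%E -> (r%:E <= B)%E) -> (A <= B)%E.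
Proof.
move=> AB; rewrite leNgt; apply/negP => BA.
case: A B AB BA => [A||] [B||] //= AB.
- rewrite lte_fin => BA; have := AB ((A + B) / 2); rewrite lte_fin lee_fin.
  have : (A + B) / 2 < A by lra.
  by move=> -> /(_ isT); lra.
- by have := AB (A - 1) => + _; rewrite lte_fin gtrBl ltr01 leeNy_eq => /(_ isT).
- by have := AB (B + 1) => + _; rewrite ltry lee_fin gerDl ler10 => /(_ isT).
- by have := AB 0 => + _; rewrite ltry leeNy_eq => /(_ isT).
Qed.

Section Duality.
Context {disp : measure_display} {Omega : measurableType disp} {R : realType}.
Variables (P : probability Omega R) (a : \bar R) (u : R -> \bar R).
Hypotheses (ha : (a < 0)%E) (hu : utility a u).

Local Notation Y := (uhat u).
Let hY : young Y. Proof. exact: uhat_young ha hu. Qed.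
Local Notation V := (orlicz P (uhat u)).
Local Notation M := (modular P (uhat u)).
Local Notation positive := (dual_le P (uhat u) (fun=> 0)).

Let u0 := fine (u 0).

Let uhatE' x : (uhat u x = u0%:E - u (- `|x|)%R)%E.
Proof. exact: uhatE ha hu x. Qed.

Lemma regular_part_spec Q : dual P Y Q -> positive Q ->
  regular P Y (regular_part P Y Q) /\ singular P Y (singular_part P Y Q).
Proof.
move=> Qd Q0; have [zr zrP] := regular_singular_decomposition hY Qd Q0.
by rewrite /singular_part /regular_part; case: xgetP => [z _ //|/(_ zr)[]].
Qed.

(** The choice in [density] is legitimate because the Radon-Nikodym density lies in the conjugate
    Orlicz space. *)
Lemma density_spec v : regular P Y v ->
  has_density P Y v (density P Y (Phihat u) v).
Proof.
move=> rv; have [vd _] := rv.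
have [chi vchi] := seq_order_continuous_density hY vd (regular_seq_order_continuous rv).
have chiO := density_conjugate_orlicz hY (uhat_rational_dense ha hu) vd vchi.
rewrite /density; case: xgetP => [phi _ [[mphi _] phiE]|/(_ chi)[]].
  split => // f Vf; have [fi fE] := phiE f Vf; split => //.
  by apply: EFin_inj; rewrite fE -Ex_EFin.
split=> // f Vf; have [_ chiE] := vchi; have [fi fE] := chiE f Vf.
by split; [exact: fi|rewrite fE Ex_EFin].
Qed.

Section PositiveFunctional.
Variable Q : @functional _ Omega R.
Hypotheses (Qd : dual P Y Q) (Q0 : positive Q).

Let zs := singular_part P Y Q.
Let phi := density P Y (Phihat u) (regular_part P Y Q).
Let nrm := fine (dual_norm P Y zs).

Let rzr : regular P Y (regular_part P Y Q).
Proof. by have [] := regular_part_spec Qd Q0. Qed.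

Let szs : singular P Y zs.
Proof. by have [] := regular_part_spec Qd Q0. Qed.

Let zsd : dual P Y zs. Proof. by case: szs. Qed.

Let zsl : linear_on P Y zs. Proof. exact: dual_linear zsd. Qed.

Let zs0 : positive zs.
Proof.
apply: (singular_part_positive hY rzr szs) => f Vf f0.
by rewrite /zs /singular_part addrC subrK; exact: Q0.
Qed.

Let mphi : measurable_fun setT phi.
Proof. by case: (density_spec rzr). Qed.

Let phi_i f : V f -> Lone P (fun w => f w * phi w).
Proof. by case: (density_spec rzr) => _ /(_ f) H Vf; case: (H Vf). Qed.

Let QE f : V f -> Q f = Ex P (fun w => f w * phi w) + zs f.
Proof.
move=> Vf; have [_ /(_ f Vf)[_ <-]] := density_spec rzr.
by rewrite /zs /singular_part addrC subrK.
Qed.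

Let phi1 : Lone P phi.
Proof. by have := phi_i (orlicz_cst P hY 1); under eq_fun do rewrite mul1r. Qed.

(** Positivity reduces the norm to nonnegative [f]. Dividing by any [c > 1] moves the Luxemburg unit
    ball into the modular one, and [c] tends to 1. *)
Lemma singular_norm_le B : (forall f, V f -> (forall w, 0 <= f w) -> (M f <= 1)%E ->
  zs f <= B) -> (dual_norm P Y zs <= B%:E)%E.
Proof.
move=> zB; apply: ge_ereal_sup => _ [f [Vf Nf] <-]; rewrite lee_fin.
have mf := orlicz_measurable Vf; have Vaf := orlicz_abs hY Vf.
have absf : `|zs f| <= zs (fun w => `|f w|).
  rewrite ler_norml -[X in - X]mul1r -mulNr -(linear_onZ hY _ zsl Vaf).
  apply/andP; split; apply: (dual_le_mono hY zsd zs0) => //; try exact: orliczZ.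
    by apply: aeW => w; rewrite mulN1r lerNl -normrN ler_norm.
  by apply: aeW => w; exact: ler_norm.
apply: (le_trans absf); have zf0 : 0 <= zs (fun w => `|f w|).
  exact: le_trans (normr_ge0 _) absf.
have B0 : 0 <= B.
  rewrite -(linear_on0 hY zsl); apply: zB => //; first exact: orlicz0.
  by rewrite modular0.
have scaled c : 1 < c -> zs (fun w => `|f w|) <= c * B.
  move=> c1; have c0 : 0 < c by apply: lt_trans c1.
  rewrite -ler_pdivrMl// -(linear_onZ hY _ zsl Vaf); apply: zB; first exact: orliczZ.
    by move=> w; rewrite mulr_ge0// invr_ge0 ltW.
  have -> : M (fun w => c^-1 * `|f w|) = M (fun w => f w / c).
    apply: eq_integral => w _; apply/le_anti.
    by rewrite !young_mono// !normrM normr_id mulrC.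
  apply: modular_luxemburg => //.
  by apply: le_lt_trans Nf _; rewrite lte_fin.
apply/ler_addgt0Pr => e e0; have [B_0|Bpos] := eqVneq B 0.
  by have := scaled 2 (ltr1n _ 2); rewrite B_0 mulr0 add0r => /le_trans; apply; exact: ltW.
have {}Bpos : 0 < B by rewrite lt_def Bpos.
have := scaled (1 + e / B); rewrite ltrDl divr_gt0// => /(_ isT).
by rewrite mulrDl mul1r divfK// gt_eqF.
Qed.

Lemma singular_norm_ge0 : (0 <= dual_norm P Y zs)%E.
Proof.
apply: ereal_sup_ubound; exists (fun=> 0); last by rewrite (linear_on0 hY zsl) normr0.
split; first exact: orlicz0.
by apply: luxemburg_le => //; under eq_fun do rewrite mul0r; rewrite modular0.
Qed.

Let nrmE : dual_norm P Y zs = nrm%:E.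
Proof.
rewrite fineK// ge0_fin_numE ?singular_norm_ge0//.
have [_ [C zC]] := (dualP P hY zs).1 zsd.
apply: (@le_lt_trans _ _ C%:E); last exact: ltry.
apply: singular_norm_le => f Vf f0 Mf; rewrite (le_trans (ler_norm _))//.
exact: zC.
Qed.

Let zs_le_nrm f : V f -> (M f <= 1)%E -> zs f <= nrm.
Proof.
move=> Vf Mf; rewrite -lee_fin -nrmE; apply: (@le_trans _ _ `|zs f|%:E).
  by rewrite lee_fin ler_norm.
apply: ereal_sup_ubound; exists f => //; split => //.
by apply: luxemburg_le => //; under eq_fun do rewrite divr1.
Qed.

(** [zs] is carried by a set [A] so small that [h * \1_A] has modular at most 1. *)
Lemma singular_le_norm h eta : V h -> (forall w, 0 <= h w) -> Lone P eta ->
  {ae P, forall w, (uhat u (h w) <= (eta w)%:E)%E} -> zs h <= nrm.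
Proof.
move=> Vh h0 etai heta; apply/ler_addgt0Pr => e e0.
have e1 : 0 < Num.min e 1 by rewrite lt_min e0 ltr01.
have [A [mA zA EA]] := singular_small_set hY szs zs0 Vh h0 etai e1.
have mAc := measurableC mA.
have -> : zs h = zs (fun w => h w * \1_A w) + zs (fun w => h w * \1_(~` A) w).
  rewrite -(linear_onD zsl (orlicz_indic hY mA Vh) (orlicz_indic hY mAc Vh)).
  congr zs; apply/funext => w.
  by rewrite -mulrDr !indicE in_setC; case: (w \in A); rewrite ?addr0 ?add0r mulr1.
apply: lerD; last by rewrite (le_trans (ltW zA))// ge_min lexx.
apply: zs_le_nrm; first exact: orlicz_indic.
have ei : Lone P (fun w => `|eta w| * \1_A w).
  apply: (Lone_le _ _ (Lone_abs etai)) => [|w].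
    apply: measurable_funM; last exact: measurable_indic.
    by apply: measurableT_comp => //; exact: Lone_measurable etai.
  by rewrite normrM normr_id ler_piMr// indicE; case: (_ \in _); rewrite ?normr1 ?normr0.
apply: (@le_trans _ _ (Ex P (fun w => `|eta w| * \1_A w))%:E); last first.
  by rewrite lee_fin (le_trans (ltW EA))// ge_min lexx orbT.
rewrite -Ex_EFin//; apply: ae_ge0_le_integral => //.
- by move=> *; exact: (young_ge0 hY).
- by apply: (modular_measurable hY); exact: orlicz_measurable (orlicz_indic hY mA Vh).
- exact: measurable_int ei.
apply: filterS heta => w le _; rewrite indicE; case: (w \in A).
  by rewrite !mulr1 (le_trans le)// lee_fin ler_norm.
by rewrite !mulr0 (young0 hY).
Qed.

Lemma weak_duality lambda x f eta : 0 < lambda -> Q (cst 1) = 1 -> V f -> Q f <= 0 ->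
  Lone P eta -> {ae P, forall w, ((eta w)%:E <= u (x + f w))%E} ->
  ((Ex P eta)%:E <= dual_value P u x lambda Q)%E.
Proof.
move=> l0 Q1 Vf Qf etai etaf.
pose g w := x + f w.
have Vx : V (fun=> x) := orlicz_cst P hY x.
have Vg : V g by exact: orliczD.
have Qg : Q g <= x.
  rewrite (linear_onD (dual_linear hY Qd) Vx Vf).
  have -> : Q (fun=> x) = x.
    have := linear_onZ hY x (dual_linear hY Qd) (orlicz_cst P hY 1).
    by under eq_fun do rewrite mulr1; rewrite [Q _ in RHS]Q1 mulr1.
  by lra.
pose h w := Num.max (- g w) 0.
have Vh : V h by apply: orlicz_max => //; [exact: orliczN|exact: orlicz0].
have zh : zs h <= nrm.
  (* Where [g] is negative, [uhat u] at [- g] equals [u0 - u (g w)], at most [u0 - eta]. The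
     integrable minorant of the utility thus controls the modular of the losses. *)
  apply: (@singular_le_norm h (fun w => `|u0 - eta w|)) => //.
  - by move=> w; rewrite le_max lexx orbT.
  - by apply: Lone_abs; apply: LoneB => //; exact: Lone_cst.
  apply: filterS etaf => w le; have [gw|gw] := leP (- g w) 0.
    by rewrite /h max_r// (young0 hY) lee_fin.
  rewrite /h (max_l (ltW gw)) uhatE' gtr0_norm// opprK.
  apply: (@le_trans _ _ (u0%:E - (eta w)%:E)%E); first by rewrite leeB.
  by rewrite -EFinB lee_fin ler_norm.
have zg : - zs g <= nrm.
  apply: le_trans zh; have : - zs g = zs (fun w => - g w).
    rewrite -mulN1r -(linear_onZ hY _ zsl Vg); congr zs; apply/funext => w.
    by rewrite mulN1r.
  move=> ->; apply: (dual_le_mono hY zsd zs0); [exact: orliczN|exact: Vh|].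
  by apply: aeW => w; rewrite le_max lexx.
pose theta w := eta w - lambda * (g w * phi w).
have gphi := phi_i Vg.
have thetai : Lone P theta by apply: LoneB => //; exact: LoneZ.
(* Fenchel's inequality makes [theta] an integrable minorant of the conjugate, which bounds its
   integral below even if that is infinite. *)
have Etheta : ((Ex P theta)%:E <= \int[P]_w Phi u (lambda * phi w)%R)%E.
  apply: (@le_trans _ _ (expected_utility P (fun w => Phi u (lambda * phi w)%R))).
    apply: below_expectation_le.
      apply: (@conjugate_measurable _ _ _ u) => //.
      - exact: utility0_fin_num ha hu.
      - by move=> y; exact: utility_lty hu y.
      - exact: utility_rational_dense hu.
      - exact: measurable_funM.
    exists theta; split => //; apply: filterS etaf => w le.
    apply: (@le_trans _ _ (u (g w) - (g w * (lambda * phi w))%:E)%E).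
      by rewrite /theta EFinB mulrCA leeB.
    by apply: ereal_sup_ubound; exists (g w).
  by rewrite /expected_utility; case: ifP => // _; rewrite leNye.
rewrite /dual_value -/zs -/phi nrmE.
apply: (@le_trans _ _ ((lambda * (x + nrm))%:E + (Ex P theta)%:E)%E); last first.
  by rewrite EFinM EFinD leeD2l.
rewrite -EFinD lee_fin /theta ExB//; last exact: LoneZ.
rewrite (ExZ _ gphi).
have : lambda * Ex P (fun w => g w * phi w) <= lambda * (x + nrm).
  by rewrite ler_pM2l//; have := QE Vg; lra.
by lra.
Qed.

(** The witness follows [g] off a set carrying [zs] and [- f2] on it. *)
Lemma strong_duality_test lambda x U0 (g eta f2 : Omega -> R) : 0 < lambda -> Q (cst 1) = 1 ->
  (forall f mu, V f -> Lone P mu -> {ae P, forall w, ((mu w)%:E <= u (x + f w))%E} ->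
     Ex P mu <= U0 + lambda * Q f) ->
  measurable_fun setT g -> measurable_fun setT eta ->
  (exists k, forall w, `|g w| <= k /\ `|eta w| <= k) ->
  (forall w, u (g w) = (eta w)%:E) ->
  V f2 -> (forall w, 0 <= f2 w) -> (M f2 <= 1)%E ->
  Ex P (fun w => eta w - g w * (lambda * phi w)) + lambda * zs f2 + lambda * x <= U0.
Proof.
move=> l0 Q1 hJ mg meta [k gk] ug V2 f20 M2.
have Vg : V g by apply: (orlicz_bounded P hY (k := k)) => // w; case: (gk w).
have etai : Lone P eta by apply: (Lone_bounded P (k := k)) => // w; case: (gk w).
pose y w := fine (uhat u (f2 w)).
have mf2 := orlicz_measurable V2; have mY := modular_measurable hY mf2.
have y0 w : 0 <= y w by rewrite fine_ge0// (young_ge0 hY).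
have yi' : P.-integrable setT (fun w => uhat u (f2 w)).
  apply/integrableP; split => //.
  under eq_integral do rewrite gee0_abs ?(young_ge0 hY)//.
  exact: le_lt_trans M2 (ltry _).
have my : measurable_fun setT y by exact: measurableT_comp.
have yi : Lone P y.
  apply: (le_integrable _ _ _ yi') => //; first exact/measurable_EFinP.
  move=> w _ /=; have := young_ge0 hY (f2 w).
  by rewrite /y; case: (uhat u (f2 w)) => [r||] //= _; rewrite ?leey.
have yE : {ae P, forall w, uhat u (f2 w) = (y w)%:E}.
  by apply: filterS (integrable_ae measurableT yi') => w /(_ I) fin; rewrite fineK.
pose h w := `|g w| + f2 w.
have Vh : V h by apply: orliczD => //; exact: orlicz_abs.
have h0 w : 0 <= h w by rewrite addr_ge0.
(* Dominates on [A] everything lost by switching from [g] to [- f2]: the utilities [eta] and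
   [u0 - y], and the two products with [phi]. *)
pose E1 w := `|eta w| + (`|u0| + y w) + lambda * (h w * `|phi w|).
have hphi : Lone P (fun w => h w * `|phi w|).
  by apply: Lone_mul_abs; [exact: orlicz_measurable Vh|exact: mphi|exact: phi_i].
have E1i : Lone P E1.
  apply: LoneD; last exact: LoneZ.
  by apply: LoneD; [exact: Lone_abs|apply: LoneD => //; exact: Lone_cst].
have E10 w : 0 <= E1 w by rewrite !addr_ge0// mulr_ge0 ?(ltW l0)// mulr_ge0.
apply/ler_addgt0Pr => e e0.
(* The expectations lose this much and [zs] loses it once more with factor [lambda], for a total of
   [e]. *)
have e1 : 0 < e / (1 + lambda) by rewrite divr_gt0// addr_gt0.
have [A [mA zA EA]] := singular_small_set hY szs zs0 Vh h0 E1i e1.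
have mAc := measurableC mA.
have m1 : measurable_fun setT (\1_A : Omega -> R) by exact: measurable_indic.
have m1c : measurable_fun setT (\1_(~` A) : Omega -> R) by exact: measurable_indic.
have V1 f : V f -> V (fun w => f w * \1_A w) by exact: orlicz_indic.
have V1c f : V f -> V (fun w => f w * \1_(~` A) w) by exact: orlicz_indic.
have E1A : Lone P (fun w => E1 w * \1_A w).
  apply: (Lone_le _ _ E1i) => [|w].
    by apply: measurable_funM => //; exact: Lone_measurable E1i.
  by rewrite normrM (ger0_norm (E10 w)) ler_piMr// indicE; case: (_ \in _); rewrite ?normr1 ?normr0.
(* This is [g] off [A] and [- f2] on [A], written so that [zs fA] is visibly a small term minus
   [zs f2]. *)
pose fA w := (g w + f2 w) * \1_(~` A) w - f2 w.
have VfA : V fA by apply: orliczB => //; apply: V1c; exact: orliczD.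
(* The utility of [fA]: [eta] off [A], and on [A] the value of [u] at [- f2], which is [u0 - y]. *)
pose mu w := eta w * \1_(~` A) w + (u0 - y w) * \1_A w.
have Vx : V (fun=> x) := orlicz_cst P hY x.
have mui : Lone P mu.
  have i1 : Lone P (fun w => `|eta w| + (`|u0| + y w)).
    by apply: LoneD; [exact: Lone_abs|apply: LoneD => //; exact: Lone_cst].
  apply: (Lone_le _ _ i1) => [|w].
    by apply: measurable_funD; apply: measurable_funM => //; exact: measurable_funB.
  rewrite /mu !indicE in_setC; case: (w \in A); rewrite ?mulr1 ?mulr0 ?addr0 ?add0r.
    apply: (@le_trans _ _ (`|u0| + y w)); last by rewrite lerDr.
    by rewrite (le_trans (ler_normB _ _))// (ger0_norm (y0 w)).
  by rewrite lerDl addr_ge0.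
(* Subtracting [x] makes [fA] the final position; since [Q] of 1 is 1, this yields the term
   [lambda * x]. *)
have := hJ (fun w => fA w - x) mu (orliczB hY VfA Vx) mui.
have muE : {ae P, forall w, ((mu w)%:E <= u (x + (fA w - x)))%E}.
  apply: filterS yE => w yw; rewrite addrC subrK /mu /fA !indicE in_setC.
  case: (w \in A); rewrite ?mulr1 ?mulr0 ?addr0 ?add0r ?sub0r; last by rewrite addrK ug.
  have := uhatE' (f2 w); rewrite yw ger0_norm//.
  have := utility_lty hu (- f2 w); case: (u (- f2 w)) => [r||] // _ [] yr.
  by rewrite lee_fin yr; lra.
move=> /(_ muE).
have Ql := dual_linear hY Qd.
have -> : Q (fun w => fA w - x) = Q fA - x.
  rewrite (linear_onB Ql VfA Vx); congr (_ - _).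
  have := linear_onZ hY x Ql (orlicz_cst P hY 1).
  by under eq_fun do rewrite mulr1; rewrite [Q _ in RHS]Q1 mulr1.
have Vgf := orliczD hY Vg V2.
have zfA : zs fA <= e / (1 + lambda) - zs f2.
  rewrite (linear_onB zsl (V1c _ Vgf) V2) lerD2r.
  apply: le_trans (ltW zA); apply: (dual_le_mono hY zsd zs0); [exact: V1c|exact: V1c|].
  apply: aeW => w; apply: ler_wpM2r; first by rewrite indicE; case: (_ \in _).
  by rewrite lerD2r ler_norm.
rewrite (QE VfA).
have fAphi := phi_i VfA.
have gphi : Lone P (fun w => g w * (lambda * phi w)).
  by have := LoneZ lambda (phi_i Vg); congr (Lone _ _); apply/funext => w; ring.
have key : Ex P (fun w => eta w - g w * (lambda * phi w)) - e / (1 + lambda) <=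
    Ex P mu - lambda * Ex P (fun w => fA w * phi w).
  apply: (@le_trans _ _ (Ex P (fun w => eta w - g w * (lambda * phi w)) -
      Ex P (fun w => E1 w * \1_A w))).
    rewrite lerD2l lerN2; apply: le_trans (ltW EA).
    by apply: le_Ex => // [|w]; [apply: (Lone_le _ _ E1A) => [|w];
      [apply: measurable_funM => //; apply: measurableT_comp => //; exact: Lone_measurable E1i
      |rewrite normrM normr_id (ger0_norm (E10 w)) ler_wpM2l// indicE; case: (_ \in _); rewrite ?normr1 ?normr0]
      |rewrite ler_wpM2r ?ler_norm// indicE; case: (_ \in _)].
  rewrite -(ExZ lambda fAphi) -!ExB//; last 2 first.
  - exact: LoneZ.
  - exact: LoneB.
  apply: le_Ex => [||w]; [by apply: LoneB => //; exact: LoneB|by apply: LoneB => //; exact: LoneZ|].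
  rewrite /mu /fA !indicE in_setC; case: (w \in A);
    rewrite /= ?mulr1 ?mulr0 ?addr0 ?add0r ?subr0 ?sub0r ?addrK; last by lra.
  rewrite /E1 /h.
  have t1 := ler_norm (eta w); have t2 : - `|u0| <= u0 by rewrite lerNl -normrN ler_norm.
  have t3 : - (g w * phi w) <= `|g w| * `|phi w| by rewrite -normrM -normrN ler_norm.
  have t4 : - (f2 w * phi w) <= f2 w * `|phi w|.
    by rewrite -mulrN ler_wpM2l// -normrN ler_norm.
  have : lambda * (- (g w * phi w) + - (f2 w * phi w)) <=
      lambda * (`|g w| * `|phi w| + f2 w * `|phi w|).
    by rewrite ler_pM2l// lerD.
  have := y0 w; move: t1 t2; lra.
have : lambda * zs fA <= lambda * (e / (1 + lambda) - zs f2) by rewrite ler_pM2l.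
have eE : e / (1 + lambda) + lambda * (e / (1 + lambda)) = e.
  by field; rewrite gt_eqF// addr_gt0.
by move: key; lra.
Qed.

Lemma strong_duality lambda x U0 : 0 < lambda -> Q (cst 1) = 1 ->
  (forall f mu, V f -> Lone P mu -> {ae P, forall w, ((mu w)%:E <= u (x + f w))%E} ->
     Ex P mu <= U0 + lambda * Q f) ->
  (dual_value P u x lambda Q <= U0%:E)%E.
Proof.
move=> l0 Q1 hJ; rewrite /dual_value -/zs -/phi nrmE -EFinD -EFinM.
rewrite addeC -leeBrDr// -EFinB; apply: le_from_reals => beta lt.
have psii : Lone P (fun w => lambda * phi w) by exact: LoneZ.
have [|||g [eta [mg meta gk ug ltb]]] := @integral_conjugate_lt _ _ _ P u _ _ _
  (fun w => lambda * phi w) (Lone_measurable psii) beta psii lt.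
- exact: utility0_fin_num ha hu.
- by move=> y; exact: utility_lty hu y.
- exact: utility_rational_dense hu.
have nrm_le : nrm <= (U0 - lambda * x - beta) / lambda.
  rewrite -lee_fin -nrmE; apply: singular_norm_le => f2 V2 f20 M2.
  rewrite ler_pdivlMr//.
  have := strong_duality_test l0 Q1 hJ mg meta gk ug V2 f20 M2.
  by move: ltb; lra.
by move: nrm_le; rewrite ler_pdivlMr// lee_fin; lra.
Qed.

End PositiveFunctional.
End Duality.

(** * Duality for an abstract convex cone *)

Section ConeDuality.
Context {disp : measure_display} {Omega : measurableType disp} {R : realType}.
Variables (P : probability Omega R) (a : \bar R) (u : R -> \bar R).
Hypotheses (ha : (a < 0)%E) (hu : utility a u).
Variables (W : Omega -> R) (x : R) (K : set (Omega -> R)).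

Let hY : young (uhat u). Proof. exact: uhat_young ha hu. Qed.
Local Notation V := (orlicz P (uhat u)).
Local Notation M := (modular P (uhat u)).
Local Notation C := (C_set P u K).
Local Notation below f := (below_expectation P (fun w => u (x + f w))).

Hypotheses (hW : V W) (hx : (a < x%:E)%E) (K0 : K (fun=> 0))
  (Klin : forall b k k', 0 <= b -> K k -> K k' -> K (fun w => b * k w + k' w))
  (Kmeas : forall k, K k -> measurable_fun setT k)
  (Kge : forall k, K k -> exists2 c, 0 < c & {ae P, forall w, - (c * W w) <= k w}).

Let mu_ (f : Omega -> R) : measurable_fun setT f ->
  measurable_fun setT (fun w => u (x + f w)).
Proof.
move=> mf; apply: measurableT_comp; first exact: utility_measurable hu.
exact: measurable_funD.
Qed.

Let below_lt (f : Omega -> R) r : measurable_fun setT f ->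
  (r%:E < expected_utility P (fun w => u (x + f w)))%E -> below f r.
Proof.
move=> mf; apply: lt_below_expectation; first exact: mu_.
by move=> w; exact: utility_lty hu _.
Qed.

Let below_le (f : Omega -> R) r : measurable_fun setT f -> below f r ->
  (r%:E <= expected_utility P (fun w => u (x + f w)))%E.
Proof. by move=> mf; apply: below_expectation_le; exact: mu_. Qed.

Lemma C_set0 : C (fun=> 0).
Proof.
split; first exact: orlicz0.
exists (fun=> 0), (fun=> 0); split => //; last by apply/funext => w; rewrite subrr.
by split; [exact: measurable_cst|exact: aeW].
Qed.

Lemma C_set_opp f : V f -> ae_le P (cst 0) f -> C (fun w => - f w).
Proof.
move=> Vf f0; split; first exact: orliczN.
exists (fun=> 0), f; split => //; last by apply/funext => w; rewrite sub0r.
by split => //; exact: orlicz_measurable Vf.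
Qed.

Lemma C_set_lin b f g : 0 <= b -> C f -> C g -> C (fun w => b * f w + g w).
Proof.
move=> b0 [Vf [k [l [Kk [ml l0] fE]]]] [Vg [k' [l' [Kk' [ml' l'0] gE]]]].
split; first exact: orlicz_lin.
exists (fun w => b * k w + k' w), (fun w => b * l w + l' w); split.
- exact: Klin.
- split; first by apply: measurable_funD => //; exact: measurable_funM.
  by apply: filterS2 l0 l'0 => w /= ? ?; rewrite addr_ge0// mulr_ge0.
- by apply/funext => w; rewrite fE gE; ring.
Qed.

Let below_0 : below (fun=> 0) (fine (u x)).
Proof.
exists (fun=> fine (u x)); split; [exact: Lone_cst| |by rewrite Ex_cst].
by apply: aeW => w; rewrite addr0 fineK// (utility_fin_num hu hx).
Qed.

Lemma sup_utilities_C :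
  ereal_sup (utilities P u K x) = ereal_sup (utilities P u C x).
Proof.
apply/le_anti/andP; split; last first.
  apply: ge_ereal_sup => _ [f [Vf [k [l [Kk [ml l0] fE]]]] <-].
  apply: (@le_trans _ _ (expected_utility P (fun w => u (x + k w)))); last first.
    by apply: ereal_sup_ubound; exists k.
  apply: le_from_reals => r /(below_lt (orlicz_measurable Vf))[eta [etai etau rE]].
  apply: below_le; first exact: Kmeas.
  exists eta; split => //; apply: filterS2 etau l0 => w le l0; apply: (le_trans le).
  by apply: (utility_mono hu); rewrite fE lerD2l gerBl.
apply: ge_ereal_sup => _ [k Kk <-]; apply: le_from_reals => r lt.
have mk := Kmeas Kk.
(* The gap between [r] and [r'] pays for the truncation below. *)
have [r' rr' lt'] : exists2 r', r < r' & (r'%:E < expected_utility P (fun w => u (x + k w)))%E.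
  move: lt; case: (expected_utility _ _) => [e||] //.
    by rewrite lte_fin => re; exists ((r + e) / 2); rewrite ?lte_fin; lra.
  by move=> _; exists (r + 1); rewrite ?ltrDl// ltry.
have [eta [etai etau rE]] := below_lt mk lt'.
have meta := Lone_measurable etai.
pose ux := fine (u x).
have uxE : u x = ux%:E by rewrite fineK// (utility_fin_num hu hx).
pose A n := [set w | k w <= n%:R].
have mA n : measurable (A n).
  by rewrite -[A n]setTI; apply: measurable_fun_ler.
(* A minorant of the utility after truncation: where [k] exceeds [n], the truncated position is at
   least [x], so [u x] can replace the lost utility. *)
pose eta_ n w := if k w <= n%:R then eta w else Num.min (eta w) ux.
have meta_ n : measurable_fun setT (eta_ n).
  apply: measurable_fun_ifT => //; first exact: measurable_fun_ler.
  exact: measurable_minr.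
have bound n w : `|eta_ n w| <= `|eta w| + `|ux|.
  rewrite /eta_; case: ifP => _; first by rewrite lerDl.
  by have [_|_] := leP (eta w) ux; rewrite ?lerDl ?lerDr.
have bi : Lone P (fun w => `|eta w| + `|ux|).
  by apply: LoneD; [exact: Lone_abs|exact: Lone_cst].
have cv : Ex P (eta_ n) @[n --> \oo] --> Ex P eta.
  apply: (Ex_dominated (g := fun w => `|eta w| + `|ux|)) => //.
  - apply: aeW => w; apply: cvg_near_cst.
    exists (Num.truncn (k w)).+1 => // n /= kn; rewrite /eta_ ifT//.
    have [k0|k0] := ltP (k w) 0; first by rewrite (le_trans (ltW k0)).
    by rewrite (le_trans (ltW (truncnS_gt _)))// ler_nat.
  - by move=> n; apply: aeW => w; exact: bound.
have dr : 0 < Ex P eta - r by move: rE rr'; lra.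
have /cvgrPdist_lt/(_ _ dr)[n _ /(_ n (leqnn n))/=] := cv.
move=> /(le_lt_trans (ler_norm _)) near_n.
have [c c0 kc] := Kge Kk.
(* Lies almost surely between [- (c * W)] and [n], hence in the Orlicz space because [W] does. *)
pose f w := Num.min (k w) n%:R.
have mf : measurable_fun setT f by exact: measurable_minr.
have Vf : V f.
  apply: (orlicz_solid hY mf (orliczD hY (orlicz_abs hY (orliczZ hY c hW))
    (orlicz_cst P hY n%:R))).
  apply: filterS kc => w kw; rewrite [leRHS]ger0_norm ?addr_ge0//.
  have cW := ler_norm (c * W w); have n0 := ler0n R n; have := normr_ge0 (c * W w).
  rewrite ler_norml /f; have [kn|kn] := leP (k w) n%:R.
    by move=> ?; apply/andP; split; lra.
  by move=> ?; apply/andP; split; lra.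
have Cf : C f.
  split => //; exists k, (fun w => k w - f w); split => //.
    split; first exact: measurable_funB.
    by apply: aeW => w /=; rewrite subr_ge0 ge_min lexx.
  by apply/funext => w; ring.
apply: (@le_trans _ _ (expected_utility P (fun w => u (x + f w)))); last first.
  by apply: ereal_sup_ubound; exists f.
apply: below_le => //; exists (eta_ n); split; last by move: near_n; lra.
  exact: Lone_le (meta_ n) (bound n) bi.
apply: filterS etau => w le; rewrite /eta_ /f; have [kn|kn] := leP (k w) n%:R => //.
apply: (@le_trans _ _ (u x)); first by rewrite uxE lee_fin ge_min lexx orbT.
by apply: (utility_mono hu); rewrite lerDl.
Qed.

Lemma polar_positive z : polar_C P u K z -> dual_le P (uhat u) (fun=> 0) z.
Proof.
move=> [zd zC] f Vf f0; have := zC _ (C_set_opp Vf f0).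
have := linear_onZ hY (-1) (dual_linear hY zd) Vf.
under [X in z X]eq_fun do rewrite mulN1r.
by move=> ->; lra.
Qed.

Lemma below_concave f g r s t : V f -> V g -> 0 < t < 1 -> below f r -> below g s ->
  below (fun w => t * f w + (1 - t) * g w) (t * r + (1 - t) * s).
Proof.
move=> Vf Vg /andP[t0 t1] [e1 [i1 le1 r1]] [e2 [i2 le2 r2]].
have t1' : 0 < 1 - t by rewrite subr_gt0.
exists (fun w => t * e1 w + (1 - t) * e2 w); split.
- by apply: LoneD; exact: LoneZ.
- apply: filterS2 le1 le2 => w le1 le2.
  have t01 : 0 <= t <= 1 by rewrite !ltW.
  have := utility_concave ha hu (x + f w) (x + g w) t01.
  have -> : t * (x + f w) + (1 - t) * (x + g w) = x + (t * f w + (1 - t) * g w) by ring.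
  apply: le_trans; rewrite EFinD !EFinM leeD//.
    by rewrite lee_wpmul2l// lee_fin ltW.
  by rewrite lee_wpmul2l// lee_fin ltW.
- by rewrite ExD ?ExZ//; [rewrite lerD// ler_pM2l|exact: LoneZ|exact: LoneZ].
Qed.

(** Writing [x = (1 - tau) * x0] with [x0] still above [a], concavity bounds [u (x - tau * g)] below
    by a mixture of [u x0] and [u (- g)], and the latter has expectation at least [u 0 - 1] on the
    modular ball. *)
Lemma below_unit_ball : exists tau r, 0 < tau /\ forall g, V g -> (M g <= 1)%E ->
  below (fun w => - (tau * g w)) r.
Proof.
(* For [x >= 0] the double of [x] works. For negative [x], [x0] is taken strictly between [a] and
   [x], with [tau = 1 - x / x0]. *)
have [tau [x0 [tau0 tau1 xE ax0]]] : exists tau x0,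
    [/\ 0 < tau, tau < 1, x = (1 - tau) * x0 & (a < x0%:E)%E].
  have [xpos|xneg] := leP 0 x.
    exists 2^-1, (2 * x); split; [lra|lra|lra|].
    by apply: lt_le_trans hx _; rewrite lee_fin; lra.
  have [x0 x0x ax0] : exists2 x0, x0 < x & (a < x0%:E)%E.
    move: hx; case: (a) => [r||] //.
      by rewrite lte_fin => rx; exists ((r + x) / 2); rewrite ?lte_fin; lra.
    by move=> _; exists (x - 1); rewrite ?ltNyr// gtrBl.
  have x0neg : x0 < 0 by apply: lt_trans xneg.
  exists (1 - x / x0), x0; split => //.
  - by rewrite subr_gt0 ltr_ndivrMr// mul1r.
  - by rewrite gtrBl nmulr_rgt0// invr_lt0.
  - by rewrite opprB addrC subrK divfK// lt_eqF.
have u0f := utility0_fin_num ha hu; have ux0f := utility_fin_num hu ax0.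
exists tau, ((1 - tau) * fine (u x0) + tau * (fine (u 0) - 1)); split => // g Vg Mg.
have mg := orlicz_measurable Vg; have mY := modular_measurable hY mg.
pose y w := fine (uhat u (g w)).
have yi' : P.-integrable setT (fun w => uhat u (g w)).
  apply/integrableP; split => //.
  under eq_integral do rewrite gee0_abs ?(young_ge0 hY)//.
  exact: le_lt_trans Mg (ltry _).
have yE : {ae P, forall w, uhat u (g w) = (y w)%:E}.
  by apply: filterS (integrable_ae measurableT yi') => w /(_ I) fin; rewrite fineK.
have my : measurable_fun setT y by exact: measurableT_comp.
have yi : Lone P y.
  apply: (le_integrable _ _ _ yi') => //; first exact/measurable_EFinP.
  move=> w _ /=; have := young_ge0 hY (g w).
  by rewrite /y; case: (uhat u (g w)) => [r||] //= _; rewrite ?leey.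
have Ey : Ex P y <= 1.
  rewrite -lee_fin -Ex_EFin//; apply: le_trans Mg.
  rewrite le_eqVlt; apply/orP; left; apply/eqP.
  apply: ae_eq_integral => //; first exact/measurable_EFinP.
  by apply: filterS yE => w -> _.
have ui := Lone_cst P (fine (u 0)).
have i1 := LoneZ tau (LoneB ui yi).
exists (fun w => (1 - tau) * fine (u x0) + tau * (fine (u 0) - y w)); split.
- by apply: LoneD => //; exact: Lone_cst.
- apply: filterS yE => w yw.
  have tau01 : 0 <= 1 - tau <= 1 by rewrite subr_ge0 (ltW tau1) gerBl ltW.
  have := utility_concave ha hu x0 (- g w) tau01.
  have -> : 1 - (1 - tau) = tau by ring.
  have -> : (1 - tau) * x0 + tau * - g w = x + - (tau * g w) by rewrite -xE; ring.
  apply: le_trans; rewrite EFinD !EFinM fineK// leeD2l//.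
  rewrite lee_wpmul2l ?lee_fin ?(ltW tau0)//.
  apply: (@le_trans _ _ (u (- `|g w|))); last first.
    by apply: (utility_mono hu); rewrite lerN2 ler_norm.
  have := uhatE ha hu (g w); rewrite yw.
  have := utility_lty hu (- `|g w|); case: (u (- `|g w|)) => [r||] // _ [] ->.
  by rewrite lee_fin; lra.
- rewrite ExD//; last exact: Lone_cst.
  rewrite Ex_cst (ExZ _ (LoneB ui yi)) (ExB ui yi) Ex_cst lerD2l ler_pM2l//.
  by rewrite lerD2l lerN2.
Qed.

Local Notation U := (ereal_sup (utilities P u K x)).
Hypothesis hsup : (U < u_infty u)%E.

Lemma sup_utilities_fin_num : U \is a fin_num.
Proof.
have ux := utility_fin_num hu hx.
have lt : (U < +oo)%E by apply: lt_le_trans hsup (leey _).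
rewrite fin_numE (lt_eqF lt) andbT gt_eqF//.
apply: (@lt_le_trans _ _ (fine (u x))%:E); first exact: ltNyr.
apply: (@le_trans _ _ (expected_utility P (fun w => u (x + 0)))).
  by apply: below_le => //; exact: measurable_cst.
by apply: ereal_sup_ubound; exists (fun=> 0).
Qed.

(** The supergradient is a positive multiple of an element of [M_set]: its mass
    vanishes only if [u] stays below [U]. *)
Lemma dual_optimizer : exists lambda Q, [/\ 0 < lambda, M_set P u K Q &
  forall f eta, V f -> Lone P eta -> {ae P, forall w, ((eta w)%:E <= u (x + f w))%E} ->
    Ex P eta <= fine U + lambda * Q f].
Proof.
have UE : U = (fine U)%:E by rewrite fineK// sup_utilities_fin_num.
have [tau [r0 [tau0 ball]]] := below_unit_ball.
have JU f r : C f -> below f r -> r <= fine U.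
  move=> Cf Jr; have [Vf _] := Cf.
  rewrite -lee_fin -UE sup_utilities_C.
  apply: le_trans (below_le (orlicz_measurable Vf) Jr) _.
  by apply: ereal_sup_ubound; exists f.
have Jabs g : V g -> exists t r, 0 < t /\ below (fun w => - (t * g w)) r.
  move=> Vg; have [s s0 Ms] := exists_modular_le1 hY Vg.
  exists (tau * s), r0; split; first exact: mulr_gt0.
  have := ball _ (orliczZ hY s Vg) Ms; congr (below_expectation _ _ _).
  by apply/funext => w; rewrite mulrA.
have CV : C `<=` V by move=> f [].
have [z zl zJ] := cone_supergradient (orlicz0 P hY)
  (fun b f g Vf Vg => orlicz_lin hY b Vf Vg) C_set0 CV C_set_lin below_concave JU Jabs.
have zlin : linear_on P (uhat u) z by [].
(* The uniform lower bound on a ball turns the supergradient inequality into continuity of [z]. *)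
have z_le g : V g -> (M g <= 1)%E -> z g <= (fine U - r0) / tau.
  move=> Vg Mg; have Vn := orliczZ hY (- tau) Vg.
  have := zJ _ (fun w => - tau * g w) r0 C_set0 Vn.
  rewrite (linear_onZ hY _ zlin Vg) ler_pdivlMr// => le.
  suff : r0 <= fine U + - tau * z g by lra.
  apply: le; have := ball g Vg Mg; congr (below_expectation _ _ _).
  by apply/funext => w; rewrite add0r mulNr.
have zd : dual P (uhat u) z.
  apply/(dualP P hY); split => //; exists ((fine U - r0) / tau) => g Vg Mg.
  rewrite ler_norml z_le// andbT lerNl.
  have Vn := orliczZ hY (-1) Vg.
  have := z_le _ Vn; rewrite (linear_onZ hY _ zlin Vg) mulN1r; apply.
  have E : M (fun w => -1 * g w) = M g.
    apply: eq_integral => w _; apply/le_anti.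
    by rewrite !(young_mono hY)// mulN1r normrN.
  by rewrite E.
have zC f : C f -> z f <= 0.
  move=> Cf; have [Vf _] := Cf; rewrite leNgt; apply/negP => zf.
  (* Tuned so that testing with [b * f] in [C] and displacement [- b * f], which cancel, would give
     [u x <= u x - 1]. *)
  pose b := (fine U - fine (u x) + 1) / z f.
  have Jx := JU _ _ C_set0 below_0.
  have b0 : 0 <= b by rewrite divr_ge0 ?(ltW zf)//; move: Jx; lra.
  have Cbf : C (fun w => b * f w).
    by have := C_set_lin b0 Cf C_set0; under eq_fun do rewrite addr0.
  have := zJ _ (fun w => - b * f w) (fine (u x)) Cbf (orliczZ hY _ Vf).
  have -> : (fun w => u (x + (b * f w + - b * f w))) = (fun w => u (x + 0)).
    by apply/funext => w; congr u; ring.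
  move=> /(_ below_0); rewrite (linear_onZ hY _ zlin Vf) mulNr /b divfK ?gt_eqF//.
  by lra.
have zpos : dual_le P (uhat u) (fun=> 0) z by exact: polar_positive.
have V1 := orlicz_cst P hY 1.
have z1 : 0 < z (cst 1).
  rewrite lt_def zpos//; last by apply: aeW => w /=.
  rewrite andbT; apply/eqP => z10.
  move: hsup; rewrite ltNge => /negP; apply.
  rewrite (u_infty_sup hu); apply: ge_ereal_sup => _ [y _ <-].
  (* The constant displacement [b] lifts [x] to at least [y]; if [z] vanished at 1 it would cost
     nothing, and every [u y] would be at most [U]. *)
  pose b := Num.max (y - x) 0.
  have xb : x <= x + b by rewrite lerDl le_max lexx orbT.
  have ub : u (x + b) \is a fin_num.
    by apply: (utility_fin_num hu); apply: lt_le_trans hx _; rewrite lee_fin.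
  have := zJ _ (fun w => b * 1) (fine (u (x + b))) C_set0 (orliczZ hY b V1).
  rewrite (linear_onZ hY _ zlin V1) [z _]z10 mulr0 addr0 => le.
  apply: (@le_trans _ _ (u (x + b))).
    by apply: (utility_mono hu); rewrite -lerBlDl le_max lexx.
  rewrite -(fineK ub) UE lee_fin; apply: le.
  exists (fun=> fine (u (x + b))); split; [exact: Lone_cst| |by rewrite Ex_cst].
  by apply: aeW => w; rewrite add0r mulr1 fineK.
exists (z (cst 1)), (fun f => (z (cst 1))^-1 * z f); split => //.
- split; last by rewrite mulVf// gt_eqF.
  split.
    have z0d := dualB hY zd zd.
    have := dual_lin hY (z (cst 1))^-1 zd z0d; congr (dual _ _ _).
    by apply/funext => f; ring.
  by move=> f Cf; rewrite mulr_ge0_le0 ?zC// invr_ge0 ltW.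
- move=> f eta Vf etai etaf; rewrite mulrA mulfV ?gt_eqF// mul1r.
  apply: (zJ (fun=> 0)) => //; first exact: C_set0.
  exists eta; split => //; apply: filterS etaf => w; by rewrite add0r.
Qed.

Lemma cone_duality : [/\ M_set P u K !=set0,
  U = ereal_sup (utilities P u C x) & is_minimum U (dual_values P u K x)].
Proof.
have UE : U = (fine U)%:E by rewrite fineK// sup_utilities_fin_num.
have weak : lbound (dual_values P u K x) U.
  move=> _ [lambda [Q [l0 [QC Q1] ->]]]; have [Qd Qneg] := QC.
  rewrite sup_utilities_C; apply: ge_ereal_sup => _ [f Cf <-]; have [Vf _] := Cf.
  apply: le_from_reals => r /(below_lt (orlicz_measurable Vf))[eta [etai etaf rE]].
  apply: (@le_trans _ _ (Ex P eta)%:E); first by rewrite lee_fin.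
  apply: (weak_duality ha hu Qd (polar_positive QC) l0 Q1 Vf _ etai etaf).
  exact: Qneg.
have [lambda [Q [l0 MQ opt]]] := dual_optimizer; have [QC Q1] := MQ.
split; [by exists Q|exact: sup_utilities_C|split=> //].
exists lambda, Q; split => //; apply/le_anti/andP; split.
  by apply: weak; exists lambda, Q.
have [Qd _] := QC; rewrite [leRHS]UE.
exact: (strong_duality ha hu Qd (polar_positive QC) l0 Q1 opt).
Qed.

End ConeDuality.

Theorem theorem21 (R : realType) (disp : measure_display)
  (Omega : measurableType disp) (P : probability Omega R)
  (T : \bar R) (F : \bar R -> set (set Omega))
  (d : nat) (hd : (0 < d)%N) (S : \bar R -> Omega -> 'rV[R]_d)
  (hS : market P T F S)
  (a : \bar R) (u : R -> \bar R) (ha : (a < 0)%E) (hu : utility a u)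
  (W : Omega -> R) (hW : orlicz P (uhat u) W) (hW0 : ae_le P (cst 0) W)
  (x : R) (hx : (a < x%:E)%E)
  (hsup : (ereal_sup (utilities P u (K_set P T F S W) x) < u_infty u)%E) :
  let K := K_set P T F S W in
  let C := C_set P u K in
  let U := ereal_sup (utilities P u K x) in
  [/\ M_set P u K !=set0,
      U = ereal_sup (utilities P u C x)
    & is_minimum U (dual_values P u K x)].
Proof.
have [T0 hF _ hSj] := hS.
have Sj j : adapted T F (coordinate S j) /\ cadlag T (coordinate S j).
  by have [[? ? _] _] := hSj j.
apply: (cone_duality ha hu hW hx _ _ _ _ hsup).
- exact: (K_set0 hF Sj hW0).
- by move=> b k k'; exact: (K_set_lin hF Sj).
- by move=> k; exact: (K_set_measurable T0 hF).
- by move=> k; exact: (K_set_ge T0).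
Qed.
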